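(* Let $\alpha>0$, $\varphi(z)=\alpha(\log^+|z|)^2$, and let $p\in\{2,\infty\}$. Then: (i) every $d_\rho$-separated sequence $\Lambda\subset\mathbb{C}$ with $D^+(\Lambda)<2\alpha$ is a set of interpolation for $\mathcal{F}^p_\varphi$; (ii) if a sequence $\Lambda\subset\mathbb{C}$ is a set of interpolation for $\mathcal{F}^p_\varphi$, then it is a $d_\rho$-separated sequence with $D^+(\Lambda)\le2\alpha$.
   Context: Here $\log^+ t=\max(\log t,0)$ and $m$ is planar Lebesgue measure. Sequences $\Lambda\subset\mathbb{C}$ are (countable) sets of distinct points. Put $d_\rho(z,w)=\sqrt{2\alpha}\,\frac{|z-w|}{\sqrt{2\alpha}+\min(|z|,|w|)}$; $\Lambda$ is $d_\rho$-separated if $\inf\{d_\rho(z,w):z,w\in\Lambda,\ z\neq w\}>0$. With $\mathcal{A}(r,R)=\{z: r\le|z|<R\}$, the upper density is $$D^+(\Lambda)=\limsup_{R\to+\infty}\limsup_{r\to+\infty}\frac{\operatorname{Card}(\Lambda\cap\mathcal{A}(r,Rr))}{\log R}.$$ $\mathcal{F}^2_\varphi$ is the Hilbert space of entire functions $f$ with $\|f\|_{\varphi,2}^2=\int_{\mathbb{C}}|f|^2e^{-2\varphi}\,dm<\infty$; $\mathbf{k}_z$ is its reproducing kernel at $z$. $\mathcal{F}^\infty_\varphi$ is the space of entire functions $f$ with $\|f\|_{\varphi,\infty}=\sup_{z\in\mathbb{C}}|f(z)|e^{-\varphi(z)}<\infty$. $\Lambda$ is (a set of) interpolation for $\mathcal{F}^2_\varphi$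 if for every $v=(v_\lambda)_{\lambda\in\Lambda}$ with $\sum_{\lambda\in\Lambda}|v_\lambda|^2/\mathbf{k}_\lambda(\lambda)<\infty$ there is $f\in\mathcal{F}^2_\varphi$ with $f|_\Lambda=v$; it is (a set of) interpolation for $\mathcal{F}^\infty_\varphi$ if for every $v$ with $\sup_{\lambda\in\Lambda}|v_\lambda|e^{-\varphi(\lambda)}<\infty$ there is $f\in\mathcal{F}^\infty_\varphi$ with $f|_\Lambda=v$. *)

(* Defs.v *)
From HB Require Import structures.
From mathcomp Require Import all_boot all_order all_algebra.
From mathcomp Require Import complex.
From mathcomp Require Import all_classical all_reals all_analysis.
Set Implicit Arguments.
Unset Strict Implicit.
Unset Printing Implicit Defensive.
Import Order.TTheory GRing.Theory Num.Theory.
Import numFieldNormedType.Exports.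
Local Open Scope classical_set_scope.
Local Open Scope complex_scope.
Local Open Scope ring_scope.

(* The norm [`|z|] of [R[i]] is again a complex number; [cabs z] is the modulus
   as an element of [R]. *)
Definition cabs (R : realType) (z : R[i]) : R := ComplexField.Normc.normc z.

(* [ln 0 = 0] in the library, hence [logplus 0 = 0] as required. *)
Definition logplus (R : realType) (t : R) : R := Num.max (ln t) 0.

Definition log_weight (R : realType) (alpha : R) (z : R[i]) : R :=
  alpha * logplus (cabs z) ^+ 2.

Definition entire (R : realType) (f : R[i] -> R[i]) : Prop :=
  forall z : R[i]^o, derivable (f : R[i]^o -> R[i]^o) z 1.

(* Planar Lebesgue measure lives on [R * R]; functions on [R[i]] are
   integrated through the identification of [(x, y)] with [x + iy]. *)
Notation plane_measure R := (@lebesgue_measure R \x @lebesgue_measure R)%E.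

Definition toC (R : realType) (p : R * R) : R[i] := p.1 +i* p.2.

Definition integralC (R : realType) (g : R[i] -> R[i]) : R[i] :=
  Rintegral (plane_measure R) setT (fun p => complex.Re (g (toC p))) +i*
  Rintegral (plane_measure R) setT (fun p => complex.Im (g (toC p))).

Section Fock.
Variables (R : realType) (phi : R[i] -> R).

Definition sqnorm2 (f : R[i] -> R[i]) : \bar R :=
  (\int[plane_measure R]_(p in setT)
     (cabs (f (toC p)) ^+ 2 * expR (- (2 * phi (toC p))))%:E)%E.

Definition fock2 : set (R[i] -> R[i]) :=
  [set f | entire f /\ (sqnorm2 f < +oo)%E].

Definition dot2 (f g : R[i] -> R[i]) : R[i] :=
  integralC (fun w => f w * (g w)^* * (expR (- (2 * phi w)))%:C).

Definition is_kernel_at (z : R[i]) (k : R[i] -> R[i]) : Prop :=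
  fock2 k /\ forall f, fock2 f -> f z = dot2 f k.

(* Such a [k] is unique, and exists as soon as evaluation at [z] is bounded;
   the default value 0 is a convention for weights where it is not. *)
Definition repro_kernel (z : R[i]) : R[i] -> R[i] :=
  xget (fun=> 0) [set k | is_kernel_at z k].

Definition normoo (f : R[i] -> R[i]) : \bar R :=
  ereal_sup [set (cabs (f z) * expR (- phi z))%:E | z in [set: R[i]]].

Definition fockoo : set (R[i] -> R[i]) :=
  [set f | entire f /\ (normoo f < +oo)%E].

(* A family indexed by [L] is a function [v] on [R[i]], of which only the
   restriction to [L] is used. *)
Definition interpolation2 (L : set R[i]) : Prop :=
  forall v : R[i] -> R[i],
    (\esum_(l in L) (cabs (v l) ^+ 2 / complex.Re (repro_kernel l l))%:E < +oo)%E ->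
  exists2 f, fock2 f & forall l, L l -> f l = v l.

Definition interpolationoo (L : set R[i]) : Prop :=
  forall v : R[i] -> R[i],
    (ereal_sup [set (cabs (v l) * expR (- phi l))%:E | l in L] < +oo)%E ->
  exists2 f, fockoo f & forall l, L l -> f l = v l.

End Fock.

Inductive exponent := exp2 | expoo.

Definition interpolation (R : realType) (phi : R[i] -> R) (p : exponent) :
    set R[i] -> Prop :=
  match p with
  | exp2 => interpolation2 phi
  | expoo => interpolationoo phi
  end.

Definition d_rho (R : realType) (alpha : R) (z w : R[i]) : R :=
  Num.sqrt (2 * alpha) * (cabs (z - w) /
    (Num.sqrt (2 * alpha) + Num.min (cabs z) (cabs w))).

(* The infimum is taken in [\bar R], where that of the empty set is [+oo]: sets
   with at most one point are separated. *)
Definition d_rho_separated (R : realType) (alpha : R) (L : set R[i]) : Prop :=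
  (0 < ereal_inf [set (d_rho alpha q.1 q.2)%:E |
                   q in [set q : R[i] * R[i] | L q.1 /\ L q.2 /\ q.1 <> q.2]])%E.

Definition annulus (R : realType) (r s : R) : set R[i] :=
  [set z | r <= cabs z < s].

Definition upper_density (R : realType) (L : set R[i]) : \bar R :=
  limf_esup (fun s : R =>
    limf_esup (fun r : R =>
      (counting (L `&` annulus r (s * r)) * ((ln s)^-1)%:E)%E)
    (pinfty_nbhs R)) (pinfty_nbhs R).

(* Main.v *)
Require Import Defs.
From HB Require Import structures.
From mathcomp Require Import all_boot all_order all_algebra.
From mathcomp Require Import complex ring lra zify.
From mathcomp Require Import all_classical all_reals all_analysis measurable_realfun.
Set Implicit Arguments.
Unset Strict Implicit.
Unset Printing Implicit Defensive.
Import Order.TTheory GRing.Theory Num.Theory.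
Import numFieldNormedType.Exports.
Local Open Scope classical_set_scope.
Local Open Scope ring_scope.

(* Everything is measured in the logarithmic coordinate t = log+ |z|, in which
   the weight is alpha t^2 and the terms of a power series in the Fock space are
   dominated near t by the exponent n = 2 alpha t, with Gaussian decay in
   n - 2 alpha t.

   Necessity: an interpolating function has a Taylor series with coefficients
   bounded by M exp(-(n + kappa)^2 / (4 alpha)), kappa = 0 for p = oo and
   kappa = 1 for p = 2.  Such a series varies slowly, which gives separation, and
   if it is large at one point l and vanishes at the other points of a window
   |t - t_l| <= s, then comparing the Taylor coefficients of its quotient by the
   polynomial of these zeros at the two ends of the window bounds the sum of
   s - |t - t_l| over the zeros by 2 alpha s^2 + O(s).  Averaging over l gives the
   density bound.

   Sufficiency: when the density is below 2 alpha, the polynomial vanishing at the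
   other points of L and equal to 1 at l, corrected by a power of z / l, decays
   like exp(- 3 |t - t_l|) relative to the weight.  Solving the interpolation
   problem on successive annuli of large logarithmic width T by such polynomials
   makes the error introduced on later annuli geometrically small.

   For p = 2 the monomials are orthogonal by rotation invariance, so the kernel
   is a power series, comparable on the diagonal to exp(2 alpha t^2 - 2 t). *)

(** * Complex limits and power series *)

(** Interpolation is assumed without any constant of interpolation. In the necessity half,
    configurations violating a uniform bound are therefore gathered into one sequence whose k-th
    member carries the value [2^-1 ^+ k], and the k-th violation is chosen much worse than this
    loss. Such data are bounded and square summable at once, so one argument serves both exponents.
    Since [entire] means complex differentiable at every point, power series have to be extracted
    first. Contour integrals become trapezoidal sums and means over [2 ^ k]-th roots of unity, for
    which subdivision, cancellation of edges and orthogonality of monomials of low degree are exact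
    identities. The role of [kappa] comes from completing a square: exp(n t - (n + kappa)^2 / (4
    alpha)) peaks at n = 2 alpha t - kappa with height exp(alpha t^2 - kappa t). The square norm of
    z^n is of order exp((n + 1)^2 / (2 alpha)), whence kappa = 1 for p = 2. Of the rate 3 of the
    peak polynomials, one unit absorbs the change of exp(- kappa t) from point to point, and two
    make the corrections summable and, for p = 2, square integrable. *)

Section Modulus.
Variable R : realType.
Implicit Types (z w : R[i]).

Lemma cabs_norm z : `|z| = (cabs z)%:C%C. Proof. by []. Qed.

Lemma cabs_ge0 z : 0 <= cabs z.
Proof. by case: z => a b; rewrite /cabs /= sqrtr_ge0. Qed.

Lemma cabs0 : cabs (0 : R[i]) = 0. Proof. exact: ComplexField.Normc.normc0. Qed.
Lemma cabs1 : cabs (1 : R[i]) = 1. Proof. exact: ComplexField.Normc.normc1. Qed.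

Lemma cabs_eq0 z : (cabs z == 0) = (z == 0).
Proof.
apply/eqP/eqP => [/ComplexField.Normc.eq0_normc//|->]; exact: cabs0.
Qed.

Lemma cabs_gt0 z : (0 < cabs z) = (z != 0).
Proof. by rewrite lt_def cabs_ge0 andbT cabs_eq0. Qed.

Lemma cabsM z w : cabs (z * w) = cabs z * cabs w.
Proof. exact: ComplexField.Normc.normcM. Qed.

Lemma cabsV z : cabs z^-1 = (cabs z)^-1.
Proof. exact: ComplexField.Normc.normcV. Qed.

Lemma cabs_div z w : cabs (z / w) = cabs z / cabs w.
Proof. by rewrite cabsM cabsV. Qed.

Lemma cabsN z : cabs (- z) = cabs z. Proof. exact: normcN. Qed.

Lemma cabsX z n : cabs (z ^+ n) = cabs z ^+ n.
Proof. by elim: n => [|n ih]; rewrite ?expr0 ?cabs1// !exprS cabsM ih. Qed.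

Lemma cabsD z w : cabs (z + w) <= cabs z + cabs w.
Proof. exact: le_normcD. Qed.

Lemma cabsB z w : cabs (z - w) <= cabs z + cabs w.
Proof. by rewrite -(cabsN w) cabsD. Qed.

Lemma cabs_distC z w : cabs (z - w) = cabs (w - z).
Proof. by rewrite -cabsN opprB. Qed.

Lemma cabs_distD u z w : cabs (z - w) <= cabs (z - u) + cabs (u - w).
Proof. by rewrite (_ : z - w = (z - u) + (u - w)) ?cabsD//; ring. Qed.

Lemma cabs_lb z w : cabs z - cabs w <= cabs (z - w).
Proof. by rewrite lerBlDr -{1}(subrK w z) cabsD. Qed.

Lemma cabsR (x : R) : cabs x%:C%C = `|x|.
Proof. by rewrite /cabs /= expr0n /= addr0 sqrtr_sqr. Qed.

Lemma cabsMr (x : R) z : cabs (x%:C%C * z) = `|x| * cabs z.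
Proof. by rewrite cabsM cabsR. Qed.

Lemma cabs_nat n : cabs (n%:R : R[i]) = n%:R.
Proof. by rewrite -(rmorph_nat (real_complex R)) cabsR ger0_norm. Qed.

Lemma cabs_sum (I : Type) (r : seq I) (P : pred I) (F : I -> R[i]) :
  cabs (\sum_(i <- r | P i) F i) <= \sum_(i <- r | P i) cabs (F i).
Proof.
elim/big_ind2 : _ => //; first by rewrite cabs0.
by move=> x1 x2 y1 y2 h1 h2; rewrite (le_trans (cabsD _ _))// lerD.
Qed.

Lemma cabs_prod (I : Type) (r : seq I) (P : pred I) (F : I -> R[i]) :
  cabs (\prod_(i <- r | P i) F i) = \prod_(i <- r | P i) cabs (F i).
Proof.
by elim/big_ind2 : _ => // [|x1 x2 y1 y2 <- <-]; rewrite ?cabs1// cabsM.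
Qed.

Lemma Re_le_cabs z : `|complex.Re z| <= cabs z.
Proof.
case: z => a b; rewrite /cabs /= -sqrtr_sqr ler_sqrt ?addr_ge0 ?sqr_ge0//.
by rewrite lerDl sqr_ge0.
Qed.

Lemma Im_le_cabs z : `|complex.Im z| <= cabs z.
Proof.
case: z => a b; rewrite /cabs /= -sqrtr_sqr ler_sqrt ?addr_ge0 ?sqr_ge0//.
by rewrite lerDr sqr_ge0.
Qed.

Lemma cabs_le_ReIm z : cabs z <= `|complex.Re z| + `|complex.Im z|.
Proof.
case: z => a b; rewrite /cabs /= -ler_sqr ?nnegrE ?sqrtr_ge0 ?addr_ge0//.
rewrite sqr_sqrtr ?addr_ge0 ?sqr_ge0// sqrrD !real_normK ?num_real//.
by have := mulr_ge0 (normr_ge0 a) (normr_ge0 b); lra.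
Qed.

Lemma cabs_conj z : cabs (z^*)%C = cabs z.
Proof. by case: z => a b; rewrite /cabs /= sqrrN. Qed.

Lemma cabs_sqr z : cabs z ^+ 2 = complex.Re z ^+ 2 + complex.Im z ^+ 2.
Proof.
by case: z => a b; rewrite /cabs /= sqr_sqrtr// addr_ge0 ?sqr_ge0.
Qed.

End Modulus.

(** * Limits and absolutely convergent series of complex numbers *)

Section ComplexLimits.
Variable R : realType.
Implicit Types (u : nat -> R[i]) (z w : R[i]).

(** The tolerance is real and the inequality large, which keeps all later estimates in [R], away
    from the partial order of [R[i]]. *)
Definition cvgC u z := forall e : R, 0 < e ->
  exists N, forall n, (N <= n)%N -> cabs (u n - z) <= e.

Lemma cvgC_unique u z w : cvgC u z -> cvgC u w -> z = w.
Proof.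
move=> uz uw; apply/eqP; rewrite -subr_eq0 -cabs_eq0 eq_le cabs_ge0 andbT.
apply/ler_addgt0Pl => e e0; rewrite addr0.
have e2 : 0 < e / 2 by rewrite divr_gt0.
have [N1 h1] := uz _ e2; have [N2 h2] := uw _ e2.
have := h1 (maxn N1 N2) (leq_maxl _ _); have := h2 (maxn N1 N2) (leq_maxr _ _).
set a := u _ => h3 h4; rewrite (le_trans (cabs_distD a _ _))// (cabs_distC z).
by rewrite [leRHS](splitr e) lerD.
Qed.

Lemma cvgC_cst z : cvgC (fun=> z) z.
Proof. by move=> e e0; exists 0%N => n _; rewrite subrr cabs0 ltW. Qed.

Lemma cvgCD u1 u2 z w : cvgC u1 z -> cvgC u2 w ->
  cvgC (fun n => u1 n + u2 n) (z + w).
Proof.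
move=> uz uw e e0; have e2 : 0 < e / 2 by rewrite divr_gt0.
have [N1 h1] := uz _ e2; have [N2 h2] := uw _ e2.
exists (maxn N1 N2) => n; rewrite geq_max => /andP[/h1 h3 /h2 h4].
rewrite (_ : _ - _ = (u1 n - z) + (u2 n - w)); last by ring.
by rewrite (le_trans (cabsD _ _))// [leRHS](splitr e) lerD.
Qed.

Lemma cvgCZ u z w : cvgC u z -> cvgC (fun n => w * u n) (w * z).
Proof.
move=> uz e e0; have c1 : 0 < cabs w + 1 by rewrite ltr_wpDl ?cabs_ge0.
have [N h] := uz (e / (cabs w + 1)) (divr_gt0 e0 c1).
exists N => n /h; rewrite ler_pdivlMr// -mulrBr cabsM => hn.
rewrite (le_trans _ hn)// mulrC ler_wpM2l ?cabs_ge0//; lra.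
Qed.

Lemma cvgCN u z : cvgC u z -> cvgC (fun n => - u n) (- z).
Proof.
by move=> uz e /uz[N h]; exists N => n /h; rewrite -opprD cabsN.
Qed.

Lemma cvgC_shift u z k : cvgC u z -> cvgC (fun n => u (n + k)%N) z.
Proof.
by move=> uz e /uz[N h]; exists N => n Nn; apply: h; rewrite (leq_trans Nn)// leq_addr.
Qed.

Lemma cvgC_le u z (B : R) N : cvgC u z ->
  (forall n, (N <= n)%N -> cabs (u n) <= B) -> cabs z <= B.
Proof.
move=> uz uB; apply/ler_addgt0Pl => e /uz[N1 h].
have := h (maxn N N1) (leq_maxr _ _); have := uB (maxn N N1) (leq_maxl _ _).
move: (u _) => a h1 h2.
rewrite (_ : z = a - (a - z)); last by ring.
by rewrite (le_trans (cabsB _ _))// addrC lerD.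
Qed.

Lemma cvgC_dist_le u z w (B : R) N : cvgC u z ->
  (forall n, (N <= n)%N -> cabs (u n - w) <= B) -> cabs (z - w) <= B.
Proof.
move=> uz; apply: cvgC_le.
by apply: (cvgCD uz (cvgC_cst (- w))).
Qed.

Lemma cvgC_bound u z : (exists2 v : nat -> R, v @ \oo --> 0 &
   forall n, cabs (u n - z) <= v n) -> cvgC u z.
Proof.
move=> [v v0 uv] e e0; move/cvgrPdist_le : v0 => /(_ _ e0)[N _ h].
exists N => n /h /=; rewrite sub0r normrN => vn.
by rewrite (le_trans (uv n))// (le_trans (ler_norm _)).
Qed.

Lemma cauchy_cvgR (u : nat -> R) : (forall e : R, 0 < e -> exists N,
  forall m n, (N <= m)%N -> (N <= n)%N -> `|u m - u n| <= e) ->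
  exists l : R, u @ \oo --> l.
Proof.
move=> h; apply/cvg_ex; apply/cauchy_cvgP/cauchy_exP => e e0.
have [N hN] := h (e / 2) (divr_gt0 e0 (ltr0n _ 2)).
exists (u N); exists N => // n Nn; rewrite /ball /=.
rewrite (@le_lt_trans _ _ (e / 2)) ?hN//.
by rewrite gtr_pMr// invf_lt1// ltr1n.
Qed.

Lemma cauchy_cvgC u : (forall e : R, 0 < e -> exists N,
  forall m n, (N <= m)%N -> (N <= n)%N -> cabs (u m - u n) <= e) ->
  exists z, cvgC u z.
Proof.
move=> h.
have [a ha] : exists l : R, (fun n => complex.Re (u n)) @ \oo --> l.
  apply: cauchy_cvgR => e /h[N hN]; exists N => m n Nm Nn /=.
  rewrite (le_trans _ (hN m n Nm Nn))// (_ : _ - _ = complex.Re (u m - u n)) ?Re_le_cabs//.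
  by case: (u m) (u n) => x y [].
have [b hb] : exists l : R, (fun n => complex.Im (u n)) @ \oo --> l.
  apply: cauchy_cvgR => e /h[N hN]; exists N => m n Nm Nn /=.
  rewrite (le_trans _ (hN m n Nm Nn))// (_ : _ - _ = complex.Im (u m - u n)) ?Im_le_cabs//.
  by case: (u m) (u n) => x y [].
exists (a +i* b)%C => e e0; have e2 : 0 < e / 2 by rewrite divr_gt0.
move/cvgrPdist_le : ha => /(_ _ e2)[N1 _ h1].
move/cvgrPdist_le : hb => /(_ _ e2)[N2 _ h2].
exists (maxn N1 N2) => n; rewrite geq_max => /andP[/h1 /= h3 /h2 /= h4].
rewrite (le_trans (cabs_le_ReIm _))// [leRHS](splitr e).
by move: h3 h4; case: (u n) => x y /= h3 h4; rewrite lerD// distrC.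
Qed.

(** Divergent sequences get the default 0; each use of [sumC] comes with an absolute bound that
    excludes this case. *)
Definition limC u : R[i] := xget 0 [set z | cvgC u z].

Lemma limCP u z : cvgC u z -> limC u = z.
Proof. move=> uz; apply: cvgC_unique (uz); rewrite /limC.
by case: xgetP => [_ -> //|/(_ z)]. Qed.

Definition sumC u : R[i] := limC (fun n => \sum_(k < n) u k).

Definition summable_below (v : nat -> R) (B : R) := forall N, \sum_(k < N) v k <= B.

Lemma summable_tail (v : nat -> R) B : (forall k, 0 <= v k) -> summable_below v B ->
  forall e, 0 < e -> exists N, forall n, \sum_(N <= k < n) v k <= e.
Proof.
move=> v0 vB e e0.
have : cvgn (series v).
  apply: nondecreasing_is_cvgn; first by apply: nondecreasing_series => n _ _; exact: v0.
  by exists B => _ [n _ <-]; rewrite /series /= big_mkord; exact: vB.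
move/cauchy_cvgP/cauchy_seriesP => /(_ _ e0)[[P Q] /= [[N1 _ hP] [N2 _ hQ]] h].
exists (maxn N1 N2) => n; have [Nn|nN] := leqP (maxn N1 N2) n; last first.
  by rewrite (big_geq (ltnW nN)); exact: ltW.
rewrite (le_trans (ler_norm _))// ltW//.
apply: (h (maxn N1 N2, n)); split => /=; first by apply: hP; rewrite /= leq_maxl.
by apply: hQ; rewrite /= (leq_trans (leq_maxr _ _) Nn).
Qed.

Lemma big_ord_cat (V : zmodType) (f : nat -> V) m n : (m <= n)%N ->
  \sum_(k < n) f k - \sum_(k < m) f k = \sum_(m <= k < n) f k.
Proof.
move=> mn; rewrite -!(big_mkord xpredT f).
by rewrite [X in X - _](big_cat_nat (leq0n m) mn)//= addrAC subrr add0r.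
Qed.

Lemma sumC_cvg u (v : nat -> R) B : (forall k, cabs (u k) <= v k) ->
  summable_below v B -> cvgC (fun n => \sum_(k < n) u k) (sumC u).
Proof.
move=> uv vB; have v0 k : 0 <= v k by rewrite (le_trans (cabs_ge0 _) (uv k)).
suff [z uz] : exists z, cvgC (fun n => \sum_(k < n) u k) z by rewrite /sumC (limCP uz).
apply: cauchy_cvgC => e e0; have [N hN] := summable_tail v0 vB e0.
exists N.
have key m n : (N <= m <= n)%N -> cabs (\sum_(k < n) u k - \sum_(k < m) u k) <= e.
  move=> /andP[Nm mn]; rewrite big_ord_cat//.
  rewrite (le_trans (cabs_sum _ _ _))// (le_trans (ler_sum _ (fun k _ => uv k)))//.
  rewrite (le_trans _ (hN n))// [leRHS](big_cat_nat Nm)//= lerDr.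
  by apply: sumr_ge0 => k _.
move=> m n Nm Nn; case/orP : (leq_total m n) => mn.
  by rewrite cabs_distC key// Nm.
by rewrite key// Nn.
Qed.

Lemma sumC_le u (v : nat -> R) B : (forall k, cabs (u k) <= v k) ->
  summable_below v B -> cabs (sumC u) <= B.
Proof.
move=> uv vB; apply: (@cvgC_le _ _ _ 0 (sumC_cvg uv vB)) => n _.
by rewrite (le_trans (cabs_sum _ _ _))// (le_trans _ (vB n))// ler_sum.
Qed.

End ComplexLimits.

(** * Complex differentiability and series of polynomials *)

Section Entire.
Variable R : realType.
Implicit Types (p : {poly R[i]}) (z w : R[i]) (f : R[i] -> R[i]).

(** First-order expansion with explicit error. It matches derivability in the direction 1 because
    every complex increment is a complex multiple of 1. *)
Definition diffC f z d := forall e : R, 0 < e -> exists2 r : R, 0 < r &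
  forall h, cabs h < r -> cabs (f (z + h) - f z - d * h) <= e * cabs h.

Lemma diffC_derivable f z d : diffC f z d ->
  derivable (f : R[i]^o -> R[i]^o) z 1.
Proof.
move=> fz; apply/cvg_ex; exists (d : R[i]^o); apply/cvgrPdist_le => e e0.
have {e e0}[e1 e0 ->] : exists2 e1 : R, 0 < e1 & e = e1%:C%C.
  case: e e0 => a b; rewrite ltcE /= => /andP[/eqP -> a0]; by exists a.
have [r r0 hr] := fz _ e0.
near=> h.
have h0 : h != 0 by near: h; exact: nbhs_dnbhs_neq.
rewrite cabs_norm lecR.
rewrite (_ : _ - _ = - h^-1 * (f (z + h) - f z - d * h)); last first.
  by rewrite /GRing.scale /= mulr1 (addrC h z); field.
rewrite cabsM cabsN cabsV mulrC ler_pdivrMr ?cabs_gt0//.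
apply: hr; near: h; apply: nbhs_dnbhs.
have := @nbhsx_ballx _ R[i]^o 0 r%:C%C; rewrite ltcR => /(_ r0).
by apply: filterS => h; rewrite /ball /= sub0r normrN cabs_norm ltcR.
Unshelve. all: by end_near. Qed.

Lemma derivable_diffC f z : derivable (f : R[i]^o -> R[i]^o) z 1 ->
  exists d, diffC f z d.
Proof.
move=> /cvg_ex[d /cvgrPdist_le fd]; exists d => e e0.
have := fd e%:C%C; rewrite ltcR => /(_ e0)/nbhs_ballP[a /= a0].
have {a a0}[r r0 ->] : exists2 e1 : R, 0 < e1 & a = e1%:C%C.
  case: a a0 => a b; rewrite ltcE /= => /andP[/eqP -> a0]; by exists a.
move=> hr; exists r => // h hh.
have [->|h0] := eqVneq h 0; first by rewrite addr0 subrr mulr0 subr0 cabs0 mulr0.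
have /= := hr h; rewrite /ball /= sub0r normrN cabs_norm ltcR => /(_ hh h0).
rewrite cabs_norm lecR.
rewrite (_ : _ - _ = - h^-1 * (f (z + h) - f z - d * h)); last first.
  by rewrite /GRing.scale /= mulr1 (addrC h z); field.
by rewrite cabsM cabsN cabsV mulrC ler_pdivrMr ?cabs_gt0.
Qed.

Lemma entireP f : entire f <-> forall z, exists d, diffC f z d.
Proof.
split=> h z; first exact: derivable_diffC (h z).
by have [d /diffC_derivable] := h z.
Qed.

(** Preferred to the supremum over a circle: it controls value, derivative and second-order
    remainder by comparison of coefficients, and behaves well under products. *)
Definition majorant p (r : R) := \sum_(i < size p) cabs p`_i * r ^+ i.

Lemma majorant_ge0 p r : 0 <= r -> 0 <= majorant p r.
Proof. by move=> r0; apply: sumr_ge0 => i _; rewrite mulr_ge0 ?cabs_ge0 ?exprn_ge0. Qed.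

Lemma horner_majorant p z : cabs p.[z] <= majorant p (cabs z).
Proof.
rewrite horner_coef (le_trans (cabs_sum _ _ _))// ler_sum// => i _.
by rewrite cabsM cabsX.
Qed.

Lemma deriv_sum p z : p^`().[z] = \sum_(i < size p) p`_i * (i%:R * z ^+ i.-1).
Proof.
rewrite [in LHS](_ : p = \sum_(i < size p) p`_i *: 'X^i); last by rewrite -poly_def coefK.
rewrite raddf_sum horner_sum; apply: eq_bigr => i _.
by rewrite /= derivZ derivXn hornerZ hornerMn hornerXn mulr_natl.
Qed.

(** Enlarging the radius by 1 pays for one differentiation, since i r^(i - 1) is one of the terms of
    the binomial expansion of (r + 1)^i. *)
Lemma deriv_majorant p z : cabs p^`().[z] <= majorant p (cabs z + 1).
Proof.
rewrite deriv_sum (le_trans (cabs_sum _ _ _))// ler_sum// => -[i _] _ /=.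
rewrite !cabsM cabsX cabs_nat ler_wpM2l ?cabs_ge0//.
have := cabs_ge0 z; move: (cabs z) => r r0.
elim: i => [|i ih] /=; first by rewrite mul0r expr0 ler01.
have r1 : 0 <= r ^+ i by rewrite exprn_ge0.
have : r ^+ i <= (r + 1) ^+ i by rewrite lerXn2r// ?nnegrE ?addr_ge0// lerDl.
rewrite exprS -natr1 mulrDl mul1r mulrDl mul1r => h; rewrite lerD//.
rewrite (le_trans _ (ler_wpM2l r0 ih))//.
by case: (i) => [|j]; rewrite ?mul0r ?mulr0//= mulrCA -exprS.
Qed.

(** The part of (z + w)^n beyond first order has nonnegative coefficients, so after extracting |w|^2
    it is dominated by the same expression at |z| and 1. *)
Lemma taylor2_majorant p z w : cabs w <= 1 ->
  cabs (p.[z + w] - p.[z] - p^`().[z] * w) <= cabs w ^+ 2 * majorant p (cabs z + 1).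
Proof.
move=> w1; rewrite deriv_sum !horner_coef mulr_suml -!sumrB /majorant mulr_sumr.
rewrite (le_trans (cabs_sum _ _ _))// ler_sum// => -[i _] _ /=.
rewrite -mulrA -!mulrBr cabsM mulrCA ler_wpM2l ?cabs_ge0//.
have := cabs_ge0 z; have := cabs_ge0 w; set a := cabs w; set r := cabs z => a0 r0.
have step n : cabs ((z + w) ^+ n - z ^+ n - n%:R * z ^+ n.-1 * w) <=
    a ^+ 2 * ((r + 1) ^+ n - r ^+ n - n%:R * r ^+ n.-1).
  elim: n => [|n ih]; first by rewrite !expr0 !mul0r !subrr cabs0 mulr0.
  rewrite (_ : _ - _ = (z + w) * ((z + w) ^+ n - z ^+ n - n%:R * z ^+ n.-1 * w)
     + n%:R * z ^+ n.-1 * w ^+ 2); last first.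
    rewrite !exprS -natr1 /=; case: n ih => [|n] ih; first by rewrite !expr0; ring.
    by rewrite /= !exprS; ring.
  rewrite (_ : (r + 1) ^+ n.+1 - _ - _ = (r + 1) * ((r + 1) ^+ n - r ^+ n - n%:R * r ^+ n.-1)
     + n%:R * r ^+ n.-1); last first.
    rewrite !exprS -natr1 /=; case: n ih => [|n] ih; first by rewrite !expr0; ring.
    by rewrite /= !exprS; ring.
  rewrite (le_trans (cabsD _ _))// [leRHS]mulrDr lerD//; last first.
    by rewrite !cabsM !cabsX cabs_nat mulrC.
  rewrite cabsM mulrCA ler_pM ?cabs_ge0// (le_trans (cabsD _ _))// lerD//.
rewrite (le_trans (step i))// ler_wpM2l ?sqr_ge0//.
have : 0 <= r ^+ i by rewrite exprn_ge0.
have : 0 <= i%:R * r ^+ i.-1 by rewrite mulr_ge0 ?exprn_ge0.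
by lra.
Qed.

Definition summable_polys (h : nat -> {poly R[i]}) := forall r : R, 0 <= r ->
  exists B, summable_below (fun k => majorant (h k) r) B.

Section PolySeries.
Variable h : nat -> {poly R[i]}.
Hypothesis hsum : summable_polys h.
Let F z := sumC (fun k => (h k).[z]).

Lemma poly_series_cvg z : cvgC (fun n => \sum_(k < n) (h k).[z]) (F z).
Proof.
have [B hB] := hsum (cabs_ge0 z).
by apply: (sumC_cvg _ hB) => k; exact: horner_majorant.
Qed.

(** The second-order remainders are summable, so the increment of the sum is linear up to
    [cabs w ^+ 2 * B]; the derivative is the sum of the derivatives. *)
Lemma poly_series_entire : entire F.
Proof.
apply/entireP => z; have rz : 0 <= cabs z + 1 by rewrite addr_ge0 ?cabs_ge0.
have [B hB] := hsum rz; exists (sumC (fun k => (h k)^`().[z])) => e e0.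
have hD : cvgC (fun n => \sum_(k < n) (h k)^`().[z]) (sumC (fun k => (h k)^`().[z])).
  by apply: (sumC_cvg _ hB) => k; exact: deriv_majorant.
have B0 : 0 <= B by have := hB 0%N; rewrite big_ord0.
exists (Num.min 1 (e / (B + 1))).
  by rewrite lt_min ltr01 divr_gt0// ltr_wpDl.
move=> w; rewrite lt_min => /andP[w1 w2].
have key : cabs (F (z + w) - F z - sumC (fun k => (h k)^`().[z]) * w) <= cabs w ^+ 2 * B.
  have hc := cvgCD (cvgCD (poly_series_cvg (z + w)) (cvgCN (poly_series_cvg z)))
    (cvgCN (cvgCZ w hD)).
  rewrite [_ * w]mulrC; apply: (@cvgC_le _ _ _ _ 0%N hc) => n _.
  rewrite mulr_sumr -!sumrB (le_trans (cabs_sum _ _ _))//.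
  rewrite (le_trans _ (ler_wpM2l (sqr_ge0 _) (hB n)))// mulr_sumr ler_sum// => k _.
  by rewrite (mulrC w) taylor2_majorant// ltW.
rewrite (le_trans key)// expr2 -mulrA mulrC ler_wpM2r ?cabs_ge0//.
have B1 : 0 < B + 1 by rewrite ltr_wpDl.
move: w2; rewrite ltr_pdivlMr// => w2.
by rewrite (le_trans _ (ltW w2))// ler_wpM2l ?cabs_ge0// lerDl.
Qed.

End PolySeries.
End Entire.

(** * Bisection of the unit square *)

Section Cousin.
Variable R : realType.

(** Nested bad squares would shrink to a point around which small squares are good. This stands for
    compactness, both in Goursat's theorem and for boundedness on discs. *)
Lemma cousin_square (good : R -> R -> R -> Prop) :
  (forall x y h, good x y (h / 2) -> good (x + h / 2) y (h / 2) ->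
     good x (y + h / 2) (h / 2) -> good (x + h / 2) (y + h / 2) (h / 2) ->
     good x y h) ->
  (forall x0 y0, 0 <= x0 <= 1 -> 0 <= y0 <= 1 -> exists2 d, 0 < d &
     forall x y h, 0 < h < d -> 0 <= x -> x <= x0 <= x + h -> x + h <= 1 ->
       0 <= y -> y <= y0 <= y + h -> y + h <= 1 -> good x y h) ->
  good 0 0 1.
Proof.
move=> split4 loc; apply: contrapT => bad.
pose P (s : R * R) h := ~ good s.1 s.2 h.
(* Any bad square of half the side inside the current one will do, which spares naming the four
   quarters. The default [s] would be returned only if none were bad, which [split4] excludes. *)
pose nxt (s : R * R) h := xget s [set t | P t (h / 2) /\
  s.1 <= t.1 <= s.1 + h / 2 /\ s.2 <= t.2 <= s.2 + h / 2].
pose s := fix s n := if n is n'.+1 then nxt (s n') (2^-1 ^+ n') else (0, 0) : R * R.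
have h0 n : 0 < 2^-1 ^+ n :> R by rewrite exprn_gt0.
have sS n : P (s n) (2^-1 ^+ n) -> P (s n.+1) (2^-1 ^+ n.+1) /\
    (s n).1 <= (s n.+1).1 <= (s n).1 + 2^-1 ^+ n.+1 /\
    (s n).2 <= (s n.+1).2 <= (s n).2 + 2^-1 ^+ n.+1.
  move=> Pn; rewrite exprSr /= /nxt; set h := _ ^+ n; have hh : 0 < h := h0 n.
  move: (s n) Pn => -[x y] Pn; case: xgetP => [t -> //|] none; exfalso; apply: Pn.
  have hp : 0 <= h / 2 by lra.
  apply: split4; apply: contrapT => g.
  - by apply: (none (x, y)); split => //=; lra.
  - by apply: (none (x + h / 2, y)); split => //=; lra.
  - by apply: (none (x, y + h / 2)); split => //=; lra.
  - by apply: (none (x + h / 2, y + h / 2)); split => //=; lra.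
have sP n : P (s n) (2^-1 ^+ n).
  by elim: n => [|n /sS[]//]; rewrite expr0.
(* For a coordinate [f], lower corners increase and upper corners decrease; the supremum of the
   former lies in every square. *)
have lim (f : R * R -> R) : f (s 0%N) = 0 ->
    (forall n, f (s n) <= f (s n.+1) <= f (s n) + 2^-1 ^+ n.+1) ->
    exists2 l, 0 <= l <= 1 & forall n, [/\ 0 <= f (s n), f (s n) <= l <= f (s n) + 2^-1 ^+ n & f (s n) + 2^-1 ^+ n <= 1].
  move=> f0 fS.
  have mon m n : (m <= n)%N -> f (s m) <= f (s n) /\ f (s n) + 2^-1 ^+ n <= f (s m) + 2^-1 ^+ m.
    move=> /subnK <-; elim: (n - m)%N => [|k [ih1 ih2]]; first by rewrite add0n.
    have := fS (k + m)%N; rewrite -addSn => /andP[]; move: (s _.+1) => t.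
    have : 2^-1 ^+ (k.+1 + m) = 2^-1 ^+ (k + m) / 2 :> R by rewrite addSn exprSr.
    by move: ih1 ih2; lra.
  have lub m n : f (s m) <= f (s n) + 2^-1 ^+ n.
    have := mon m (maxn m n) (leq_maxl _ _); have := mon n (maxn m n) (leq_maxr _ _).
    by have := h0 (maxn m n); lra.
  have hub : has_ubound [set f (s n) | n in setT].
    by exists (f (s 0%N) + 2^-1 ^+ 0) => _ [n _ <-]; exact: lub.
  have up n : f (s n) <= sup [set f (s n) | n in setT] <= f (s n) + 2^-1 ^+ n.
    apply/andP; split; first by apply: ub_le_sup => //; exists n.
    by apply: ge_sup; [exists (f (s 0%N)), 0%N | move=> _ [m _ <-]; exact: lub].
  exists (sup [set f (s n) | n in setT]); first by have := up 0%N; rewrite f0 expr0 add0r.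
  by move=> n; have := mon 0%N n (leq0n n); rewrite f0 expr0 add0r => -[? ?]; split=> //; exact: up.
have [x0 x01 hx] := lim fst erefl (fun n => (sS n (sP n)).2.1).
have [y0 y01 hy] := lim snd erefl (fun n => (sS n (sP n)).2.2).
have [d d0 hd] := loc _ _ x01 y01.
have [N _ hN] : \forall n \near \oo, 2^-1 ^+ n < d.
  have : @GRing.exp R 2^-1 @ \oo --> 0.
    by apply: cvg_expr; rewrite ger0_norm// invf_lt1// ltr1n.
  move/cvgrPdist_lt => /(_ _ d0); apply: filterS => n.
  by rewrite sub0r normrN ger0_norm// ltW.
have [? ? ?] := hx N; have [? ? ?] := hy N.
by apply: (sP N); apply: hd => //; rewrite h0 hN/=.
Qed.

End Cousin.

(** * Goursat's theorem by trapezoidal sums *)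

Section Goursat.
Variable R : realType.
Implicit Types (f g : R[i] -> R[i]) (c : R -> R[i]).

Definition trapezoid f (u v : R[i]) := (f u + f v) / 2 * (v - u).

(* Trapezoidal sum for the integral of [f] along the curve [c], on the
   subdivision of [a, b] into 2^k equal parts. *)
Fixpoint path_sum k f c (a b : R) : R[i] :=
  if k is k'.+1 then path_sum k' f c a ((a + b) / 2) + path_sum k' f c ((a + b) / 2) b
  else trapezoid f (c a) (c b).

Lemma path_sumD k f g c a b :
  path_sum k (fun w => f w + g w) c a b = path_sum k f c a b + path_sum k g c a b.
Proof.
elim: k a b => [|k ih] a b /=; last by rewrite !ih addrACA.
by rewrite /trapezoid; ring.
Qed.

(** The trapezoidal rule is exact for affine integrands: the sum telescopes to the increment of a
    primitive and cancels around closed curves. *)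
Lemma path_sum_affine k p q c a b : path_sum k (fun w => p + q * w) c a b =
  p * (c b - c a) + q * (c b ^+ 2 - c a ^+ 2) / 2.
Proof.
elim: k a b => [|k ih] a b /=; last by rewrite !ih; ring.
by rewrite /trapezoid; field.
Qed.

Lemma path_sum_le k f c a b (M L : R) : 0 <= M -> a <= b ->
  (forall t, a <= t <= b -> cabs (f (c t)) <= M) ->
  (forall s t, a <= s -> s <= t -> t <= b -> cabs (c t - c s) <= L * (t - s)) ->
  cabs (path_sum k f c a b) <= M * L * (b - a).
Proof.
move=> M0; elim: k a b => [|k ih] a b ab hf hc /=.
  rewrite /trapezoid cabsM -mulrA ler_pM ?cabs_ge0//; last by rewrite hc.
  rewrite cabs_div cabs_nat ler_pdivrMr// mulr_natr mulr2n (le_trans (cabsD _ _))//.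
  by rewrite lerD// hf ?lexx ?ab.
have am : a <= (a + b) / 2 by lra.
have mb : (a + b) / 2 <= b by lra.
rewrite (le_trans (cabsD _ _))//.
apply: (le_trans (lerD (ih _ _ am _ _) (ih _ _ mb _ _))).
- by move=> t /andP[h1 h2]; apply: hf; rewrite h1/= (le_trans h2).
- by move=> s t h1 h2 h3; apply: hc => //; exact: le_trans h3 mb.
- by move=> t /andP[h1 h2]; apply: hf; rewrite h2 andbT (le_trans am).
- by move=> s t h1 h2 h3; apply: hc => //; exact: le_trans am h1.
by rewrite le_eqVlt; apply/orP; left; apply/eqP; field.
Qed.

Variable P : R -> R -> R[i].

Definition square_sum k f (x y h : R) : R[i] :=
  path_sum k f (P (x + h)) y (y + h) - path_sum k f (P x) y (y + h)
  - path_sum k f (P^~ (y + h)) x (x + h) + path_sum k f (P^~ y) x (x + h).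

(** With dyadic subdivisions the inner edges cancel exactly at every finite level. *)
Lemma square_sumS k f x y h : square_sum k.+1 f x y h =
  square_sum k f x y (h / 2) + square_sum k f (x + h / 2) y (h / 2)
  + square_sum k f x (y + h / 2) (h / 2) + square_sum k f (x + h / 2) (y + h / 2) (h / 2).
Proof.
have m (a : R) : (a + (a + h)) / 2 = a + h / 2 by field.
have e (a : R) : a + h / 2 + h / 2 = a + h by field.
by rewrite /square_sum /= !m !e; ring.
Qed.

Variable L : R.
Hypothesis L_gt0 : 0 < L.
Hypothesis PL : forall x x' y y', 0 <= x <= 1 -> 0 <= x' <= 1 -> 0 <= y <= 1 -> 0 <= y' <= 1 ->
  cabs (P x y - P x' y') <= L * (`|x - x'| + `|y - y'|).

(** Near a point, [f] is affine up to o(h). The affine part contributes 0 around a small square and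
    the rest o(h) on sides of length O(h), so the sum is at most [e * h ^+ 2], a bound additive
    under subdivision. *)
Lemma goursat f :
  (forall x y, 0 <= x <= 1 -> 0 <= y <= 1 -> exists d, diffC f (P x y) d) ->
  forall e, 0 < e -> exists K, forall k, (K <= k)%N -> cabs (square_sum k f 0 0 1) <= e.
Proof.
move=> fP e e0.
pose good x y h := exists K, forall k, (K <= k)%N -> cabs (square_sum k f x y h) <= e * h ^+ 2.
suff : good 0 0 1 by rewrite /good expr1n mulr1.
apply: cousin_square => [x y h [K1 h1] [K2 h2] [K3 h3] [K4 h4]|x0 y0 x01 y01].
  exists (maxn K1 (maxn K2 (maxn K3 K4))).+1 => -[//|k]; rewrite ltnS !geq_max.
  move=> /andP[/h1 l1 /andP[/h2 l2 /andP[/h3 l3 /h4 l4]]].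
  rewrite square_sumS.
  have -> : e * h ^+ 2 = e * (h / 2) ^+ 2 + e * (h / 2) ^+ 2 + e * (h / 2) ^+ 2 + e * (h / 2) ^+ 2 by field.
  rewrite (le_trans (cabsD _ _))// lerD// (le_trans (cabsD _ _))// lerD//.
  by rewrite (le_trans (cabsD _ _))// lerD.
have [d fd] := fP _ _ x01 y01; set p := P x0 y0 in fd.
(* Images of a square of side h stay within 2 L h of p, so the error [g] is at most e h / (4 L)
   there, and each of the four sides contributes at most e h^2 / 4. *)
have e1 : 0 < e / (8 * L ^+ 2) by rewrite divr_gt0// mulr_gt0// exprn_gt0.
have [r r0 hr] := fd _ e1.
exists (r / (2 * L)); first by rewrite divr_gt0// mulr_gt0.
move=> x y h /andP[h0 hd] x_ge /andP[xx0 x0x] x_le y_ge /andP[yy0 y0y] y_le; exists 0%N => k _.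
pose g w := f w - (f p - d * p + d * w).
have -> : f = fun w => g w + (f p - d * p + d * w) by apply/funext => w; rewrite /g subrK.
have inx s : x <= s <= x + h -> 0 <= s <= 1.
  by move=> /andP[s1 s2]; rewrite (le_trans x_ge s1) (le_trans s2 x_le).
have iny s : y <= s <= y + h -> 0 <= s <= 1.
  by move=> /andP[s1 s2]; rewrite (le_trans y_ge s1) (le_trans s2 y_le).
have xl : x <= x <= x + h by rewrite lexx lerDl ltW.
have xr : x <= x + h <= x + h by rewrite lexx lerDl ltW.
have yl : y <= y <= y + h by rewrite lexx lerDl ltW.
have yr : y <= y + h <= y + h by rewrite lexx lerDl ltW.
have between (a s t : R) : a <= s -> s <= t -> t <= a + h -> a <= s <= a + h /\ a <= t <= a + h.
  by move=> h1 h2 h3; rewrite h1 h3 (le_trans h2 h3) (le_trans h1 h2).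
have close s t : x <= s <= x + h -> y <= t <= y + h ->
    cabs (g (P s t)) <= e / (8 * L ^+ 2) * (2 * L * h).
  move=> /andP[s1 s2] /andP[t1 t2].
  have dist : cabs (P s t - p) <= 2 * L * h.
    rewrite (le_trans (PL _ x01 _ y01))//; [by apply: inx; lra|by apply: iny; lra|].
    rewrite (_ : 2 * L * h = L * (h + h)); last by ring.
    rewrite ler_wpM2l ?(ltW L_gt0)// lerD// ler_norml; lra.
  have -> : g (P s t) = f (p + (P s t - p)) - f p - d * (P s t - p).
    by rewrite (addrC p) subrK /g; ring.
  apply: le_trans (hr _ _) _.
    rewrite (le_lt_trans dist)//; move: hd; rewrite ltr_pdivlMr ?mulr_gt0//.
    by rewrite mulrC.
  by rewrite ler_wpM2l// ltW.
rewrite /square_sum !(path_sumD _ g) !path_sum_affine.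
set s1 := path_sum _ _ _ _ _; set s2 := path_sum _ _ _ _ _.
set s3 := path_sum _ _ _ _ _; set s4 := path_sum _ _ _ _ _.
rewrite (_ : _ + _ = s1 - s2 - s3 + s4); last by field.
set M := e / (8 * L ^+ 2) * (2 * L * h) in close.
have M0 : 0 <= M by rewrite /M mulr_ge0 ?(ltW e1)// !mulr_ge0// ltW.
have small c a : (forall s t, a <= s -> s <= t -> t <= a + h -> cabs (c t - c s) <= L * (t - s)) ->
    (forall t, a <= t <= a + h -> cabs (g (c t)) <= M) -> cabs (path_sum k g c a (a + h)) <= M * L * h.
  move=> hc hg; have ah : a <= a + h by lra.
  have := path_sum_le k M0 ah hg hc; by rewrite (addrC a) addrK.
have {}small1 : cabs s1 <= M * L * h.
  apply: small => [s t h1 h2 h3|t ht]; last exact: close.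
  have [hs ht] := between _ _ _ h1 h2 h3.
  rewrite (le_trans (PL (inx _ xr) (inx _ xr) (iny _ ht) (iny _ hs)))//.
  by rewrite subrr normr0 add0r ger0_norm ?subr_ge0.
have {}small2 : cabs s2 <= M * L * h.
  apply: small => [s t h1 h2 h3|t ht]; last exact: close.
  have [hs ht] := between _ _ _ h1 h2 h3.
  rewrite (le_trans (PL (inx _ xl) (inx _ xl) (iny _ ht) (iny _ hs)))//.
  by rewrite subrr normr0 add0r ger0_norm ?subr_ge0.
have {}small3 : cabs s3 <= M * L * h.
  apply: small => [s t h1 h2 h3|t ht]; last exact: close.
  have [hs ht] := between _ _ _ h1 h2 h3.
  rewrite (le_trans (PL (inx _ ht) (inx _ hs) (iny _ yr) (iny _ yr)))//.
  by rewrite subrr normr0 addr0 ger0_norm ?subr_ge0.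
have {}small4 : cabs s4 <= M * L * h.
  apply: small => [s t h1 h2 h3|t ht]; last exact: close.
  have [hs ht] := between _ _ _ h1 h2 h3.
  rewrite (le_trans (PL (inx _ ht) (inx _ hs) (iny _ yl) (iny _ yl)))//.
  by rewrite subrr normr0 addr0 ger0_norm ?subr_ge0.
have -> : e * h ^+ 2 = M * L * h + M * L * h + M * L * h + M * L * h.
  by rewrite /M; field; rewrite gt_eqF.
rewrite (le_trans (cabsD _ _))// lerD// (le_trans (cabsB _ _))// lerD//.
by rewrite (le_trans (cabsB _ _))// lerD.
Qed.

End Goursat.

(** * Means over roots of unity *)

Section CircleMean.
Variable R : realType.
Implicit Types (f g : R[i] -> R[i]) (z w : R[i]).

Definition circle (t : R) : R[i] := (cos (2 * pi * t) +i* sin (2 * pi * t))%C.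

Lemma circleD s t : circle (s + t) = circle s * circle t.
Proof.
rewrite /circle mulrDr cosD sinD; apply/eqP; rewrite eq_complex /= eqxx.
by rewrite /= addrC.
Qed.

Lemma circle0 : circle 0 = 1.
Proof. by rewrite /circle mulr0 cos0 sin0. Qed.

Lemma circle1 : circle 1 = 1.
Proof. by rewrite /circle mulr1 mulr_natl cos2pi sin2pi. Qed.

Lemma circleMn n t : circle (n%:R * t) = circle t ^+ n.
Proof.
elim: n => [|n ih]; first by rewrite mul0r circle0 expr0.
by rewrite exprS -natr1 mulrDl mul1r addrC circleD ih.
Qed.

Lemma cabs_circle t : cabs (circle t) = 1.
Proof. by rewrite /cabs /= cos2Dsin2 sqrtr1. Qed.

Lemma circle_neq0 t : circle t != 0.
Proof. by rewrite -cabs_gt0 cabs_circle. Qed.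

Lemma circle_lip s t : cabs (circle s - circle t) <= 4 * pi * `|s - t|.
Proof.
have p0 := pi_gt0 R.
wlog st : s t / s < t.
  move=> h; have [/h//|/h|->] := ltgtP s t.
    by rewrite cabs_distC distrC.
  by rewrite !subrr cabs0 normr0 mulr0.
have lip (g dg : R -> R) : (forall x : R, is_derive x (1 : R) g (dg x)) -> (forall x, `|dg x| <= 1) ->
    `|g (2 * pi * s) - g (2 * pi * t)| <= 2 * pi * `|s - t|.
  move=> gd dg1; have st' : 2 * pi * s < 2 * pi * t by rewrite ltr_pM2l// mulr_gt0.
  have [|x _ h] := @MVT R g dg _ _ st' (fun x _ => gd x).
    by apply: derivable_within_continuous => x _; apply: ex_derive.
  rewrite distrC h normrM (le_trans (ler_wpM2r _ (dg1 x)))// mul1r -mulrBr normrM.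
  by rewrite (distrC s) ger0_norm// mulr_ge0// ltW.
rewrite (le_trans (cabs_le_ReIm _))//= (_ : 4 * pi * _ = 2 * pi * `|s - t| + 2 * pi * `|s - t|); last by ring.
rewrite lerD//; first by apply: (lip cos (fun x => - sin x)) => x; rewrite ?normrN sin_max.
by apply: (lip sin cos) => x; exact: cos_max.
Qed.

Definition unit_root k := circle (2^-1 ^+ k).

Lemma unit_root_exp k : unit_root k ^+ (2 ^ k) = 1.
Proof.
by rewrite /unit_root -circleMn natrX -exprMn mulfV ?expr1n ?circle1// pnatr_eq0.
Qed.

(** If cos(2 pi t) = 1 then sin(pi t) = 0 by the double angle formula, impossible for 0 < t < 1. *)
Lemma unit_root_exp_neq1 k j : (0 < j < 2 ^ k)%N -> unit_root k ^+ j != 1.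
Proof.
move=> /andP[j0 jk]; rewrite /unit_root -circleMn; set t := _ * _.
have t0 : 0 < t by rewrite mulr_gt0 ?ltr0n ?exprn_gt0.
have t1 : t < 1 by rewrite /t exprVn ltr_pdivrMr ?exprn_gt0// mul1r -natrX ltr_nat.
have p0 := pi_gt0 R.
apply/negP => /eqP; rewrite /circle => -[c1 s0].
have : sin (pi * t) = 0.
  move: c1; rewrite (_ : 2 * pi * t = (pi * t) *+ 2); last by ring.
  rewrite cos_mulr2n => c1; apply/eqP; rewrite -sqrf_eq0; apply/eqP.
  have := cos2Dsin2 (pi * t); move: c1; rewrite mulr2n; lra.
by apply/eqP; rewrite gt_eqF// sin_gt0_pi// mulr_gt0//= gtr_pMr.
Qed.

Definition cmean k (F : R[i] -> R[i]) : R[i] :=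
  (2 ^ k)%:R^-1 * \sum_(j < 2 ^ k) F (unit_root k ^+ j).

Lemma cmeanD k f g : cmean k (fun u => f u + g u) = cmean k f + cmean k g.
Proof. by rewrite /cmean big_split mulrDr. Qed.

Lemma cmeanZ k f z : cmean k (fun u => z * f u) = z * cmean k f.
Proof. by rewrite /cmean -mulr_sumr mulrCA. Qed.

Lemma cmean_sum k (I : Type) (r : seq I) (f : I -> R[i] -> R[i]) :
  cmean k (fun u => \sum_(i <- r) f i u) = \sum_(i <- r) cmean k (f i).
Proof.
rewrite /cmean -mulr_sumr; congr (_ * _); exact: exchange_big.
Qed.

Lemma cmean_cst k z : cmean k (fun=> z) = z.
Proof.
rewrite /cmean sumr_const card_ord -[z *+ _]mulr_natl mulrA mulVf ?mul1r// pnatr_eq0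
  expn_eq0.
Qed.

Lemma eq_cmean k f g : (forall u, cabs u = 1 -> f u = g u) -> cmean k f = cmean k g.
Proof.
move=> fg; congr (_ * _); apply: eq_bigr => j _; apply: fg.
by rewrite cabsX cabs_circle expr1n.
Qed.

Lemma cmean_le k f (M : R) : (forall u, cabs u = 1 -> cabs (f u) <= M) ->
  cabs (cmean k f) <= M.
Proof.
move=> fM; rewrite /cmean cabsM cabsV cabs_nat mulrC ler_pdivrMr ?ltr0n ?expn_gt0//.
rewrite (le_trans (cabs_sum _ _ _))// (@le_trans _ _ (\sum_(j < 2 ^ k) M))//.
  by apply: ler_sum => j _; rewrite fM// cabsX cabs_circle expr1n.
by rewrite sumr_const card_ord mulr_natr.
Qed.

Lemma cmean_dist_le k f z (M : R) : (forall u, cabs u = 1 -> cabs (f u - z) <= M) ->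
  cabs (cmean k f - z) <= M.
Proof.
by move=> fM; rewrite -{1}(cmean_cst k z) -mulN1r -cmeanZ -cmeanD; apply: cmean_le => u /fM; rewrite mulN1r.
Qed.

Lemma cmean_monomial k n : cmean k (fun u => u ^+ n) = (2 ^ k %| n)%:R.
Proof.
case: (boolP (2 ^ k %| n)%N) => [/dvdnP[m ->]|ndvd].
  rewrite -[in RHS](cmean_cst k 1); congr (_ * _); apply: eq_bigr => j _.
  by rewrite mulnC exprM -!exprM (mulnC j) -mulnA exprM unit_root_exp expr1n.
have [] : unit_root k ^+ n != 1 /\ (unit_root k ^+ n) ^+ (2 ^ k) = 1.
  split; last by rewrite -exprM mulnC exprM unit_root_exp expr1n.
  rewrite (divn_eq n (2 ^ k)) exprD mulnC exprM unit_root_exp expr1n mul1r.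
  by rewrite unit_root_exp_neq1// ltn_mod expn_gt0 andbT lt0n.
set q := _ ^+ n => q1 qk.
suff -> : cmean k (fun u => u ^+ n) = (2 ^ k)%:R^-1 * \sum_(j < 2 ^ k) q ^+ j.
  apply/eqP; rewrite mulf_eq0; apply/orP; right.
  have /eqP : (q - 1) * \sum_(j < 2 ^ k) q ^+ j = 0 by rewrite -subrX1 qk subrr.
  by rewrite mulf_eq0 subr_eq0 (negPf q1).
by congr (_ * _); apply: eq_bigr => j _; rewrite -!exprM mulnC.
Qed.

Lemma path_sum_unroll k f (c : R -> R[i]) a (d : R) :
  path_sum k f c a (a + (2 ^ k)%:R * d) =
  \sum_(j < 2 ^ k) trapezoid f (c (a + j%:R * d)) (c (a + j.+1%:R * d)).
Proof.
elim: k a => [|k ih] a /=.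
  by rewrite expn0 big_ord1 !mul0r addr0.
have -> : (a + (a + (2 ^ k.+1)%:R * d)) / 2 = a + (2 ^ k)%:R * d.
  by rewrite expnS natrM; field.
have -> : a + (2 ^ k.+1)%:R * d = (a + (2 ^ k)%:R * d) + (2 ^ k)%:R * d.
  by rewrite expnS natrM; ring.
rewrite !ih expnS mul2n -addnn big_split_ord /=; congr (_ + _).
by apply: eq_bigr => j _; rewrite -addnS !natrD !mulrDl !addrA.
Qed.

(** This is 2^k i sin(2 pi / 2^k), the discrete counterpart of 2 pi i. *)
Definition mesh k : R[i] := (2 ^ k)%:R * ((unit_root k - (unit_root k)^-1) / 2).

(** The nodes are permuted by rotation, so the index can be shifted in one half of the trapezoidal
    sum, which then becomes a fixed multiple of a single mean. *)
Lemma path_sum_circle k f z (r : R[i]) :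
  path_sum k f (fun t => z + r * circle t) 0 1 =
  mesh k * cmean k (fun u => f (z + r * u) * (r * u)).
Proof.
have -> : 1 = 0 + (2 ^ k)%:R * 2^-1 ^+ k :> R.
  by rewrite add0r natrX -exprMn mulfV ?expr1n// pnatr_eq0.
rewrite path_sum_unroll /mesh /cmean mulrACA [X in X * _]mulfV ?pnatr_eq0 ?expn_eq0// mul1r.
set w := unit_root k; have w0 : w != 0 := circle_neq0 _.
transitivity (\sum_(j < 2 ^ k) (f (z + r * w ^+ j) + f (z + r * w ^+ j.+1)) / 2
    * (r * (w ^+ j.+1 - w ^+ j))).
  apply: eq_bigr => j _; rewrite /trapezoid !add0r !circleMn -/(unit_root k) -/w.
  by congr (_ * _); ring.
pose F j := f (z + r * w ^+ j) * (r * w ^+ j).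
have shift : \sum_(j < 2 ^ k) F j.+1 = \sum_(j < 2 ^ k) F j.
  have := @big_ord_recl _ 0 +%R (2 ^ k) (fun j : 'I_(2 ^ k).+1 => F j) => /= h1.
  have := @big_ord_recr _ 0 +%R (2 ^ k) (fun j : 'I_(2 ^ k).+1 => F j) => /= h2.
  have FN : F (2 ^ k)%N = F 0%N by rewrite /F /w unit_root_exp expr0.
  apply: (addrI (F 0%N)); rewrite [RHS]addrC -[X in _ = _ + X]FN -h2 h1.
  by congr (_ + _); apply: eq_bigr.
transitivity (\sum_(j < 2 ^ k) ((w - 1) / 2 * F j + (1 - w^-1) / 2 * F j.+1)).
  by apply: eq_bigr => j _; rewrite /F exprS; field.
by rewrite big_split/= -!mulr_sumr shift; field.
Qed.

(** The modulus 2^k |sin(2 pi / 2^k)| is nondecreasing in k because sin 2x = 2 sin x cos x, and it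
    equals 4 at k = 2. *)
Lemma mesh_ge k : (2 <= k)%N -> 4 <= cabs (mesh k).
Proof.
have p0 := pi_gt0 R.
have meshE j : cabs (mesh j) = (2 ^ j)%:R * `|sin (2 * pi * 2^-1 ^+ j)|.
  rewrite /mesh cabsM cabs_nat; congr (_ * _).
  have -> : (unit_root j)^-1 = (unit_root j)^*%C.
    apply: (mulfI (circle_neq0 (2^-1 ^+ j))); rewrite mulfV ?circle_neq0//.
    apply/eqP; rewrite eq_complex /= mulrN opprK -!expr2 cos2Dsin2 eqxx/=.
    by rewrite mulrN mulrC addNr.
  rewrite /unit_root /circle; set c := cos _; set s := sin _.
  rewrite (_ : _ / 2 = (0 +i* s)%C); last first.
    apply: (mulIf (_ : 2 != 0)); first by rewrite pnatr_eq0.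
    rewrite divfK ?pnatr_eq0//; apply/eqP; rewrite eq_complex /= subrr opprK.
    by apply/andP; split; apply/eqP; ring.
  by rewrite /cabs /= expr0n /= add0r sqrtr_sqr.
elim: k => // k ih; rewrite leq_eqVlt => /predU1P[<-|].
  rewrite meshE (_ : 2 * pi * 2^-1 ^+ 2 = pi / 2 :> R); last by field.
  by rewrite sin_pihalf normr1 mulr1.
rewrite ltnS => /ih {}ih; rewrite (le_trans ih)// !meshE.
rewrite (_ : 2 * pi * 2^-1 ^+ k = (2 * pi * 2^-1 ^+ k.+1) *+ 2); last first.
  by rewrite exprSr -mulr_natl; field.
rewrite sin_mulr2n -[_ * _ *+ 2]mulr_natl !normrM normr_nat expnS natrM.
rewrite mulrCA -!mulrA ler_wpM2l// ler_wpM2l//.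
by rewrite ler_piMl// cos_max.
Qed.

End CircleMean.

(** * Cauchy's formula and Taylor expansion of entire functions *)

Section Taylor.
Variable R : realType.
Implicit Types (f : R[i] -> R[i]) (z w : R[i]) (a : nat -> R[i]).

Lemma diffC_cont f z d : diffC f z d -> forall e, 0 < e ->
  exists2 r : R, 0 < r & forall h, cabs h <= r -> cabs (f (z + h) - f z) <= e.
Proof.
move=> fz e e0; have [r r0 hr] := fz 1 ltr01.
have c0 : 0 < 1 + cabs d by rewrite ltr_pwDl// cabs_ge0.
exists (Num.min (r / 2) (e / (1 + cabs d))); first by rewrite lt_min !divr_gt0.
move=> h; rewrite le_min => /andP[h1]; rewrite ler_pdivlMr// => h2.
have /hr h3 : cabs h < r by rewrite (le_lt_trans h1)// gtr_pMr// invf_lt1// ltr1n.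
rewrite (_ : _ - _ = (f (z + h) - f z - d * h) + d * h); last by ring.
rewrite (le_trans (cabsD _ _))// (le_trans _ h2)// cabsM mulrDr lerD//.
  by rewrite mulr1 (le_trans h3)// mul1r.
by rewrite mulrC.
Qed.

Lemma entire_bounded f (r : R) : entire f -> 0 < r ->
  exists2 B : R, 0 <= B & forall w, cabs w <= r -> cabs (f w) <= B.
Proof.
move=> /entireP fe r0.
pose P (s t : R) := ((- r + 2 * r * s) +i* (- r + 2 * r * t))%C.
pose good x y h := exists2 B : R, 0 <= B & forall s t, x <= s <= x + h -> y <= t <= y + h ->
  cabs (f (P s t)) <= B.
suff [B B0 hB] : good 0 0 1.
  exists B => // w wr; have r2 : 0 < 2 * r by rewrite mulr_gt0.
  have pt (v : R) : `|v| <= cabs w -> 0 <= (v + r) / (2 * r) <= 0 + 1.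
    move=> vw; have := le_trans vw wr; rewrite ler_norml => /andP[v1 v2].
    rewrite ler_pdivrMr// divr_ge0 ?(ltW r2)//; lra.
  rewrite (_ : w = P ((complex.Re w + r) / (2 * r)) ((complex.Im w + r) / (2 * r))).
    by apply: hB; apply: pt; rewrite ?Re_le_cabs ?Im_le_cabs.
  rewrite /P ![2 * r * _]mulrC !divfK ?gt_eqF//; case: w {wr pt} => u v /=.
  by congr (Complex _ _); ring.
apply: cousin_square => [x y h [B1 p1 h1] [B2 p2 h2] [B3 p3 h3] [B4 p4 h4]|x0 y0 _ _].
  exists (B1 + B2 + B3 + B4); first by rewrite !addr_ge0.
  move=> s t /andP[s1 s2] /andP[t1 t2].
  have [sl|/ltW sl] := leP s (x + h / 2); have [tl|/ltW tl] := leP t (y + h / 2).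
  - by rewrite (le_trans (h1 s t _ _)) ?s1 ?t1//; lra.
  - by rewrite (le_trans (h3 s t _ _)) ?s1 ?tl//; lra.
  - by rewrite (le_trans (h2 s t _ _)) ?sl ?t1//; lra.
  - by rewrite (le_trans (h4 s t _ _)) ?sl ?tl//; lra.
have [d fd] := fe (P x0 y0); have [e e0 he] := diffC_cont fd ltr01.
exists (e / (4 * r)); first by rewrite divr_gt0// mulr_gt0.
move=> x y h; rewrite ltr_pdivlMr ?mulr_gt0// => /andP[h0 hr] _ /andP[x1 x2] _ _ /andP[y1 y2] _.
exists (1 + cabs (f (P x0 y0))); first by rewrite addr_ge0// cabs_ge0.
move=> s t /andP[s1 s2] /andP[t1 t2]; rewrite -lerBlDr (le_trans (cabs_lb _ _))//.
rewrite (_ : P s t = P x0 y0 + (P s t - P x0 y0)); last by rewrite addrC subrK.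
apply: he; rewrite (le_trans (cabs_le_ReIm _))// /P /=.
have -> : - r + 2 * r * s - (- r + 2 * r * x0) = 2 * r * (s - x0) by ring.
have -> : - r + 2 * r * t - (- r + 2 * r * y0) = 2 * r * (t - y0) by ring.
rewrite (le_trans _ (ltW hr))// !normrM normr_nat (gtr0_norm r0) -mulrDr.
rewrite (_ : h * (4 * r) = 2 * r * (h + h)); last by ring.
by rewrite ler_wpM2l ?mulr_ge0 ?(ltW r0)// lerD// ler_norml; apply/andP; split; lra.
Qed.

(* Goursat on the family of circles interpolating between the small circle
   around [z] and the circle of radius [r] around 0, which all avoid [z]. *)
Lemma cauchy_formula f z (r : R) : entire f -> cabs z < r ->
  cvgC (fun k => cmean k (fun u => f (r%:C%C * u) * (r%:C%C * u / (r%:C%C * u - z)))) (f z).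
Proof.
move=> fe zr e e0; have fe' := fe; move/entireP : fe => fe.
have e2 : 0 < e / 2 by rewrite divr_gt0.
have [d fd] := fe z; have [q q0 hq] := diffC_cont fd e2.
have r0 : 0 < r := le_lt_trans (cabs_ge0 z) zr.
(* The radius goes from q, within which [f] varies by at most e / 2, to r. The circle with centre (1
   - x) z keeps a radius exceeding x |z|, the distance of its centre from z. *)
pose rad x : R := (1 - x) * q + x * r.
pose P (x y : R) := (1 - x)%:C%C * z + (rad x)%:C%C * circle y.
have rad_gt x : 0 <= x <= 1 -> x * cabs z < rad x.
  move=> /andP[x0 x1]; rewrite /rad; have [->|x_neq0] := eqVneq x 0.
    by rewrite !mul0r addr0 subr0 mul1r.
  have : x * cabs z < x * r by rewrite ltr_pM2l// lt_def x_neq0.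
  have : 0 <= (1 - x) * q by rewrite mulr_ge0 ?subr_ge0// ltW.
  lra.
have Pz x y : 0 <= x <= 1 -> P x y != z.
  move=> x01; have := rad_gt x x01; move: (x01) => /andP[x0 x1] hx.
  apply/eqP => h; have : cabs ((rad x)%:C%C * circle y) = cabs (x%:C%C * z).
    congr cabs; move: h; rewrite /P raddfB /= => h.
    rewrite (_ : _ * circle y = P x y - (1 - x)%:C%C * z); last by rewrite /P addrC addKr.
    by rewrite /P raddfB /= h; ring.
  rewrite !cabsMr cabs_circle mulr1 !ger0_norm//; last first.
    by rewrite (le_trans _ (ltW hx))// mulr_ge0// cabs_ge0.
  by move=> h2; rewrite h2 ltxx in hx.
have p0 := pi_gt0 R.
pose L := cabs z + q + r + (q + r) * (4 * pi).
have q4 : 0 < (q + r) * (4 * pi) by rewrite !mulr_gt0// addr_gt0.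
have L0 : 0 < L.
  by have := cabs_ge0 z; rewrite /L; lra.
have PL x x' y y' : 0 <= x <= 1 -> 0 <= x' <= 1 -> 0 <= y <= 1 -> 0 <= y' <= 1 ->
    cabs (P x y - P x' y') <= L * (`|x - x'| + `|y - y'|).
  move=> /andP[x0 x1] /andP[x0' x1'] _ _.
  have -> : P x y - P x' y' = (x' - x)%:C%C * z + ((x - x') * (r - q))%:C%C * circle y
      + (rad x')%:C%C * (circle y - circle y').
    by rewrite /P /rad !(raddfB, rmorphM, raddfD) /=; ring.
  have rqL : `|r - q| <= q + r.
    by rewrite (le_trans (ler_normB _ _))// !gtr0_norm// addrC.
  have radL : `|rad x'| <= q + r.
    rewrite ger0_norm /rad; last by rewrite addr_ge0 ?mulr_ge0 ?subr_ge0// ltW.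
    by rewrite lerD// ler_piMl ?(ltW q0) ?(ltW r0)//; lra.
  rewrite (le_trans (cabsD _ _))// [leRHS]mulrDr lerD//.
    rewrite (le_trans (cabsD _ _))// !cabsMr cabs_circle mulr1 normrM distrC -mulrDr mulrC.
    rewrite ler_wpM2r// /L (le_trans (lerD (lexx _) rqL))// addrA lerDl.
    exact: ltW.
  rewrite cabsMr (le_trans (ler_wpM2l (normr_ge0 _) (circle_lip _ _)))// mulrA ler_wpM2r//.
  rewrite (le_trans (ler_wpM2r _ radL)) ?mulr_ge0 ?(ltW p0)// /L lerDr.
  by rewrite !addr_ge0 ?cabs_ge0// ltW.
pose g w := f w / (w - z).
have gP x y : 0 <= x <= 1 -> 0 <= y <= 1 -> exists d, diffC g (P x y) d.
  move=> x01 _; apply: derivable_diffC; apply: derivableM; first exact: fe'.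
  apply: derivableV; first by rewrite subr_eq0 Pz.
  by apply: derivableB; [exact: derivable_id|exact: derivable_cst].
(* Dividing by [mesh], of modulus at least 4, will turn 2 e into e / 2. *)
have e4 : 0 < 2 * e by rewrite mulr_gt0.
have [K hK] := goursat L0 PL gP e4.
exists (maxn K 2) => k; rewrite geq_max => /andP[/hK + k2].
rewrite /square_sum !add0r.
(* The sides y = 0 and y = 1 of the parameter square have the same image and cancel, leaving the two
   circles. *)
have -> : P^~ 1 = P^~ 0 by apply/funext => x; rewrite /P circle1 circle0.
rewrite addrNK.
have -> : P 1 = fun t => 0 + r%:C%C * circle t.
  by apply/funext => t; rewrite /P /rad subrr !mul0r mul1r !add0r.
have -> : P 0 = fun t => z + q%:C%C * circle t.
  by apply/funext => t; rewrite /P /rad subr0 !mul0r !mul1r addr0.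
rewrite !path_sum_circle -mulrBr cabsM.
set A := cmean k _; set B := cmean k _ => hAB.
have : cabs (A - B) <= e / 2.
  have m4 := mesh_ge R k2; have m0 : 0 < cabs (mesh R k) by rewrite (lt_le_trans _ m4).
  rewrite -(ler_pM2l m0) (le_trans hAB)//.
  rewrite (_ : 2 * e = 4 * (e / 2)); last by field.
  by rewrite ler_wpM2r// ltW.
have -> : A = cmean k (fun u => f (r%:C%C * u) * (r%:C%C * u / (r%:C%C * u - z))).
  by apply: eq_cmean => u _; rewrite /g add0r; ring.
move=> hAB2; rewrite (le_trans (cabs_distD B _ _))// [leRHS](splitr e) lerD//.
apply: cmean_dist_le => u u1.
have qu : q%:C%C * u != 0 by rewrite -cabs_gt0 cabsMr u1 mulr1 normr_gt0 gt_eqF.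
rewrite /g (addrC z) addrK divfK// (addrC _ z) hq// cabsMr u1 mulr1 gtr0_norm//.
Qed.

Lemma geometric_le (q : R) m n : 0 <= q -> q < 1 ->
  \sum_(m <= k < n) q ^+ k <= q ^+ m / (1 - q).
Proof.
move=> q0 q1; have q1' : 0 < 1 - q by rewrite subr_gt0.
have [mn|/ltnW nm] := leqP m n; last by rewrite big_geq// divr_ge0 ?exprn_ge0// ltW.
rewrite ler_pdivlMr// -{1}(subnK mn) addnC -{1}(add0n m) big_addn addKn.
under eq_bigr do rewrite exprD.
rewrite -mulr_suml big_mkord mulrAC mulrC ler_piMr ?exprn_ge0//.
by rewrite -[1 - q]opprB mulrN mulrC -subrX1 opprB lerBlDr lerDl exprn_ge0.
Qed.

Lemma power_series_tail a (B r : R) z v N : 0 < r ->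
  (forall n, cabs (a n) * r ^+ n <= B) -> cabs z < r ->
  cvgC (fun n => \sum_(k < n) a k * z ^+ k) v ->
  cabs (v - \sum_(k < N) a k * z ^+ k) <= B * ((cabs z / r) ^+ N / (1 - cabs z / r)).
Proof.
move=> r0 aB zr av.
have q0 : 0 <= cabs z / r by rewrite divr_ge0 ?cabs_ge0// ltW.
have q1 : cabs z / r < 1 by rewrite ltr_pdivrMr// mul1r.
apply: (@cvgC_dist_le _ _ _ _ _ N av) => n Nn; rewrite (big_ord_cat (fun k => a k * z ^+ k) Nn).
have B0 : 0 <= B by rewrite (le_trans _ (aB 0%N))// mulr_ge0 ?cabs_ge0// exprn_ge0// ltW.
rewrite (le_trans _ (ler_wpM2l B0 (geometric_le N n q0 q1)))// mulr_sumr.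
rewrite (le_trans (cabs_sum _ _ _))// ler_sum// => k _.
rewrite cabsM cabsX -{1}(divfK (lt0r_neq0 r0) (cabs z)) exprMn mulrCA mulrC.
by rewrite ler_wpM2r// exprn_ge0.
Qed.

Lemma expr_subn_root (F : fieldType) (u : F) n m : u != 0 -> u ^+ n = 1 -> (m <= n)%N ->
  u ^+ (n - m) = (u ^+ m)^-1.
Proof.
move=> u0 un mn; apply: (mulIf (expf_neq0 m u0)).
by rewrite -exprD subnK// un mulVf// expf_neq0.
Qed.

Lemma cmean_orth k m n : (m < 2 ^ k)%N -> (n < 2 ^ k)%N ->
  cmean k (fun u : R[i] => u ^+ m / u ^+ n) = (m == n)%:R.
Proof.
move=> mk nk.
have -> : cmean k (fun u : R[i] => u ^+ m / u ^+ n) =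
    cmean k (fun u : R[i] => u ^+ (m + (2 ^ k - n))).
  congr (_ * _); apply: eq_bigr => j _; set u := _ ^+ j.
  have u0 : u != 0 by rewrite expf_neq0// circle_neq0.
  by rewrite exprD (expr_subn_root u0 _ (ltnW nk))// /u exprAC unit_root_exp expr1n.
rewrite cmean_monomial; congr (_%:R); congr nat_of_bool.
apply/idP/eqP => [|->]; last by rewrite subnKC ?(ltnW nk)// dvdnn.
move=> /dvdnP[q hq]; have q2 : (q < 2)%N.
  by rewrite -(ltn_pmul2r (expn_gt0 2 k)) -hq; lia.
case: q hq q2 => [|[|//]] hq _; lia.
Qed.

(* Averaging over 2^k-th roots of unity isolates one coefficient up to the
   tail of index at least 2^k. *)
Lemma cauchy_estimate a (B r p M : R) (F : R[i] -> R[i]) n : 0 < p -> p < r ->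
  (forall n, cabs (a n) * r ^+ n <= B) ->
  (forall z, cabs z = p -> cvgC (fun n => \sum_(k < n) a k * z ^+ k) (F z)) ->
  (forall z, cabs z = p -> cabs (F z) <= M) ->
  cabs (a n) * p ^+ n <= M.
Proof.
move=> p0 pr aB aF FM; apply/ler_addgt0Pl => e e0.
have r0 : 0 < r := lt_trans p0 pr.
have B0 : 0 <= B by rewrite (le_trans _ (aB 0%N))// mulr_ge0 ?cabs_ge0// exprn_ge0// ltW.
set q := p / r; have q0 : 0 <= q by rewrite divr_ge0// ltW.
have q1 : q < 1 by rewrite ltr_pdivrMr// mul1r.
have [N nN hN] : exists2 N, (n < N)%N & B * (q ^+ N / (1 - q)) <= e.
  have : (fun N => B * (q ^+ N / (1 - q))) @ \oo --> B * (0 / (1 - q)).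
    apply: cvgM; first exact: cvg_cst.
    by apply: cvgM; [apply: cvg_expr; rewrite ger0_norm|exact: cvg_cst].
  rewrite mul0r mulr0 => /cvgrPdist_le /(_ _ e0)[N _ h].
  exists (maxn n.+1 N); first by rewrite leq_max leqnn.
  have := h (maxn n.+1 N) (leq_maxr _ _); rewrite /= sub0r normrN.
  exact: le_trans (ler_norm _).
pose A z := \sum_(k < N) a k * z ^+ k.
have FA z : cabs z = p -> cabs (F z - A z) <= e.
  move=> zp; rewrite (le_trans (power_series_tail N r0 aB _ (aF z zp))) ?zp//.
have nk : (N <= 2 ^ N)%N by rewrite ltnW// ltn_expl.
have -> : cabs (a n) * p ^+ n = cabs (cmean N (fun u => A (p%:C%C * u) / u ^+ n)).
  have -> : cmean N (fun u => A (p%:C%C * u) / u ^+ n) =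
      cmean N (fun u => \sum_(k < N) a k * p%:C%C ^+ k * (u ^+ k / u ^+ n)).
    by apply: eq_cmean => u _; rewrite /A mulr_suml; apply: eq_bigr => k _; rewrite exprMn !mulrA.
  rewrite cmean_sum (bigD1 (Ordinal nN))//= big1 ?addr0; last first.
    move=> i; rewrite -val_eqE /= => iN; rewrite cmeanZ cmean_orth ?(negPf iN) ?mulr0//.
      by rewrite (leq_trans (ltn_ord i)).
    by rewrite (leq_trans nN).
  rewrite cmeanZ cmean_orth ?eqxx ?mulr1 ?(leq_trans nN)//.
  by rewrite cabsM cabsX cabsR gtr0_norm.
apply: cmean_le => u u1; rewrite cabs_div cabsX u1 expr1n divr1.
have pu : cabs (p%:C%C * u) = p by rewrite cabsMr u1 mulr1 gtr0_norm.
rewrite (_ : A _ = F (p%:C%C * u) - (F (p%:C%C * u) - A (p%:C%C * u))); last by rewrite opprB addrC subrK.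
by rewrite (le_trans (cabsB _ _))// addrC lerD// ?FA// FM.
Qed.

(** By compactness, bounded sequences converge along an ultrafilter. A single one then yields all
    Taylor coefficients simultaneously from the discrete means, in place of a diagonal
    extraction. *)
Lemma ultra_limC (U : set_system nat) (u : nat -> R[i]) (B : R) : UltraFilter U ->
  (forall k, cabs (u k) <= B) ->
  exists l, forall e : R, 0 < e -> U [set k | cabs (u k - l) <= e].
Proof.
move=> UU uB.
have lim (v : nat -> R) : (forall k, `|v k| <= B) ->
    exists l, forall e : R, 0 < e -> U [set k | `|v k - l| <= e].
  move=> vB; have vU : U (v @^-1` `[- B, B]%classic).
    by apply: filterS (@filterT _ U _) => k _ /=; have := vB k; rewrite ler_norml in_itv.
  have [l [_ hl]] := @segment_compact R (- B) B (fmap v U) _ vU.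
  exists l => e e0; set E := [set k | _].
  have [//|UE] := in_ultra_setVsetC E UU; exfalso.
  have [|x [xE xl]] := hl [set x | ~ (`|x - l| <= e)] (ball l e) _ (nbhsx_ballx l e e0).
    exact: UE.
  by apply: xE; rewrite distrC ltW.
have [a ha] := lim (fun k => complex.Re (u k)) (fun k => le_trans (Re_le_cabs _) (uB k)).
have [b hb] := lim (fun k => complex.Im (u k)) (fun k => le_trans (Im_le_cabs _) (uB k)).
exists (a +i* b)%C => e e0; have e2 : 0 < e / 2 by rewrite divr_gt0.
apply: (filterS _ (filterI (ha _ e2) (hb _ e2))) => k /= [h1 h2].
rewrite (le_trans (cabs_le_ReIm _))// [leRHS](splitr e).
by move: h1 h2; case: (u k) => x y /= h1 h2; rewrite lerD.
Qed.

Lemma taylor_disc f (r : R) : entire f -> 0 < r -> exists a (B : R),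
  (forall n, cabs (a n) * r ^+ n <= B) /\
  (forall z, cabs z < r -> cvgC (fun n => \sum_(k < n) a k * z ^+ k) (f z)).
Proof.
move=> fe r0; have [B B0 fB] := entire_bounded fe r0.
pose A n k := cmean k (fun u => f (r%:C%C * u) / (r%:C%C * u) ^+ n).
have ru u : cabs u = 1 -> cabs (r%:C%C * u) = r by move=> u1; rewrite cabsMr u1 mulr1 gtr0_norm.
have AB n k : cabs (A n k) <= B / r ^+ n.
  apply: cmean_le => u u1; rewrite cabs_div cabsX ru// ler_wpM2r ?invr_ge0 ?exprn_ge0 ?(ltW r0)//.
  by rewrite fB// ru.
have [U [UU oU]] := ultraFilterLemma (F := \oo : set_system nat) _.
have /choice[a ha] : forall n, exists l, forall e : R, 0 < e -> U [set k | cabs (A n k - l) <= e].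
  by move=> n; exact: ultra_limC (AB n).
have aB n : cabs (a n) * r ^+ n <= B.
  rewrite -ler_pdivlMr ?exprn_gt0//; apply/ler_addgt0Pl => e e0.
  have [k /= hk] := filter_ex (ha n e e0).
  rewrite (_ : a n = A n k - (A n k - a n)); last by rewrite opprB addrC subrK.
  by rewrite (le_trans (cabsB _ _))// addrC lerD.
exists a, B; split => // z zr.
set q := cabs z / r.
have q0 : 0 <= q by rewrite divr_ge0 ?cabs_ge0// ltW.
have q1 : q < 1 by rewrite ltr_pdivrMr// mul1r.
(* Cauchy's formula with the finite geometric expansion of 1 / (1 - z / w): the first N terms give
   the means [A n k], and the remainder has a geometric bound uniform in k. *)
have key N : cabs (\sum_(k < N) a k * z ^+ k - f z) <= B * (q ^+ N / (1 - q)).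
  apply/ler_addgt0Pl => e e0.
  have e2 : 0 < e / 2 by rewrite divr_gt0.
  have [K hK] := cauchy_formula fe zr e2.
  pose C := \sum_(n < N) cabs z ^+ n + 1.
  have C0 : 0 < C by rewrite ltr_wpDl// sumr_ge0// => n _; rewrite exprn_ge0// cabs_ge0.
  have e3 : 0 < e / 2 / C by rewrite divr_gt0.
  have UK : U [set k | (K <= k)%N] by apply: oU; exists K.
  have : U (\bigcap_(n in [set n | (n < N)%N]) [set k | cabs (A n k - a n) <= e / 2 / C]).
    elim: (N) => [|M ih]; first by rewrite (_ : \bigcap_(n in _) _ = setT) ?predeqE//; exact: filterT.
    apply: filterS (filterI ih (ha M _ e3)) => k [/= h1 h2] n /=.
    by rewrite ltnS leq_eqVlt => /predU1P[->//|/h1].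
  move=> /(filterI UK)/filter_ex[k [/= Kk hk]].
  have := hK k Kk; set I := cmean k _ => hI.
  pose S := \sum_(n < N) A n k * z ^+ n.
  have IS : cabs (S - I) <= B * (q ^+ N / (1 - q)).
    have -> : I = S + cmean k (fun u => f (r%:C%C * u) * (z / (r%:C%C * u)) ^+ N
        * (r%:C%C * u / (r%:C%C * u - z))).
      rewrite /S; under eq_bigr do rewrite mulrC -cmeanZ.
      rewrite -cmean_sum -cmeanD; apply: eq_cmean => u u1.
      have w0 : r%:C%C * u != 0 by rewrite -cabs_gt0 ru.
      have wz : r%:C%C * u - z != 0 by rewrite subr_eq0; apply: contraTneq zr => <-; rewrite ru// ltxx.
      set w := r%:C%C * u in w0 wz *.
      elim: (N) => [|M ih]; first by rewrite big_ord0 add0r expr0 mulr1.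
      rewrite big_ord_recr /= {1}ih -addrA; congr (_ + _).
      by rewrite exprS expr_div_n; field; rewrite w0 wz expf_neq0.
    rewrite opprD addNKr cabsN; apply: cmean_le => u u1.
    rewrite cabsM [cabs (f _ * _)]cabsM cabsX !cabs_div ru// -/q -mulrA ler_pM ?cabs_ge0//.
    - by rewrite mulr_ge0 ?exprn_ge0 ?divr_ge0 ?cabs_ge0 ?(ltW r0).
    - by rewrite fB ?ru.
    rewrite ler_wpM2l ?exprn_ge0//.
    have -> : (1 - q)^-1 = r / (r - cabs z).
      by rewrite /q; field; rewrite !gt_eqF// subr_gt0.
    rewrite ler_wpM2l ?(ltW r0)// lef_pV2 ?posrE ?subr_gt0//.
      by rewrite -{1}(ru u u1) cabs_lb.
    rewrite cabs_gt0 subr_eq0; apply: contraTneq zr => <-; rewrite ru// ltxx//.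
  have aS : cabs (\sum_(n < N) a n * z ^+ n - S) <= e / 2.
    rewrite /S -sumrB (le_trans (cabs_sum _ _ _))//.
    apply: (@le_trans _ _ (\sum_(n < N) e / 2 / C * cabs z ^+ n)).
      apply: ler_sum => n _; rewrite -mulrBl cabsM cabsX ler_wpM2r ?exprn_ge0 ?cabs_ge0//.
      by rewrite cabs_distC; apply: (hk n) => /=.
    rewrite -mulr_sumr -mulrA ler_piMr ?(ltW e2)// mulrC ler_pdivrMr// mul1r /C; lra.
  rewrite (le_trans (cabs_distD S _ _))//.
  have := cabs_distD I S (f z); lra.
apply: cvgC_bound; exists (fun N => B * (q ^+ N / (1 - q))) => //.
have : (fun N => B * (q ^+ N / (1 - q))) @ \oo --> B * (0 / (1 - q)).
  apply: cvgM; first exact: cvg_cst.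
  by apply: cvgM; [apply: cvg_expr; rewrite ger0_norm|exact: cvg_cst].
by rewrite mul0r mulr0.
Qed.

Definition entire_coefs a := forall r : R, 0 <= r -> exists B, forall n, cabs (a n) * r ^+ n <= B.

Definition expands a f := entire_coefs a /\
  forall z, cvgC (fun n => \sum_(k < n) a k * z ^+ k) (f z).

Lemma coefs_unique a b (B r : R) f : 0 < r ->
  (forall n, cabs (a n) * r ^+ n <= B) -> (forall n, cabs (b n) * r ^+ n <= B) ->
  (forall z, cabs z < r -> cvgC (fun n => \sum_(k < n) a k * z ^+ k) (f z)) ->
  (forall z, cabs z < r -> cvgC (fun n => \sum_(k < n) b k * z ^+ k) (f z)) ->
  a = b.
Proof.
move=> r0 aB bB af bf; apply/funext => n; apply/eqP; rewrite -subr_eq0 -cabs_eq0.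
have r2 : 0 < r / 2 by rewrite divr_gt0.
have r2r : r / 2 < r by rewrite gtr_pMr// invf_lt1// ltr1n.
have := @cauchy_estimate (fun n => a n - b n) (B + B) r (r / 2) 0 (fun=> 0) n r2 r2r.
rewrite eq_le cabs_ge0 andbT => h.
rewrite -(ler_pM2r (exprn_gt0 n r2)) mul0r h// => [m|z zr|z _]; last by rewrite cabs0.
  by rewrite (le_trans (ler_wpM2r (exprn_ge0 _ (ltW r0)) (cabsB _ _)))// mulrDl lerD.
have zr' : cabs z < r by rewrite zr.
have := cvgCD (af z zr') (cvgCN (bf z zr')); rewrite subrr.
suff -> : (fun n => \sum_(k < n) (a k - b k) * z ^+ k) =
    (fun n => \sum_(k < n) a k * z ^+ k - \sum_(k < n) b k * z ^+ k) by [].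
by apply/funext => m; rewrite -sumrB; apply: eq_bigr => k _; rewrite mulrBl.
Qed.

(** By [coefs_unique], expansions on discs of different radii share their coefficients, so those
    found on the unit disc serve everywhere. *)
Lemma taylor f : entire f -> exists a, expands a f.
Proof.
move=> fe; have [a [B [aB af]]] := taylor_disc fe ltr01.
have aR (r : R) : 1 <= r -> exists B, (forall n, cabs (a n) * r ^+ n <= B) /\
    (forall z, cabs z < r -> cvgC (fun n => \sum_(k < n) a k * z ^+ k) (f z)).
  move=> r1; have r0 : 0 < r := lt_le_trans ltr01 r1.
  have [b [C [bC bf]]] := taylor_disc fe r0.
  suff -> : a = b by exists C.
  apply: (@coefs_unique _ _ (B + C) 1 f) => // [n|n|z z1].
  - rewrite (le_trans (aB n))// lerDl (le_trans _ (bC 0%N))// mulr_ge0 ?cabs_ge0//.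
  - rewrite (@le_trans _ _ C) ?lerDr ?(le_trans _ (aB 0%N)) ?mulr_ge0 ?cabs_ge0//.
    rewrite (le_trans _ (bC n))// ler_wpM2l ?cabs_ge0// expr1n exprn_ege1//.
  - by apply: bf; rewrite (lt_le_trans z1).
exists a; split => [r r0|z].
  have [|C [aC _]] := aR (r + 1); first by rewrite lerDr.
  exists C => n; rewrite (le_trans _ (aC n))// ler_wpM2l ?cabs_ge0// lerXn2r ?nnegrE ?addr_ge0//.
  by rewrite lerDl.
have [|C [_]] := aR (cabs z + 1); first by rewrite lerDr cabs_ge0.
by apply; rewrite ltrDl.
Qed.

End Taylor.

(** * Series with Gaussian coefficients *)

Section GaussianSums.
Variable R : realType.

Lemma expR_geom_lt1 : expR (-1) < 1 :> R.
Proof. by rewrite -[ltRHS]expR0 ltr_expR oppr_lt0. Qed.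

(** Independence of the centre [x] is the point: replacing it by a natural number costs a factor
    [expR 1] and leaves two geometric series. *)
Lemma exp_dist_sum : exists2 C : R, 0 < C & forall (x : R) N,
  \sum_(n < N) expR (- `|n%:R - x|) <= C.
Proof.
set q := expR (-1) : R; have q0 : 0 <= q := ltW (expR_gt0 _).
have q1 : q < 1 := expR_geom_lt1; have q1' : 0 < 1 - q by rewrite subr_gt0.
exists (expR 1 * ((1 - q)^-1 + (1 - q)^-1)) => [|x N].
  by rewrite mulr_gt0 ?expR_gt0// addr_gt0 ?invr_gt0.
have [m hm] : exists m : nat, forall n : nat, `|n%:R - m%:R| - 1 <= `|n%:R - x|.
  have [x0|/ltW x0] := leP 0 x; last first.
    exists 0%N => n; rewrite subr0 ger0_norm// ger0_norm; last by rewrite subr_ge0 (le_trans x0).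
    lra.
  exists (Num.truncn x) => n; have /andP[h1 h2] := truncn_itv x0.
  rewrite lerBlDr -addn1 natrD in h2 *.
  have -> : n%:R - (Num.truncn x)%:R = (n%:R - x) + (x - (Num.truncn x)%:R) by ring.
  by rewrite (le_trans (ler_normD _ _))// lerD2l ger0_norm; lra.
have expq k : expR (- k%:R) = q ^+ k by rewrite /q -expRM_natr mulN1r.
have term n : expR (- `|n%:R - x|) <= expR 1 * expR (- `|n%:R - m%:R|).
  by rewrite -expRD ler_expR; have := hm n; lra.
apply: (@le_trans _ _ (\sum_(n < m + N) expR 1 * expR (- `|n%:R - m%:R|))).
  apply: (@le_trans _ _ (\sum_(n < N) expR 1 * expR (- `|n%:R - m%:R|))); first exact: ler_sum.
  rewrite addnC big_split_ord /= lerDl sumr_ge0 => // i _;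
    rewrite mulr_ge0 ?expR_ge0.
rewrite -mulr_sumr ler_wpM2l ?expR_ge0// big_split_ord/=.
have geo k : \sum_(n < k) q ^+ n <= (1 - q)^-1.
  by have := geometric_le 0 k q0 q1; rewrite big_mkord expr0 mul1r.
apply: lerD.
  rewrite (reindex_inj rev_ord_inj) /= (le_trans _ (geo m))//; apply: ler_sum => i _.
  rewrite distrC ger0_norm ?subr_ge0 ?ler_nat ?leq_subr// -natrB ?leq_subr//.
  by rewrite expq subKn// exprS ler_piMl ?exprn_ge0// ltW.
rewrite (le_trans _ (geo N))//; apply: ler_sum => i _.
by rewrite natrD addrAC subrr add0r ger0_norm// expq.
Qed.

(** The exponent is at most K - |n - x|, where K is the maximum of - c y^2 + (b + 1) y. *)
Lemma gaussian_sum (c b : R) : 0 < c -> exists2 C : R, 0 < C & forall (x : R) N,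
  \sum_(n < N) expR (- c * (n%:R - x) ^+ 2 + b * `|n%:R - x|) <= C.
Proof.
move=> c0; have [C C0 hC] := exp_dist_sum.
set K := (b + 1) ^+ 2 / (4 * c).
exists (expR K * C) => [|x N]; first by rewrite mulr_gt0 ?expR_gt0.
apply: (@le_trans _ _ (\sum_(n < N) expR K * expR (- `|n%:R - x|))); last first.
  by rewrite -mulr_sumr ler_wpM2l ?expR_ge0.
apply: ler_sum => n _; rewrite -expRD ler_expR.
rewrite -[(_ - x) ^+ 2]real_normK ?num_real//; set y := `|_|.
have -> : - c * y ^+ 2 + b * y = K - y - c * (y - (b + 1) / (2 * c)) ^+ 2.
  by rewrite /K; field; rewrite gt_eqF.
by rewrite lerBlDr lerDl mulr_ge0 ?sqr_ge0// ltW.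
Qed.

End GaussianSums.

(** * Growth and slow variation of series with Gaussian coefficients *)

Section GoodSeries.
Variables (R : realType) (alpha kappa : R).
Hypothesis alpha_gt0 : 0 < alpha.
Implicit Types (f : R[i] -> R[i]) (z w : R[i]) (a : nat -> R[i]).

Definition tlog z : R := logplus (cabs z).

Lemma tlog_ge0 z : 0 <= tlog z.
Proof. by rewrite /tlog /logplus le_max lexx orbT. Qed.

Lemma cabs_le_tlog z : cabs z <= expR (tlog z).
Proof.
have [z0|z0] := leP (cabs z) 0; first by rewrite (le_trans z0)// expR_ge0.
by rewrite -{1}(@lnK _ (cabs z))// ler_expR /tlog /logplus le_max lexx.
Qed.

Lemma tlog_cabs z : 1 <= cabs z -> cabs z = expR (tlog z).
Proof.
move=> z1; rewrite /tlog /logplus max_l ?ln_ge0// lnK// posrE (lt_le_trans ltr01)//.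
Qed.

Lemma tlog_gt0 z : 0 < tlog z -> cabs z = expR (tlog z).
Proof.
move=> t0; apply: tlog_cabs; rewrite leNgt; apply/negP => z1; move: t0.
by rewrite /tlog /logplus max_r ?ltxx// ln_le0// ltW.
Qed.

Lemma tlog_le1 z : cabs z <= 1 -> tlog z = 0.
Proof. by move=> z1; rewrite /tlog /logplus max_r// ln_le0. Qed.

Lemma cabsX_le_tlog z n : cabs z ^+ n <= expR (n%:R * tlog z).
Proof. by rewrite expRM_natl lerXn2r ?nnegrE ?cabs_ge0 ?expR_ge0// cabs_le_tlog. Qed.

Definition weight z := expR (alpha * tlog z ^+ 2 - kappa * tlog z).

Definition good_coefs a (M : R) := forall n,
  cabs (a n) <= M * expR (- (n%:R + kappa) ^+ 2 / (4 * alpha)).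

Let x_ z := 2 * alpha * tlog z - kappa.

(** Completing the square in n: the terms at [z] form a Gaussian of height [weight z] centred at 2
    alpha t - kappa. The slot [y] carries a perturbation. *)
Lemma good_term z n (y : R) :
  expR (- (n%:R + kappa) ^+ 2 / (4 * alpha)) * expR (n%:R * tlog z + y) =
  weight z * expR (- (4 * alpha)^-1 * (n%:R - x_ z) ^+ 2 + y).
Proof.
rewrite /weight -!expRD; congr expR; rewrite /x_.
by field; rewrite gt_eqF.
Qed.

Lemma good_partial_sums : exists2 C : R, 0 < C & forall a M, 0 <= M -> good_coefs a M ->
  forall z N, \sum_(n < N) cabs (a n) * cabs z ^+ n <= C * M * weight z.
Proof.
have c0 : 0 < (4 * alpha)^-1 by rewrite invr_gt0 mulr_gt0.
have [C C0 hC] := gaussian_sum 0 c0.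
exists C => // a M M0 aM z N.
rewrite (_ : C * M * weight z = M * weight z * C); last by ring.
rewrite (le_trans _ (ler_wpM2l _ (hC (x_ z) N))) ?mulr_ge0 ?expR_ge0//.
rewrite mulr_sumr ler_sum// => n _; rewrite -mulrA mul0r -good_term mulrA addr0.
by rewrite ler_pM ?cabs_ge0 ?exprn_ge0 ?cabs_ge0// cabsX_le_tlog.
Qed.

Lemma good_growth : exists2 C : R, 0 < C & forall a f M, 0 <= M -> good_coefs a M ->
  expands a f -> forall z, cabs (f z) <= C * M * weight z.
Proof.
have [C C0 hC] := good_partial_sums.
exists C => // a f M M0 aM [_ af] z; apply: (@cvgC_le _ _ _ _ 0 (af z)) => N _.
rewrite (le_trans (cabs_sum _ _ _))// (le_trans _ (hC a M M0 aM z N))// ler_sum// => n _.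
by rewrite cabsM cabsX.
Qed.

(** The Lipschitz bound for powers, multiplied by [m] so that the exponent k - 1 and its case k = 0
    do not appear. *)
Lemma pow_diff (u v : R[i]) (m : R) k : cabs u <= m -> cabs v <= m ->
  cabs (u ^+ k - v ^+ k) * m <= k%:R * cabs (u - v) * m ^+ k.
Proof.
move=> um vm; have m0 : 0 <= m := le_trans (cabs_ge0 u) um.
elim: k => [|k ih]; first by rewrite !expr0 subrr cabs0 !mul0r.
have -> : u ^+ k.+1 - v ^+ k.+1 = u * (u ^+ k - v ^+ k) + (u - v) * v ^+ k by rewrite !exprS; ring.
have -> : k.+1%:R * cabs (u - v) * m ^+ k.+1 = k%:R * cabs (u - v) * m ^+ k.+1 + cabs (u - v) * m ^+ k.+1.
  by rewrite -[k.+1%:R]natr1; ring.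
rewrite (le_trans (ler_wpM2r m0 (cabsD _ _)))// [leLHS]mulrDl lerD//.
  rewrite cabsM -[leLHS]mulrA (le_trans (ler_pM _ _ um ih)) ?cabs_ge0 ?mulr_ge0 ?cabs_ge0//.
  by rewrite exprS mulrCA.
rewrite cabsM -[leLHS]mulrA ler_wpM2l ?cabs_ge0// exprS mulrC ler_wpM2l// cabsX.
by rewrite lerXn2r// nnegrE ?cabs_ge0.
Qed.

Lemma exp2_bound (k : nat) : k%:R * 2 ^+ k <= expR (2 * k%:R) :> R.
Proof.
have e2 : 2 <= expR 1 :> R by have := expR_ge1Dx (1 : R); lra.
have -> : expR (2 * k%:R) = expR k%:R * expR 1 ^+ k :> R.
  by rewrite -expRM_natl -expRD; congr expR; ring.
rewrite ler_pM ?exprn_ge0//; first by have := expR_ge1Dx (k%:R : R); lra.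
by rewrite lerXn2r ?nnegrE ?expR_ge0.
Qed.

(* Comparing powers relative to the dominant exponent [m] of the series at
   [z] makes the constant independent of [z]. *)
Lemma pow_ratio_diff z w n m : (0 < m)%N -> 1 < cabs z -> 2 * cabs (z - w) <= cabs z ->
  cabs (z ^+ n - w ^+ n * (z / w) ^+ m) * cabs z <=
  cabs z ^+ n * (expR (2 * `|n%:R - m%:R|) * cabs (z - w)).
Proof.
move=> m0 z1 zw.
have z_gt0 : 0 < cabs z := lt_trans ltr01 z1.
have wl : cabs z <= 2 * cabs w by have := cabs_lb z w; lra.
have wr : cabs w <= 2 * cabs z by have := cabs_lb w z; rewrite cabs_distC; lra.
have w_gt0 : 0 < cabs w by lra.
have w0 : w != 0 by rewrite -cabs_gt0.
have [mn|/ltnW nm] := leqP m n.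
  rewrite -(subnK mn); set k := (n - m)%N.
  have -> : z ^+ (k + m) - w ^+ (k + m) * (z / w) ^+ m = z ^+ m * (z ^+ k - w ^+ k).
    by rewrite !exprD expr_div_n; field; rewrite expf_neq0.
  rewrite natrD addrK normr_nat cabsM cabsX exprD -mulrA mulrAC -mulrA mulrC mulrA.
  rewrite ler_wpM2r ?exprn_ge0 ?cabs_ge0//.
  have h := @pow_diff z w (2 * cabs z) k; rewrite mulrC.
  have : cabs (z ^+ k - w ^+ k) * (2 * cabs z) <= k%:R * cabs (z - w) * (2 * cabs z) ^+ k.
    by apply: h => //; lra.
  rewrite exprMn => {}h.
  have := ler_wpM2r (mulr_ge0 (cabs_ge0 (z - w)) (exprn_ge0 k (cabs_ge0 z))) (exp2_bound k).
  have := mulr_ge0 (cabs_ge0 (z ^+ k - w ^+ k)) (cabs_ge0 z); lra.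
rewrite -(subnK nm); set k := (m - n)%N.
have -> : z ^+ n - w ^+ n * (z / w) ^+ (k + n) = z ^+ n / w ^+ k * (w ^+ k - z ^+ k).
  by rewrite !exprD !expr_div_n; field; rewrite !expf_neq0.
rewrite natrD opprD addrCA subrr addr0 normrN normr_nat cabsM cabs_div !cabsX.
rewrite -!mulrA ler_wpM2l ?exprn_ge0 ?cabs_ge0// mulrC ler_pdivrMr ?exprn_gt0//.
have h := @pow_diff w z (2 * cabs w) k; rewrite (cabs_distC z).
have : cabs (w ^+ k - z ^+ k) * (2 * cabs w) <= k%:R * cabs (w - z) * (2 * cabs w) ^+ k.
  by apply: h => //; lra.
rewrite exprMn => {}h.
have := ler_wpM2r (mulr_ge0 (cabs_ge0 (w - z)) (exprn_ge0 k (cabs_ge0 w))) (exp2_bound k).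
have := ler_wpM2l (cabs_ge0 (w ^+ k - z ^+ k)) wl; lra.
Qed.

(** Since f(w) = 0, f(z) equals f(z) - (z / w)^m f(w) with m the dominant exponent at [z]. Each term
    of this difference gains |z - w| / e^t at the price of exp(2 |n - m|), which the Gaussian decay
    absorbs. *)
Lemma good_vanish : exists2 C : R, 0 < C & forall a f M z w, 0 <= M -> good_coefs a M ->
  expands a f -> f w = 0 -> 2 * cabs (z - w) <= expR (tlog z) ->
  cabs (f z) <= C * M * weight z * (cabs (z - w) / expR (tlog z)).
Proof.
have c0 : 0 < (4 * alpha)^-1 by rewrite invr_gt0 mulr_gt0.
have [C C0 hC] := gaussian_sum 2 c0.
set K := 2 * (`|kappa| + 1).
exists (expR K * C) => [|a f M z w M0 aM [_ af] fw zw]; first by rewrite mulr_gt0 ?expR_gt0.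
set t := tlog z in zw *; have t0 : 0 <= t := tlog_ge0 z.
set m := Num.truncn (2 * alpha * t).
have at0 : 0 <= 2 * alpha * t by rewrite !mulr_ge0// ltW.
have /andP[m1 m2] := truncn_itv at0; rewrite -/m -[m.+1%:R]natr1 in m1 m2.
have key n : cabs (z ^+ n - w ^+ n * (z / w) ^+ m) * expR t <=
    expR (n%:R * t + 2 * `|n%:R - m%:R|) * cabs (z - w).
  rewrite expRD; have [tz|tp] := eqVneq t 0.
    have m0 : m = 0%N by rewrite /m tz mulr0; apply/eqP; rewrite truncn_eq// lexx ltr01.
    rewrite m0 tz expR0 mulr1 mulr0 expR0 mul1r expr0 mulr1 subr0 normr_nat.
    have z1 : cabs z <= 1 by have := cabs_le_tlog z; rewrite -/t tz expR0.
    rewrite tz expR0 in zw.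
    have w2 : cabs w <= 2 by have := cabs_lb w z; rewrite cabs_distC; lra.
    have := @pow_diff z w 2 n; have -> : cabs z <= 2 by lra.
    move=> /(_ isT w2) h; have := ler_wpM2r (cabs_ge0 (z - w)) (exp2_bound n).
    have := cabs_ge0 (z ^+ n - w ^+ n); lra.
  have {}tp : 0 < t by rewrite lt_def tp.
  have zt := tlog_gt0 tp; rewrite -/t in zt.
  have z1 : 1 < cabs z by rewrite zt -expR0 ltr_expR.
  rewrite -zt in zw *; have -> : expR (n%:R * t) = cabs z ^+ n by rewrite zt expRM_natl.
  rewrite -mulrA; have [m0|m0] := posnP m; last exact: pow_ratio_diff.
  rewrite m0 expr0 mulr1 subr0 normr_nat.
  have w2 : cabs w <= 2 * cabs z by have := cabs_lb w z; rewrite cabs_distC; lra.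
  have := @pow_diff z w (2 * cabs z) n; have -> : cabs z <= 2 * cabs z by lra.
  move=> /(_ isT w2); rewrite exprMn => h.
  have := ler_wpM2r (mulr_ge0 (cabs_ge0 (z - w)) (exprn_ge0 n (cabs_ge0 z))) (exp2_bound n).
  have := mulr_ge0 (cabs_ge0 (z ^+ n - w ^+ n)) (cabs_ge0 z); lra.
have := cvgCD (af z) (cvgCN (cvgCZ ((z / w) ^+ m) (af w))); rewrite fw mulr0 subr0 => cv.
apply: (@cvgC_le _ _ _ _ 0 cv) => N _.
rewrite mulr_sumr -sumrB (le_trans (cabs_sum _ _ _))//.
rewrite (_ : expR K * C * M * weight z * (cabs (z - w) / expR t) =
   M * weight z * (cabs (z - w) / expR t) * expR K * C); last by ring.
have D0 : 0 <= M * weight z * (cabs (z - w) / expR t) * expR K.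
  by rewrite !mulr_ge0 ?expR_ge0 ?invr_ge0 ?cabs_ge0 ?expR_ge0.
rewrite (le_trans _ (ler_wpM2l D0 (hC (x_ z) N)))// mulr_sumr ler_sum// => n _.
have -> : a n * z ^+ n - (z / w) ^+ m * (a n * w ^+ n) = a n * (z ^+ n - w ^+ n * (z / w) ^+ m).
  by rewrite mulrBr [in RHS](mulrC (w ^+ n)) (mulrCA (a n)).
rewrite cabsM -(ler_pM2r (expR_gt0 t)) -[leLHS]mulrA.
rewrite (le_trans (ler_pM _ _ (aM n) (key n))) ?mulr_ge0 ?cabs_ge0 ?expR_ge0//.
have gt := good_term z n (2 * `|n%:R - m%:R|); rewrite -/t in gt.
rewrite [leLHS](_ : _ = M * (expR (- (n%:R + kappa) ^+ 2 / (4 * alpha)) * expR (n%:R * t + 2 * `|n%:R - m%:R|) * cabs (z - w))); last by ring.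
rewrite gt [leRHS](_ : _ = M * (weight z * (expR K *
   expR (- (4 * alpha)^-1 * (n%:R - x_ z) ^+ 2 + 2 * `|n%:R - x_ z|)) * cabs (z - w))); last first.
  by field; rewrite gt_eqF ?expR_gt0.
rewrite ler_wpM2l// ler_wpM2r ?cabs_ge0// ler_wpM2l ?expR_ge0// -expRD ler_expR.
have : `|n%:R - m%:R| <= `|n%:R - x_ z| + (`|kappa| + 1).
  have -> : n%:R - m%:R = (n%:R - x_ z) + (x_ z - m%:R) by ring.
  rewrite (le_trans (ler_normD _ _))// lerD2l.
  have -> : x_ z - m%:R = (2 * alpha * t - m%:R) - kappa by rewrite /x_ -/t; ring.
  by rewrite (le_trans (ler_normB _ _))// addrC lerD2l ger0_norm; lra.
rewrite /K; lra.
Qed.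

End GoodSeries.

(** * Division of a power series by its zeros *)

Section ZeroDivision.
Variable R : realType.
Implicit Types (f : R[i] -> R[i]) (z w m : R[i]) (a b : nat -> R[i]).

Definition sums_to a z v := cvgC (fun n => \sum_(k < n) a k * z ^+ k) v.

(** Coefficients of f(z) / (z - m), obtained by formal division. *)
Definition quotient_coefs a m n := - (\sum_(j < n.+1) a j * m ^+ j) / m ^+ n.+1.

(** As the series vanishes at [m], the partial sum in [quotient_coefs] is minus a tail, which is
    geometrically small relative to any larger radius. *)
Lemma quotient_coefs_entire a m : m != 0 -> entire_coefs a -> sums_to a m 0 ->
  entire_coefs (quotient_coefs a m).
Proof.
move=> m0 ha am r r0; set p := r + 2 * cabs m.
have mp : 0 < cabs m by rewrite cabs_gt0.
have p0 : 0 < p by rewrite /p; lra.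
have mp' : cabs m < p by rewrite /p; lra.
have [B hB] := ha p (ltW p0); set q := cabs m / p.
have q1 : 0 < 1 - q by rewrite subr_gt0 /q ltr_pdivrMr// mul1r.
exists (B / p / (1 - q)) => n; rewrite /quotient_coefs cabs_div cabsN cabsX.
have := power_series_tail n.+1 p0 hB mp' am; rewrite -/q sub0r cabsN => h.
have B0 : 0 <= B by rewrite (le_trans _ (hB 0%N))// mulr_ge0 ?cabs_ge0// exprn_ge0// ltW.
rewrite mulrAC ler_pdivrMr ?exprn_gt0//.
rewrite (le_trans (ler_wpM2r (exprn_ge0 _ r0) h))//.
rewrite [leRHS](_ : _ = B * (q ^+ n.+1 / (1 - q)) * p ^+ n).
  apply: ler_wpM2l; last by rewrite lerXn2r ?nnegrE ?(ltW p0)// /p; lra.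
  by rewrite !mulr_ge0 ?exprn_ge0 ?invr_ge0 ?divr_ge0 ?(ltW mp) ?(ltW p0) ?(ltW q1).
have pn : p ^+ n != 0 by rewrite expf_neq0 ?gt_eqF.
rewrite /q expr_div_n -/q (exprSr p); move: (p ^+ n) pn => x x0.
by field; rewrite x0 !gt_eqF.
Qed.

Lemma quotient_coefs_sum a m z N : m != 0 ->
  (z - m) * \sum_(n < N) quotient_coefs a m n * z ^+ n =
  \sum_(n < N) a n * z ^+ n - (\sum_(j < N) a j * m ^+ j) / m ^+ N * z ^+ N.
Proof.
move=> m0; elim: N => [|N ih]; first by rewrite !big_ord0 mulr0 !mul0r subr0.
rewrite 2!big_ord_recr /= mulrDr ih /quotient_coefs big_ord_recr /= !exprS.
set s := \sum_(_ < N) _ * m ^+ _; set s' := \sum_(_ < N) _.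
move: (z ^+ N) => y; have mN := expf_neq0 N m0; move: (m ^+ N) mN => x x0.
by field; rewrite m0 x0.
Qed.

Lemma quotient_coefs_sums_to a m z v : m != 0 -> entire_coefs a -> sums_to a m 0 ->
  z != m -> sums_to a z v -> sums_to (quotient_coefs a m) z (v / (z - m)).
Proof.
move=> m0 ha am zm az; have zm0 : z - m != 0 by rewrite subr_eq0.
have rem0 : cvgC (fun N => - ((\sum_(j < N) a j * m ^+ j) / m ^+ N * z ^+ N)) 0.
  have [B hB] := quotient_coefs_entire m0 ha am (addr_ge0 (cabs_ge0 z) ler01).
  suff : cvgC (fun N => quotient_coefs a m N * z ^+ N.+1) 0.
    move=> h e e0; have [N hN] := h e e0; exists N.+1 => -[//|n]; rewrite ltnS => /hN.
    by rewrite /quotient_coefs !mulNr.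
  have r1 : 0 < cabs z + 1 by rewrite ltr_wpDl// cabs_ge0.
  set q := cabs z / (cabs z + 1).
  have q1 : q < 1 by rewrite ltr_pdivrMr// mul1r ltrDl.
  have q0 : 0 <= q by rewrite divr_ge0 ?cabs_ge0// ltW.
  apply: cvgC_bound; exists (fun N => B * cabs z * q ^+ N).
    rewrite -[X in _ --> X](mulr0 (B * cabs z)); apply: cvgM; first exact: cvg_cst.
    by apply: cvg_expr; rewrite ger0_norm.
  move=> N; rewrite subr0 cabsM cabsX exprS.
  have -> : cabs z ^+ N = q ^+ N * (cabs z + 1) ^+ N by rewrite -exprMn /q divfK ?gt_eqF.
  have := ler_wpM2l (mulr_ge0 (cabs_ge0 z) (exprn_ge0 N q0)) (hB N).
  by move: (q ^+ N) (_ ^+ N) (cabs (quotient_coefs _ _ _)) => x1 x2 x3; lra.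
have := cvgCZ (z - m)^-1 (cvgCD az rem0); rewrite addr0 mulrC.
suff -> : (fun n => (z - m)^-1 * (\sum_(k < n) a k * z ^+ k - (\sum_(j < n) a j * m ^+ j) / m ^+ n * z ^+ n)) =
  (fun n => \sum_(k < n) quotient_coefs a m k * z ^+ k) by [].
by apply/funext => n; rewrite -quotient_coefs_sum// mulKf.
Qed.

(** Zeros are removed one at a time. [P] is general because the value of a quotient at the zero just
    removed is unknown, so this point leaves the domain in the induction. *)
Lemma divide_zeros (s : seq R[i]) (P : R[i] -> Prop) f a : uniq s -> 0 \notin s ->
  entire_coefs a -> (forall z, P z -> sums_to a z (f z)) ->
  (forall m, m \in s -> P m /\ f m = 0) ->
  exists2 b, entire_coefs b &
    forall z, P z -> z \notin s -> sums_to b z (f z / \prod_(m <- s) (z - m)).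
Proof.
elim: s P f a => [|m s ih] P f a /=.
  move=> _ _ ha af _; exists a => // z Pz _; rewrite big_nil divr1; exact: af.
rewrite inE negb_or eq_sym => /andP[ms us] /andP[m0 s0] ha af zs.
have [Pm fm] := zs m (mem_head _ _).
have am : sums_to a m 0 by rewrite -fm; exact: af.
have [z [Pz zm]|m' m's|b hb hs] := ih (fun z => P z /\ z != m) (fun z => f z / (z - m))
  (quotient_coefs a m) us s0 (quotient_coefs_entire m0 ha am).
- by apply: quotient_coefs_sums_to => //; exact: af.
- have [Pm' fm'] := zs m' (mem_behead (s := m :: s) m's); split; last by rewrite fm' mul0r.
  by split => //; apply: contraNneq ms => <-.
exists b => // z Pz; rewrite inE negb_or => /andP[zm zs']; rewrite big_cons invfM mulrA.
by apply: hs.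
Qed.

End ZeroDivision.

(** * A Jensen-type bound for the zeros in a window *)

Section WindowBound.
Variables (R : realType) (alpha kappa : R).
Hypothesis alpha_gt0 : 0 < alpha.
Implicit Types (f : R[i] -> R[i]) (z w : R[i]) (a : nat -> R[i]).

Lemma expR_oneB_ge (x : R) : 0 <= x <= 2^-1 -> expR (- (2 * x)) <= 1 - x.
Proof.
move=> /andP[x0 x1]; have x1' : 0 < 1 - x by lra.
rewrite expRN -[leRHS]invrK lef_pV2 ?posrE ?invr_gt0 ?expR_gt0//.
rewrite (le_trans _ (expR_ge1Dx _))// -[leLHS]mul1r ler_pdivrMr//; nra.
Qed.

Lemma expR_N_le_half (x : R) : 1 <= x -> expR (- x) <= 2^-1.
Proof.
move=> x1; rewrite expRN lef_pV2 ?posrE ?expR_gt0//.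
by rewrite (le_trans _ (expR_ge1Dx x))//; lra.
Qed.

(* Dividing [f] by the polynomial vanishing on [Z] and bounding the Taylor
   coefficients of the quotient on the two circles at logarithmic distance [s]
   from [l] replaces Jensen's formula. *)
Lemma zeros_in_window (K : R) : exists C : R, forall a f LM l (Z : seq R[i]) (s la : R),
  good_coefs alpha kappa a (expR LM) -> expands a f ->
  1 <= s -> s < tlog l -> (size Z)%:R <= 2 * alpha * tlog l - kappa ->
  uniq Z -> l \notin Z -> (forall m, m \in Z -> f m = 0 /\ `|tlog m - tlog l| <= s - 1) ->
  \sum_(m <- Z) expR (- (s - (tlog m - tlog l))) <= K ->
  \sum_(m <- Z) expR (- (s + (tlog m - tlog l))) <= K ->
  \sum_(m <- Z) expR (- `|tlog m - tlog l|) <= K ->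
  expR la * weight alpha kappa l <= cabs (f l) ->
  \sum_(m <- Z) (s - `|tlog m - tlog l|) <= 2 * alpha * s ^+ 2 + 2 * s + C + 2 * (LM - la).
Proof.
have [C C0 growth] := good_growth kappa alpha_gt0.
have [C1 C10 hC1] := exp_dist_sum R.
exists (2 * (ln C + ln C1 + 3 * K)) => a f LM l Z s la aM af s1 st Zt uZ lZ hZ K1 K2 K3 fl.
set t := tlog l in st Zt hZ K1 K2 K3 *.
pose D m := tlog m - t.
have t0 : 0 < t by lra.
have lt : cabs l = expR t := tlog_gt0 t0.
have Zm m : m \in Z -> [/\ f m = 0, `|D m| <= s - 1, 0 < tlog m & cabs m = expR (tlog m)].
  move=> /hZ[fm h]; have : 0 < tlog m by move: h; rewrite ler_norml => /andP[]; lra.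
  by move=> tm; split => //; exact: tlog_gt0.
have Z0 : 0 \notin Z.
  apply/negP => /Zm[_ _ _]; rewrite cabs0 => /eqP; rewrite eq_sym gt_eqF ?expR_gt0//.
have [b hb bs] := divide_zeros (P := fun=> True) uZ Z0 af.1 (fun z _ => af.2 z)
  (fun m mZ => conj I (let: And4 h _ _ _ := Zm m mZ in h)).
set nZ : R := (size Z)%:R in Zt *.
set SD := \sum_(m <- Z) D m; set S1 := \sum_(m <- Z) `|D m|.
have sum_cst (x : R) : \sum_(m <- Z) x = nZ * x.
  by rewrite big_const_seq count_predT iter_addr_0 mulr_natl.
(* The exponent at which the outer bound [E1] and the inner bound [E2] coincide. The hypothesis on
   [size Z] makes it nonnegative, so that it has a natural integer part. *)
pose y := 2 * alpha * t - kappa - (nZ * s - SD) / (2 * s).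
have s0 : 0 < s by lra.
have SDs : `|SD| <= nZ * s.
  rewrite (le_trans (ler_norm_sum _ _ _))// -sum_cst big_seq [leRHS]big_seq ler_sum// => m /Zm[_ h _ _].
  by rewrite (le_trans h)//; lra.
have y0 : 0 <= y.
  rewrite /y subr_ge0 (le_trans _ Zt)// ler_pdivrMr ?mulr_gt0//.
  by move: SDs; rewrite ler_norml => /andP[]; lra.
set m := Num.truncn y; have /andP[m1 m2] := truncn_itv y0; rewrite -/m -[m.+1%:R]natr1 in m1 m2.
set E1 := ln C + LM + alpha * (t + s) ^+ 2 - kappa * (t + s) - (nZ * (t + s) - 2 * K) - s * m%:R.
set E2 := ln C + LM + alpha * (t - s) ^+ 2 - kappa * (t - s) - (nZ * t + SD - 2 * K) + s * m%:R.
pose E := Num.max E1 E2.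
have fw w : cabs w = expR (tlog w) -> cabs (f w) <= expR (ln C + LM + alpha * tlog w ^+ 2 - kappa * tlog w).
  move=> _; rewrite (le_trans (growth _ _ _ (expR_ge0 _) aM af w))//.
  by rewrite -addrA 2!expRD (@lnK _ C).
have circ p (d : R[i] -> R) n : 0 < p ->
    (forall m w, m \in Z -> cabs w = expR p -> expR (d m) <= cabs (w - m)) ->
    cabs (b n) * expR (n%:R * p) <=
      expR (ln C + LM + alpha * p ^+ 2 - kappa * p - \sum_(m <- Z) d m).
  move=> p0 hd; rewrite expRM_natl.
  have [B hB] := hb _ (addr_ge0 (expR_ge0 p) ler01).
  apply: (@cauchy_estimate _ b B (expR p + 1) (expR p) _ (fun w => f w / \prod_(m <- Z) (w - m))) => //.
  - exact: expR_gt0.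
  - by rewrite ltrDl.
  - move=> w wp; apply: bs => //; apply/negP => wZ; have := hd _ _ wZ wp.
    by rewrite subrr cabs0 leNgt expR_gt0.
  move=> w wp; have tw : tlog w = p.
    by rewrite /tlog /logplus wp expRK max_l// ltW.
  have pos : 0 < \prod_(m <- Z) expR (d m) by rewrite -expR_sum expR_gt0.
  have pp : \prod_(m <- Z) expR (d m) <= cabs (\prod_(m <- Z) (w - m)).
    rewrite cabs_prod big_seq [leRHS]big_seq; apply: ler_prod => m' mZ.
    by rewrite expR_ge0 hd.
  rewrite cabs_div ler_pdivrMr ?(lt_le_trans pos)//.
  rewrite (le_trans (fw w _)) ?tw//.
  rewrite (le_trans _ (ler_wpM2l (expR_ge0 _) pp))// -expR_sum -expRD ler_expR; lra.
(* The outer circle serves the exponents n above m and the inner one those below; returning to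
   radius e^t gains s |n - m|, at least |n - m|. *)
have bE n : cabs (b n) * expR (n%:R * t) <= expR (E - `|n%:R - m%:R|).
  have [mn|nm] := leqP m n.
    have mn' : m%:R <= n%:R :> R by rewrite ler_nat.
    rewrite (_ : expR (n%:R * t) = expR (n%:R * (t + s)) * expR (- (n%:R * s))); last first.
      by rewrite -expRD; congr expR; ring.
    have := @circ (t + s) (fun m => (t + s) - 2 * expR (- (s - D m))) n _ _.
    rewrite sumrB sum_cst -mulr_sumr mulrA => h.
    rewrite (le_trans (ler_wpM2r (expR_ge0 _) (h _ _)))//.
    - by lra.
    (* Zeros keep logarithmic distance at least 1 from the circle, so |m' / w| is at most 1 / 2 and
       1 - x >= exp(- 2 x) applies. *)
    - move=> m' w /Zm[_ Dm _ mE] wE; rewrite (le_trans _ (cabs_lb _ _))// wE mE.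
      have -> : expR (tlog m') = expR (t + s) * expR (- (s - D m')).
        by rewrite -expRD; congr expR; rewrite /D; ring.
      rewrite expRD -[X in _ <= X - _]mulr1 -mulrBr ler_wpM2l ?expR_ge0//.
      rewrite expR_oneB_ge// expR_ge0 expR_N_le_half//.
      by move: Dm; rewrite ler_norml => /andP[]; lra.
    rewrite -expRD ler_expR ger0_norm ?subr_ge0//.
    have : 1 * (n%:R - m%:R) <= s * (n%:R - m%:R) by rewrite ler_wpM2r ?subr_ge0.
    have : E1 <= E by rewrite /E le_max lexx.
    rewrite /E1; lra.
  have nm' : n%:R <= m%:R :> R by rewrite ler_nat ltnW.
  rewrite (_ : expR (n%:R * t) = expR (n%:R * (t - s)) * expR (n%:R * s)); last first.
    by rewrite -expRD; congr expR; ring.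
  have := @circ (t - s) (fun m => tlog m - 2 * expR (- (s + D m))) n _ _.
  have -> : \sum_(m <- Z) (tlog m - 2 * expR (- (s + D m))) =
      nZ * t + SD - 2 * \sum_(m <- Z) expR (- (s + D m)).
    rewrite sumrB -mulr_sumr; congr (_ - _); rewrite -sum_cst -big_split /=.
    by apply: eq_bigr => m' _; rewrite /D; ring.
  move=> h; rewrite [cabs _ * (_ * _)]mulrA (le_trans (ler_wpM2r (expR_ge0 _) (h _ _)))//.
  - by lra.
  - move=> m' w /Zm[_ Dm _ mE] wE; rewrite cabs_distC (le_trans _ (cabs_lb _ _))// wE mE.
    have -> : expR (t - s) = expR (tlog m') * expR (- (s + D m')).
      by rewrite -expRD; congr expR; rewrite /D; ring.
    rewrite expRD -[X in _ <= X - _]mulr1 -mulrBr ler_wpM2l ?expR_ge0//.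
    rewrite expR_oneB_ge// expR_ge0 expR_N_le_half//.
    by move: Dm; rewrite ler_norml => /andP[]; lra.
  rewrite -expRD ler_expR distrC ger0_norm ?subr_ge0//.
  have : 1 * (m%:R - n%:R) <= s * (m%:R - n%:R) by rewrite ler_wpM2r ?subr_ge0.
  have : E2 <= E by rewrite /E le_max lexx orbT.
  rewrite /E2; lra.
have quot : cabs (f l / \prod_(m <- Z) (l - m)) <= expR E * C1.
  apply: (@cvgC_le _ _ _ _ 0 (bs l I lZ)) => N _.
  rewrite (le_trans (cabs_sum _ _ _))// (le_trans _ (ler_wpM2l (expR_ge0 E) (hC1 m%:R N)))//.
  rewrite mulr_sumr ler_sum// => n _; rewrite cabsM cabsX lt -expRM_natl -expRD.
  exact: bE.
(* (|D| + D) / 2 is the positive part of D, so the first two terms describe the larger modulus; the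
   last one bounds the factor 1 + exp(- |D|). *)
have lm m' : m' \in Z -> cabs (l - m') <= expR (t + (`|D m'| + D m') / 2 + expR (- `|D m'|)).
  move=> /Zm[_ _ _ mE]; rewrite (le_trans (cabsB _ _))// lt mE expRD.
  have e1 := expR_ge1Dx (expR (- `|D m'|)).
  rewrite (le_trans _ (ler_wpM2l (expR_ge0 _) e1))// mulrDr mulr1 -expRD.
  have -> : tlog m' = t + D m' by rewrite /D; ring.
  have [D0|D0] := leP 0 (D m').
    by rewrite (ger0_norm D0) addrC; apply: lerD; rewrite ler_expR; clear; lra.
  by rewrite (ltr0_norm D0); apply: lerD; rewrite ler_expR; clear; lra.
have prod_le : cabs (\prod_(m <- Z) (l - m)) <= expR (nZ * t + (S1 + SD) / 2 + K).
  rewrite cabs_prod (@le_trans _ _ (\prod_(m' <- Z) expR (t + (`|D m'| + D m') / 2 + expR (- `|D m'|))))//.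
    rewrite big_seq [leRHS]big_seq; apply: ler_prod => m' mZ; rewrite cabs_ge0; exact: lm.
  rewrite -expR_sum ler_expR !big_split /= sum_cst -mulr_suml big_split /= -/S1 -/SD.
  by rewrite lerD2l.
have prod_neq0 : \prod_(m <- Z) (l - m) != 0.
  rewrite prodf_seq_neq0; apply/allP => m' m'Z; rewrite subr_eq0.
  by apply: contraNneq lZ => ->.
have main : la + (alpha * t ^+ 2 - kappa * t) <= E + ln C1 + (nZ * t + (S1 + SD) / 2 + K).
  rewrite -ler_expR expRD (le_trans fl)// -(divfK prod_neq0 (f l)) cabsM.
  rewrite expRD (expRD E) (@lnK _ C1)// ler_pM ?cabs_ge0//.
have -> : \sum_(m0 <- Z) (s - `|tlog m0 - t|) = nZ * s - S1 by rewrite sumrB sum_cst.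
have sy : s * y = s * (2 * alpha * t - kappa) - (nZ * s - SD) / 2.
  by rewrite /y; field; rewrite gt_eqF.
have sm1 : s * m%:R <= s * y by rewrite ler_wpM2l// ltW.
have sm2 : s * y <= s * m%:R + s by have := ler_wpM2l (ltW s0) (ltW m2); rewrite [s * (m%:R + 1)]mulrDr mulr1.
(* At [y] both bounds equal their average, in which the terms nZ t and SD cancel against the product
   of the |l - m|; rounding [y] to [m] costs at most s. *)
move: main; rewrite /E; have [_|_] := leP E1 E2; rewrite /E1 /E2; lra.
Qed.

End WindowBound.

(** * Sums over finite subsets *)

Section FiniteSums.
Variable R : realType.

Lemma esum_le_seq (T : choiceType) (S : set T) (a : T -> R) (B : R) :
  (forall Z : seq T, uniq Z -> (forall z, z \in Z -> S z) -> \sum_(z <- Z) a z <= B) ->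
  (\esum_(z in S) (a z)%:E <= B%:E)%E.
Proof.
move=> h; apply: ge_ereal_sup => _ [A [finA AS] <-].
have [Z ZA] := (finite_seqP A).1 finA.
have -> : A = [set` undup Z] by rewrite ZA; apply/seteqP; split => z /=; rewrite mem_undup.
rewrite -fsbig_seq ?undup_uniq// sumEFin lee_fin; apply: h; first exact: undup_uniq.
by move=> z; rewrite mem_undup => zZ; apply: AS; rewrite ZA.
Qed.

Lemma seq_le_esum (T : choiceType) (S : set T) (a : T -> R) (Z : seq T) :
  uniq Z -> (forall z, z \in Z -> S z) ->
  ((\sum_(z <- Z) a z)%:E <= \esum_(z in S) (a z)%:E)%E.
Proof.
move=> uZ ZS; apply: esum_ge; exists [set` Z]; first by split => //; exact: finite_seq.
by rewrite -fsbig_seq// sumEFin.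
Qed.

Lemma esum_fin_bound (T : choiceType) (S : set T) (a : T -> R) :
  (\esum_(z in S) (a z)%:E < +oo)%E -> exists B : R, forall Z : seq T, uniq Z ->
    (forall z, z \in Z -> S z) -> \sum_(z <- Z) a z <= B.
Proof.
move=> h; exists (fine (\esum_(z in S) (a z)%:E)) => Z uZ ZS.
have := seq_le_esum a uZ ZS; move: h; case: (\esum_(z in S) _)%E => //= r.
Qed.

Lemma sum_by_shell (T : eqType) (Z : seq T) (k : T -> nat) (F : nat -> R) (N K : nat) :
  (forall n, 0 <= F n) -> (forall z, z \in Z -> (k z < N)%N) ->
  (forall n, (count (fun z => k z == n) Z <= K)%N) ->
  \sum_(z <- Z) F (k z) <= K%:R * \sum_(n < N) F n.
Proof.
move=> F0 kN kK.
have -> : \sum_(z <- Z) F (k z) = \sum_(z <- Z) \sum_(n < N) (if k z == n then F n else 0).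
  rewrite big_seq [RHS]big_seq; apply: eq_bigr => z /kN zN.
  rewrite (bigD1 (Ordinal zN))//= eqxx big1 ?addr0// => i; rewrite -val_eqE /= eq_sym => /negPf ->//.
rewrite exchange_big /= mulr_sumr; apply: ler_sum => n _.
rewrite -big_mkcond /= big_const_seq iter_addr_0 -[_ *+ _]mulr_natl ler_wpM2r// ler_nat.
exact: kK.
Qed.

(* A maximal duplicate-free sequence in [A] exhausts [A]. *)
Lemma bounded_enum (T : choiceType) (A : set T) (K : nat) :
  (forall Z : seq T, uniq Z -> (forall z, z \in Z -> A z) -> (size Z <= K)%N) ->
  exists2 Z : seq T, uniq Z & forall z, z \in Z <-> A z.
Proof.
move=> h; pose P n := `[< exists2 Z : seq T, size Z = n & uniq Z /\ (forall z, z \in Z -> A z) >].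
have P0 : exists n, P n by exists 0%N; apply/asboolP; exists [::].
have PK n : P n -> (n <= K)%N by move=> /asboolP[Z <- [uZ ZA]]; exact: h.
case: (ex_maxnP P0 PK) => n /asboolP[W sW [uW WA]] maxn.
exists W => // z; split; first exact: WA.
move=> Az; apply: contrapT => /negP zW.
have : P (size (z :: W)).
  apply/asboolP; exists (z :: W) => //; split; first by rewrite /= zW.
  by move=> y; rewrite inE => /predU1P[->//|/WA].
by move=> /maxn; rewrite /= sW ltnn.
Qed.

End FiniteSums.

(** * Necessity *)

Section Separation.
Variable R : realType.
Implicit Types (L : set R[i]) (z w : R[i]) (Z : seq R[i]).

(** Working form of [d_rho] separation: distances are compared with [expR (tlog z)], that is, with
    max(1, |z|). *)
Definition log_separated L (d : R) := forall z w, L z -> L w -> z <> w ->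
  d * expR (tlog z) <= cabs (z - w).

Definition in_set L Z := uniq Z /\ forall z, z \in Z -> L z.

Lemma in_set_filter L (P : pred R[i]) Z : in_set L Z -> in_set L (seq.filter P Z).
Proof.
by move=> [uZ ZL]; split; [exact: filter_uniq|move=> z; rewrite mem_filter => /andP[_ /ZL]].
Qed.

Definition shell_bound L (K : nat) := forall Z (x : R), in_set L Z ->
  (forall z, z \in Z -> x <= tlog z <= x + 1) -> (size Z <= K)%N.

(** Pigeonhole on a grid of mesh (d / 3) e^x: two points in one cell would be closer than d e^x, and
    the number of cells does not depend on x. *)
Lemma separated_shell_bound L (d : R) : 0 < d -> log_separated L d ->
  exists K, shell_bound L K.
Proof.
move=> d0 Ld; set h := d / 3; have h0 : 0 < h by rewrite divr_gt0.
pose N := (Num.truncn (2 * expR 1 / h)).+1.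
exists (N * N)%N => Z x [uZ ZL] Zx.
have ex0 := expR_gt0 x.
pose g (u : R) := Num.truncn ((u + expR (x + 1)) / (h * expR x)).
have gN (u : R) : `|u| <= expR (x + 1) -> 0 <= (u + expR (x + 1)) / (h * expR x) /\ (g u < N)%N.
  rewrite ler_norml => /andP[u1 u2].
  have ge0 : 0 <= (u + expR (x + 1)) / (h * expR x).
    by rewrite divr_ge0 ?mulr_ge0 ?(ltW h0) ?(ltW ex0)//; lra.
  split => //; rewrite ltnS; apply: le_truncn.
  rewrite ler_pdivrMr ?mulr_gt0// [leRHS](_ : _ = 2 * expR (x + 1)); first lra.
  by rewrite expRD; field; rewrite gt_eqF.
have gdiff (u v : R) : `|u| <= expR (x + 1) -> `|v| <= expR (x + 1) -> g u = g v ->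
    `|u - v| <= h * expR x.
  move=> /gN[u0 _] /gN[v0 _] guv.
  have := truncn_itv u0; have := truncn_itv v0; rewrite -!/(g _) guv -[(g v).+1%:R]natr1.
  have hx : 0 < h * expR x by rewrite mulr_gt0.
  rewrite !(ler_pdivlMr, ltr_pdivrMr)// => /andP[v1 v2] /andP[u1 u2].
  by rewrite ler_norml; apply/andP; split; lra.
have cz z : z \in Z -> cabs z <= expR (x + 1).
  by move=> /Zx/andP[_ zx]; rewrite (le_trans (cabs_le_tlog z))// ler_expR.
pose c z : 'I_N * 'I_N := (inord (g (complex.Re z)), inord (g (complex.Im z))).
have cinj : {in Z &, injective c}.
  move=> z w zZ wZ [] /(congr1 val) /= e1 /(congr1 val) /= e2; apply: contrapT => zw.
  have re (y : R[i]) : y \in Z -> `|complex.Re y| <= expR (x + 1).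
    by move=> /cz; exact: le_trans (Re_le_cabs _).
  have im (y : R[i]) : y \in Z -> `|complex.Im y| <= expR (x + 1).
    by move=> /cz; exact: le_trans (Im_le_cabs _).
  rewrite !inordK ?(gN _ _).2 ?re// in e1; rewrite !inordK ?(gN _ _).2 ?im// in e2.
  have := gdiff _ _ (re _ zZ) (re _ wZ) e1; have := gdiff _ _ (im _ zZ) (im _ wZ) e2.
  have := Ld z w (ZL _ zZ) (ZL _ wZ) zw; have := cabs_le_ReIm (z - w).
  have -> : complex.Re (z - w) = complex.Re z - complex.Re w by case: (z) (w) => ? ? [].
  have -> : complex.Im (z - w) = complex.Im z - complex.Im w by case: (z) (w) => ? ? [].
  have /andP[xz _] := Zx _ zZ.
  have : d * expR x <= d * expR (tlog z) by rewrite ler_wpM2l ?(ltW d0)// ler_expR.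
  have : 0 < d * expR x by rewrite mulr_gt0.
  rewrite /h; lra.
rewrite -(size_map c) -[X in (_ <= X * X)%N]card_ord -card_prod.
rewrite -(card_uniqP _); first exact: max_card.
by rewrite map_inj_in_uniq.
Qed.

Lemma shell_sum L (K : nat) : shell_bound L K ->
  exists2 C : R, 0 <= C & forall Z (x : R), in_set L Z ->
    \sum_(z <- Z) expR (- `|tlog z - x|) <= C.
Proof.
move=> LK; have [C1 C10 hC1] := exp_dist_sum R.
exists (K%:R * (expR 1 * C1)) => [|Z x ZL]; first by rewrite !mulr_ge0 ?expR_ge0 ?(ltW C10).
pose k z := Num.truncn (tlog z); have kE z := truncn_itv (tlog_ge0 z).
pose N := (\max_(z <- Z) k z).+1.
apply: (@le_trans _ _ (\sum_(z <- Z) expR 1 * expR (- `|(k z)%:R - x|))).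
  apply: ler_sum => z _; rewrite -expRD ler_expR.
  have /andP[h1 h2] := kE z; rewrite -[_.+1%:R]natr1 in h2.
  have -> : (k z)%:R - x = (tlog z - x) - (tlog z - (k z)%:R) by ring.
  have := ler_normB (tlog z - x) (tlog z - (k z)%:R).
  have : `|tlog z - (k z)%:R| <= 1 by rewrite /k ler_norml; apply/andP; split; lra.
  lra.
apply: le_trans (sum_by_shell (k := k) (N := N) (K := K) (F := fun n => expR 1 * expR (- `|n%:R - x|)) _ _ _) _.
- by move=> n; rewrite mulr_ge0 ?expR_ge0.
- by move=> z zZ; rewrite ltnS; apply: leq_bigmax_seq.
- move=> n; rewrite -size_filter; apply: (LK _ n%:R); first exact: in_set_filter.
  move=> z; rewrite mem_filter => /andP[/eqP <- _]; have /andP[-> h2] := kE z.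
  by rewrite -[_.+1%:R]natr1 in h2; rewrite ltW.
rewrite -mulr_sumr ler_wpM2l// ler_wpM2l ?expR_ge0//.
Qed.

(** Each such point weighs at least exp(- b) in the sum of [shell_sum] centred at 0, which bounds
    their number. *)
Lemma shell_bound_finite L (K : nat) (b : R) : shell_bound L K ->
  exists2 Z, uniq Z & forall z, z \in Z <-> L z /\ tlog z <= b.
Proof.
move=> LK; have [C C0 hC] := shell_sum LK.
apply: (@bounded_enum _ [set z | L z /\ tlog z <= b] (Num.truncn (C * expR b))) => Z uZ ZL.
have ZL' : in_set L Z by split => // z /ZL[].
have h : (size Z)%:R * expR (- b) <= C.
  rewrite (le_trans _ (hC Z 0 ZL'))// -[size Z]count_predT mulr_natl -iter_addr_0 -big_const_seq.
  rewrite big_seq [leRHS]big_seq ler_sum// => z /ZL[_ zb].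
  by rewrite ler_expR subr0 ger0_norm ?tlog_ge0// lerN2.
have Cb : 0 <= C * expR b by rewrite mulr_ge0 ?expR_ge0.
rewrite -ltnS -(ltr_nat R); have /andP[_] := truncn_itv Cb; apply: le_lt_trans.
by rewrite -ler_pdivrMr ?expR_gt0// -expRN.
Qed.

End Separation.

(** * Condensation of bad configurations, and separation *)

Section Necessity.
Variables (R : realType) (alpha kappa : R).
Hypothesis alpha_gt0 : 0 < alpha.
Implicit Types (L : set R[i]) (z w : R[i]) (f : R[i] -> R[i]) (a : nat -> R[i]).

(* Common consequence of interpolation for both exponents; it only uses data
   that are square summable with respect to the normalised values. *)
Definition interpolates_l2 L := forall v : R[i] -> R, (forall l, 0 <= v l) ->
  (\esum_(l in L) (v l ^+ 2)%:E < +oo)%E ->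
  exists f a M, [/\ 0 <= M, good_coefs alpha kappa a M, expands a f &
    forall l, L l -> f l = (v l * weight alpha kappa l)%:C%C].

(** The condensation device: one function, with a single [M], sees infinitely many chosen points
    with only a geometric loss at the k-th. *)
Lemma interpolates_sequence L (l : nat -> R[i]) : interpolates_l2 L ->
  (forall k, L (l k)) -> injective l ->
  exists f a M, [/\ 0 <= M, good_coefs alpha kappa a M, expands a f,
    forall k, cabs (f (l k)) = 2^-1 ^+ k * weight alpha kappa (l k) &
    forall z, L z -> (forall k, l k <> z) -> f z = 0].
Proof.
(* Off the sequence the default index 0 is masked by the test in [v]. *)
move=> HL lL linj; pose idx z := xget 0%N [set k | l k = z].
have idxK k : idx (l k) = k.
  by apply: linj; rewrite /idx; apply: (@xgetPex _ 0%N [set j | l j = l k]); exists k.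
pose v z : R := if `[< exists k, l k = z >] then 2^-1 ^+ idx z else 0.
have v0 z : 0 <= v z by rewrite /v; case: ifP => // _; rewrite exprn_ge0.
have [|f [a [M [M0 aM af fv]]]] := HL v v0.
  apply: (@le_lt_trans _ _ (2 : R)%:E); last by rewrite ltry.
  apply: esum_le_seq => Z uZ ZL.
  pose Z' := [seq z <- Z | `[< exists k, l k = z >]].
  apply: (@le_trans _ _ (\sum_(z <- Z') 2^-1 ^+ idx z)).
    rewrite big_filter [leRHS]big_mkcond ler_sum// => z _; rewrite /v; case: ifP => _; last by rewrite expr0n.
    by rewrite expr2 ler_piMl ?exprn_ge0// exprn_ile1// invf_le1// ler1n.
  have := @sum_by_shell R _ Z' idx (fun n => 2^-1 ^+ n) (\max_(z <- Z') idx z).+1 1.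
  move=> /(_ _ _ _)/le_trans; apply.
  - by move=> n; rewrite exprn_ge0.
  - by move=> z zZ; rewrite ltnS; apply: leq_bigmax_seq.
  - move=> n; rewrite (@leq_trans (count (pred1 (l n)) Z'))//; last first.
      by rewrite count_uniq_mem ?filter_uniq//; case: (_ \in _).
    rewrite -!size_filter; apply: uniq_leq_size; first by rewrite !filter_uniq.
    move=> z; rewrite !mem_filter /= => /andP[/eqP <- /andP[zl ->]].
    by rewrite zl andbT; move/asboolP : zl => [k <-]; rewrite idxK eqxx.
  rewrite mul1r; have := @geometric_le R 2^-1 0 (\max_(z <- Z') idx z).+1.
  rewrite big_mkord expr0 mul1r => h; rewrite (le_trans (h _ _))//; first by rewrite invf_lt1// ltr1n.
  by rewrite (_ : 1 - 2^-1 = 2^-1) ?invrK//; field.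
exists f, a, M; split => // [k|z Lz zl].
  rewrite fv// cabsR ger0_norm; last by rewrite mulr_ge0 ?expR_ge0.
  by rewrite /v asboolT ?idxK//; exists k.
by rewrite fv// /v asboolF ?mul0r// => -[k /zl].
Qed.

Lemma d_rhoC z w : d_rho alpha z w = d_rho alpha w z.
Proof. by rewrite /d_rho cabs_distC minC. Qed.

Lemma d_rho_ge0 z w : 0 <= d_rho alpha z w.
Proof.
by rewrite /d_rho !mulr_ge0 ?sqrtr_ge0 ?cabs_ge0// invr_ge0 addr_ge0 ?sqrtr_ge0// le_min !cabs_ge0.
Qed.

(** The minimum in the denominator of [d_rho] is at most |z|, so |z - w| / max(1, |z|) is at most a
    constant times [d_rho]. *)
Lemma good_vanish_rho : exists2 C : R, 0 < C & forall a f M z w, 0 <= M ->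
  good_coefs alpha kappa a M -> expands a f -> f w = 0 -> C * d_rho alpha z w <= 1 ->
  cabs (f z) <= C * M * weight alpha kappa z * d_rho alpha z w.
Proof.
have [C C0 hC] := good_vanish kappa alpha_gt0.
set A := Num.sqrt (2 * alpha); have A0 : 0 < A by rewrite sqrtr_gt0 mulr_gt0.
pose C2 := 1 + A^-1; have C20 : 0 < C2 by rewrite addr_gt0// invr_gt0.
exists (2 * C2 * (C + 1)) => [|a f M z w M0 aM af fw h].
  by rewrite !mulr_gt0// addr_gt0.
have md : cabs (z - w) <= C2 * d_rho alpha z w * expR (tlog z).
  set m := Num.min (cabs z) (cabs w).
  have m0 : 0 <= m by rewrite le_min !cabs_ge0.
  have mz : m <= expR (tlog z) by rewrite (le_trans _ (cabs_le_tlog z))// ge_min lexx.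
  have e1 : 1 <= expR (tlog z) by rewrite -expR0 ler_expR tlog_ge0.
  have -> : cabs (z - w) = d_rho alpha z w * ((A + m) / A).
    by rewrite /d_rho -/A -/m; field; rewrite !gt_eqF// ltr_pwDl.
  have d0 := d_rho_ge0 z w.
  rewrite (mulrC C2) -[leRHS]mulrA ler_wpM2l//.
  have -> : (A + m) / A = 1 + A^-1 * m by field; rewrite gt_eqF.
  by rewrite /C2 mulrDl mul1r lerD// ler_wpM2l// invr_ge0 ltW.
have d0 := d_rho_ge0 z w.
have e0 := expR_gt0 (tlog z).
have Cd : 2 * (C2 * d_rho alpha z w) <= 1.
  by have := mulr_ge0 (ltW C0) (mulr_ge0 (ltW C20) d0); move: h; lra.
have zw : 2 * cabs (z - w) <= expR (tlog z).
  rewrite (le_trans (ler_wpM2l _ md))// -[leRHS]mul1r mulrA mulrA ler_wpM2r ?(ltW e0)//.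
  by rewrite -mulrA.
rewrite (le_trans (hC _ _ _ _ _ M0 aM af fw zw))//.
have W0 : 0 <= M * weight alpha kappa z by rewrite mulr_ge0 ?expR_ge0.
have dle : cabs (z - w) / expR (tlog z) <= C2 * d_rho alpha z w by rewrite ler_pdivrMr.
have h1 := ler_wpM2l W0 dle.
have h2 := mulr_ge0 W0 (mulr_ge0 (ltW C20) d0).
have h3 := ler_wpM2l (ltW C0) h1; have h4 := mulr_ge0 (ltW C0) h2; lra.
Qed.

(** Otherwise there are pairs closer than 4^-k. A function of normalised value 2^-k at the first
    point of the k-th pair and 0 at the second contradicts [good_vanish_rho], as 4^k outgrows 2^k.
    The pairs must be disjoint, hence the preliminary isolation of single points. *)
Lemma interpolates_separated L : interpolates_l2 L -> exists2 d : R, 0 < d &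
  forall z w, L z -> L w -> z <> w -> d <= d_rho alpha z w.
Proof.
move=> HL; have [C C0 hC] := good_vanish_rho.
apply: contrapT => nsep.
have close (e : R) : 0 < e -> exists zw : R[i] * R[i],
    [/\ L zw.1, L zw.2, zw.1 <> zw.2 & d_rho alpha zw.1 zw.2 < e].
  move=> e0; apply: contrapT => none; apply: nsep; exists e => // z w Lz Lw zw.
  by rewrite leNgt; apply/negP => d; apply: none; exists (z, w).
(* Interpolating a nonzero value at [z] and 0 at all other points keeps the latter at a distance
   governed by the resulting [M]. *)
have isolated z : L z -> exists2 r : R, 0 < r & forall w, L w -> z <> w -> r <= d_rho alpha z w.
  move=> Lz; apply: contrapT => acc.
  have [l|| f [a [M [M0 aM af fv]]]] := HL (fun l => (l == z)%:R); first by [].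
    apply: (@le_lt_trans _ _ (1 : R)%:E); last by rewrite ltry.
    apply: esum_le_seq => Z uZ _.
    have -> : \sum_(l <- Z) (l == z)%:R ^+ 2 = (count (pred1 z) Z)%:R :> R.
      rewrite -sum1_count natr_sum [RHS]big_mkcond; apply: eq_bigr => l _ /=.
      by case: eqP => _; rewrite ?expr1n ?expr0n.
    by rewrite count_uniq_mem// lern1; case: (_ \in _).
  have CM : 0 < C * (M + 1) by rewrite mulr_gt0// ltr_wpDl.
  apply: acc; exists (C * (M + 1))^-1; first by rewrite invr_gt0.
  move=> w Lw zw; rewrite leNgt; apply/negP; rewrite -div1r ltr_pdivlMr// => d.
  have d0 := d_rho_ge0 z w.
  have CMd := mulr_ge0 (mulr_ge0 (ltW C0) M0) d0.
  have Cd1 := mulr_ge0 (ltW C0) d0.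
  have Cd : C * d_rho alpha z w <= 1 by lra.
  have fw : f w = 0 by rewrite fv// (introF eqP) ?mul0r// => wz; exact: zw.
  have := hC _ _ _ _ _ M0 aM af fw Cd; rewrite fv// eqxx mul1r cabsR gtr0_norm ?expR_gt0//.
  have W0 := expR_gt0 (alpha * tlog z ^+ 2 - kappa * tlog z).
  rewrite (_ : C * M * _ * _ = weight alpha kappa z * (C * M * d_rho alpha z w)); last by ring.
  by rewrite -{1}[weight _ _ _]mulr1 ler_pM2l//; have := mulr_ge0 (ltW C0) d0; lra.
have /choice[p hp] : forall e : R, exists zw : R[i] * R[i], 0 < e ->
    [/\ L zw.1, L zw.2, zw.1 <> zw.2 & d_rho alpha zw.1 zw.2 < e].
  move=> e; have [e0|e0] := ltP 0 e; last by exists (0, 0).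
  by have [zw h] := close _ e0; exists zw.
have /choice[r hr] : forall z, exists r : R, 0 < r /\ (L z -> forall w, L w -> z <> w -> r <= d_rho alpha z w).
  move=> z; have [Lz|nLz] := pselect (L z); last by exists 1; split.
  by have [r r0 h] := isolated z Lz; exists r.
(* The next tolerance is at most the isolation radii of both points just chosen, so no later pair
   contains either of them. *)
pose next (x : R) := Num.min (x / 4) (Num.min (r (p x).1) (r (p x).2)).
pose e k := iter k next 1.
have eS k : e k.+1 = Num.min (e k / 4) (Num.min (r (p (e k)).1) (r (p (e k)).2)) by [].
have e0 k : 0 < e k.
  by elim: k => [|k ih]; rewrite ?eS ?ltr01// !lt_min (hr _).1 (hr _).1 divr_gt0.
have e4 k : e k <= 4^-1 ^+ k.
  elim: k => [|k ih]; first by rewrite expr0.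
  by rewrite eS (@le_trans _ _ (e k / 4)) ?ge_min ?lexx// exprSr ler_wpM2r.
have emon j k : (j < k)%N -> e k <= e j.+1.
  move=> /subnK <-; elim: (k - j.+1)%N => [|m ih]; first by rewrite add0n.
  rewrite addSn eS (le_trans _ ih)// ge_min; apply/orP; left.
  by rewrite ler_pdivrMr// ler_peMr ?ler1n// ltW.
have far j k z : (j < k)%N -> z = (p (e j)).1 \/ z = (p (e j)).2 ->
    z <> (p (e k)).1 /\ z <> (p (e k)).2.
  move=> jk zj; have [L1 L2 ne dlt] := hp (e k) (e0 k); have [L3 L4 _ _] := hp (e j) (e0 j).
  have Lz : L z by case: zj => ->.
  have rz : e k <= r z.
    by rewrite (le_trans (emon _ _ jk))// eS; case: zj => ->; rewrite !ge_min lexx ?orbT.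
  have sep := (hr z).2 Lz.
  split => zk.
    have := sep _ L2 (eq_ind_r (fun x => x <> _) ne zk); rewrite zk => h.
    by move: (lt_le_trans dlt rz); rewrite zk ltNge h.
  have := sep _ L1; rewrite zk => h; have := h (nesym ne); rewrite d_rhoC => {}h.
  by move: (lt_le_trans dlt rz); rewrite zk ltNge h.
have [k|j k jk|f [a [M [M0 aM af fl f0]]]] := interpolates_sequence (l := fun k => (p (e k)).1) HL.
- by have [] := hp (e k) (e0 k).
- apply: contrapT => /eqP; rewrite neq_ltn => /orP[lt|lt].
    by have [+ _] := far _ _ _ lt (or_introl erefl); apply.
  by have [+ _] := far _ _ _ lt (or_introl erefl); apply; rewrite jk.
have f2 k : f (p (e k)).2 = 0.
  have [L1 L2 ne _] := hp (e k) (e0 k); apply: f0 => // j.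
  case: (ltngtP j k) => [lt|lt|->//].
    by have [_ +] := far _ _ _ lt (or_introl erefl).
  by have [+ _] := far _ _ _ lt (or_intror erefl); move=> /nesym.
have [k hk] : exists k : nat, C * (M + 1) < 2 ^+ k.
  have CM : 0 <= C * (M + 1) by rewrite mulr_ge0 ?addr_ge0// ltW.
  have /andP[_ h] := truncn_itv CM; exists (Num.truncn (C * (M + 1))).+1.
  rewrite (lt_le_trans h)// -natrX ler_nat ltnW// ltn_expl//.
have [L1 L2 ne dlt] := hp (e k) (e0 k).
have d0 := d_rho_ge0 (p (e k)).1 (p (e k)).2.
have d4 : d_rho alpha (p (e k)).1 (p (e k)).2 * 4 ^+ k <= 1.
  by rewrite -ler_pdivlMr ?exprn_gt0// div1r -exprVn (le_trans (ltW dlt)).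
have pk0 : 1 <= 2 ^+ k :> R by rewrite exprn_ege1// ler1n.
have k44 : 4 ^+ k = 2 ^+ k * 2 ^+ k :> R by rewrite -exprMn; congr (_ ^+ _); ring.
set d := d_rho alpha _ _ in d0 d4.
have CMd : C * (M + 1) * d * 2 ^+ k < 1.
  rewrite (lt_le_trans _ d4)// k44 mulrA ltr_pM2r ?(lt_le_trans ltr01 pk0)//.
  rewrite mulrC ltr_pM2l// lt_def d0 andbT.
  have [L1' L2' ne'] := hp (e k) (e0 k); rewrite /d /d_rho.
  rewrite !mulf_neq0 ?invr_eq0//.
    by rewrite gt_eqF// sqrtr_gt0 mulr_gt0.
  - by rewrite cabs_eq0 subr_eq0; apply/eqP.
  - by rewrite gt_eqF// ltr_pwDl ?sqrtr_gt0 ?mulr_gt0// le_min !cabs_ge0.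
have Md0 := mulr_ge0 (mulr_ge0 (ltW C0) M0) d0.
have Cd0 := mulr_ge0 (ltW C0) d0.
have CMd1 : C * (M + 1) * d <= C * (M + 1) * d * 2 ^+ k.
  by rewrite ler_peMr// mulrDr mulr1 mulrDl addr_ge0.
have Cd1 : C * d <= 1 by lra.
have := hC _ _ _ _ _ M0 aM af (f2 k) Cd1; rewrite -/d fl.
have W0 := expR_gt0 (alpha * tlog (p (e k)).1 ^+ 2 - kappa * tlog (p (e k)).1).
rewrite (_ : C * M * _ * _ = C * M * d * weight alpha kappa (p (e k)).1); last by ring.
rewrite ler_pM2r// exprVn -div1r ler_pdivrMr ?(lt_le_trans ltr01 pk0)// => h.
have := mulr_ge0 Cd0 (le_trans ler01 pk0); lra.
Qed.

End Necessity.

(** * From window sums to counts of points *)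

Section DensityBound.
Variables (R : realType) (alpha kappa : R).
Hypothesis alpha_gt0 : 0 < alpha.
Implicit Types (L : set R[i]) (z w : R[i]) (Z J : seq R[i]) (f : R[i] -> R[i]).

Definition window_sum_le L (s A : R) (l : R[i]) := forall Z, in_set L Z -> l \notin Z ->
  (forall z, z \in Z -> `|tlog z - tlog l| <= s - 1) ->
  \sum_(z <- Z) (s - `|tlog z - tlog l|) <= A.

(** If every [s] failed at arbitrarily large points, failures with s_k growing like k could be taken
    far apart. For one interpolating function, [zeros_in_window] bounds the excess e s_k^2 linearly
    in s_k, since the value 2^-k costs only k log 2. *)
Lemma window_sum_bounded L (K : nat) (e : R) (s0 : nat) : interpolates_l2 alpha kappa L ->
  shell_bound L K -> 0 < e -> exists2 s : nat, (s0 <= s)%N & exists T : R,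
  forall l, L l -> T <= tlog l -> window_sum_le L s%:R ((2 * alpha + e) * s%:R ^+ 2) l.
Proof.
move=> HL LK e0; apply: contrapT => none.
have [C C0 hC] := shell_sum LK.
have [C' hC'] := zeros_in_window kappa alpha_gt0 C.
have /choice[p hp] : forall sT : nat * R, exists lZ : R[i] * seq R[i], (s0 <= sT.1)%N ->
    [/\ L lZ.1, sT.2 <= tlog lZ.1, in_set L lZ.2 /\ lZ.1 \notin lZ.2,
     (forall z, z \in lZ.2 -> `|tlog z - tlog lZ.1| <= sT.1%:R - 1) &
     (2 * alpha + e) * sT.1%:R ^+ 2 < \sum_(z <- lZ.2) (sT.1%:R - `|tlog z - tlog lZ.1|)].
  move=> [s T] /=; have [s0s|] := leqP s0 s; last by move=> _; exists (0, [::]).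
  apply: contrapT => h; apply: none; exists s => //; exists T => l Ll Tl Z ZL lZ hZ.
  by rewrite leNgt; apply/negP => lt; apply: h; exists (l, Z).
pose s k := (s0 + k.+1)%N.
(* The term 2 s_k separates successive windows. The last one ensures that the window, holding at
   most C e^(s_k) points, meets the size condition of [zeros_in_window]. *)
pose T k (t : R) := t + 2 * (s k)%:R + 1 + (C * expR (s k)%:R + `|kappa|) / (2 * alpha).
pose x := fix x k := p (s k, T k (if k is k'.+1 then tlog (x k').1 else 0)).
pose l k := (x k).1; pose Z k := (x k).2.
pose prev k := if k is k'.+1 then tlog (l k') else 0.
have hx k : [/\ L (l k), T k (prev k) <= tlog (l k), in_set L (Z k) /\ l k \notin Z k,
     (forall z, z \in Z k -> `|tlog z - tlog (l k)| <= (s k)%:R - 1) &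
     (2 * alpha + e) * (s k)%:R ^+ 2 < \sum_(z <- Z k) ((s k)%:R - `|tlog z - tlog (l k)|)].
  by case: k => [|k]; apply: hp; rewrite /= leq_addr.
have prev0 k : 0 <= prev k by case: k => //= k; exact: tlog_ge0.
have rest0 k : 0 <= (C * expR (s k)%:R + `|kappa|) / (2 * alpha).
  by rewrite divr_ge0 ?addr_ge0 ?mulr_ge0 ?expR_ge0// ltW.
have far j k : (j < k)%N -> tlog (l j) + 2 * (s k)%:R < tlog (l k).
  elim: k j => // k ih j; rewrite ltnS leq_eqVlt => /predU1P[->|jk].
    by have [_ + _ _ _] := hx k.+1; rewrite /T /=; have := rest0 k.+1; lra.
  have := ih _ jk; have [_ + _ _ _] := hx k.+1; rewrite /T /=; have := rest0 k.+1.
  have : 0 <= (s k)%:R :> R by []; lra.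
have smon j k : (j < k)%N -> (s j)%:R <= (s k)%:R :> R by move=> jk; rewrite ler_nat leq_add2l ltnS ltnW.
have [k|j k jk|f [a [M [M0 aM af fl f0]]]] := interpolates_sequence HL (l := l).
- by have [] := hx k.
- apply: contrapT => /eqP; rewrite neq_ltn => /orP[lt|lt]; have := far _ _ lt; rewrite jk.
    by have : 0 <= (s k)%:R :> R by []; lra.
  by have : 0 <= (s j)%:R :> R by []; lra.
(* [M] may be 0, hence the logarithm of M + 1. *)
have aM1 : good_coefs alpha kappa a (expR (ln (M + 1))).
  move=> n; rewrite lnK ?posrE ?ltr_wpDl// (le_trans (aM n))// ler_wpM2r ?expR_ge0//; lra.
have key k : e * (s k)%:R ^+ 2 <= 2 * (s k)%:R + C' + 2 * (ln (M + 1) + k%:R * ln 2).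
  have [Ll Tl [ZL lZ] hZ lt] := hx k.
  have s1 : 1 <= (s k)%:R :> R by rewrite ler1n /s addnS.
  have sz : (size (Z k))%:R * expR (- (s k)%:R) <= C.
    rewrite (le_trans _ (hC (Z k) (tlog (l k)) ZL))// -[size _]count_predT mulr_natl -iter_addr_0 -big_const_seq.
    rewrite big_seq [leRHS]big_seq ler_sum// => z /hZ h.
    by rewrite ler_expR lerN2 (le_trans h)//; lra.
  have sz2 : (size (Z k))%:R <= C * expR (s k)%:R.
    by rewrite -ler_pdivrMr ?expR_gt0// -expRN.
  have T1 : (C * expR (s k)%:R + `|kappa|) / (2 * alpha) <= tlog (l k) - (s k)%:R - 1.
    move: Tl; rewrite /T; have := prev0 k; lra.
  have ta : C * expR (s k)%:R + `|kappa| <= 2 * alpha * (tlog (l k) - (s k)%:R - 1).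
    by move: T1; rewrite ler_pdivrMr ?mulr_gt0// (mulrC _ (2 * alpha)).
  have a0 : 0 <= 2 * alpha * ((s k)%:R + 1) by rewrite !mulr_ge0 ?addr_ge0// ltW.
  have kk := ler_norm kappa.
  have := hC' a f (ln (M + 1)) (l k) (Z k) (s k)%:R (- (k%:R * ln 2)) aM1 af s1.
  have -> : (s k)%:R < tlog (l k) by move: Tl; rewrite /T; have := prev0 k; have := rest0 k; lra.
  move=> /(_ isT); have -> : (size (Z k))%:R <= 2 * alpha * tlog (l k) - kappa by lra.
  move=> /(_ isT ZL.1 lZ) h; rewrite -subr_ge0.
  suff : \sum_(m <- Z k) ((s k)%:R - `|tlog m - tlog (l k)|) <=
         2 * alpha * (s k)%:R ^+ 2 + 2 * (s k)%:R + C' + 2 * (ln (M + 1) - - (k%:R * ln 2)) by lra.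
  apply: h.
  - move=> m mZ; split; last exact: hZ.
    apply: f0 => [|j]; first exact: ZL.2.
    move=> lm; have := hZ _ mZ; rewrite -lm; case: (ltngtP j k) => [jk|kj|jk].
    + have := far _ _ jk; have : 0 <= (s k)%:R :> R by [].
      by rewrite ler_norml => ? ? /andP[]; lra.
    + have := far _ _ kj; have := smon _ _ kj; have : 0 <= (s k)%:R :> R by [].
      by rewrite ler_norml => ? ? ? /andP[]; lra.
    + by subst j; move: lZ; rewrite lm mZ.
  - rewrite (le_trans _ (hC (Z k) (tlog (l k) + (s k)%:R) ZL))// big_seq [leRHS]big_seq ler_sum// => m /hZ.
    rewrite ler_norml ler_expR => /andP[h1 h2]; rewrite lerN2 ler0_norm; move: h1 h2; clear; lra.
  - rewrite (le_trans _ (hC (Z k) (tlog (l k) - (s k)%:R) ZL))// big_seq [leRHS]big_seq ler_sum// => m /hZ.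
    rewrite ler_norml ler_expR => /andP[h1 h2]; rewrite lerN2 ger0_norm; move: h1 h2; clear; lra.
  - exact: hC.
  - rewrite fl ler_wpM2r ?expR_ge0// expRN expRM_natl lnK ?posrE// exprVn lexx//.
have ln2 : ln 2 <= 1 :> R.
  by rewrite -[leRHS]expRK ler_ln ?posrE ?expR_gt0//; have := expR_ge1Dx (1 : R); lra.
have ln20 : 0 <= ln 2 :> R by rewrite ln_ge0// ler1n.
pose B := 4 + `|C' + 2 * ln (M + 1)|.
have [k hk] : exists k : nat, B / e < (s k)%:R.
  have B0 : 0 <= B / e by rewrite divr_ge0 ?addr_ge0// ltW.
  have /andP[_ h] := truncn_itv B0; exists (Num.truncn (B / e)).
  by rewrite (lt_le_trans h)// ler_nat leq_addl.
have s1 : 1 <= (s k)%:R :> R by rewrite ler1n /s addnS.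
have ks : k%:R <= (s k)%:R :> R by rewrite ler_nat (leq_trans (leqnSn _))// leq_addl.
have := key k; rewrite ltr_pdivrMr// in hk.
have h1 : k%:R * ln 2 <= (s k)%:R * 1 := ler_pM (ler0n _ _) ln20 ks ln2.
have h2 : C' + 2 * ln (M + 1) <= `|C' + 2 * ln (M + 1)| := ler_norm _.
have h3 : `|C' + 2 * ln (M + 1)| <= `|C' + 2 * ln (M + 1)| * (s k)%:R by rewrite ler_peMr.
have h4 : B * (s k)%:R < (s k)%:R * e * (s k)%:R by rewrite ltr_pM2r// (lt_le_trans ltr01).
rewrite /B in h4; lra.
Qed.

Lemma sum_indicator_itv (m M N : nat) : (m <= M)%N -> (M <= N)%N ->
  (\sum_(i < N) ((m <= i < M) : nat) = M - m)%N.
Proof.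
move=> mM MN; rewrite -(big_mkord xpredT (fun i => ((m <= i < M)%N : nat))).
rewrite (big_cat_nat (leq0n m) (leq_trans mM MN)) /= (big_cat_nat mM MN) /=.
rewrite big_nat_cond big1 ?add0n; last by move=> i /andP[/andP[_ im] _]; rewrite leqNgt im.
rewrite [X in (_ + X)%N](_ : _ = 0%N) ?addn0; last first.
  rewrite big_nat_cond big1// => i /andP[/andP[Mi _] _].
  by rewrite [(i < M)%N]ltnNge Mi andbF.
rewrite big_nat_cond (eq_bigr (fun=> 1%N)); last by move=> i /andP[-> _].
by rewrite -big_nat_cond sum_nat_const_nat muln1.
Qed.

(* Cauchy-Schwarz for the numbers of points in sliding windows of integer
   length: the mean square is controlled by the window sums. *)
Lemma window_count L (s : nat) (A T x : R) (S : nat) J : (3 <= s)%N -> 0 <= A ->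
  (forall l, L l -> T <= tlog l -> window_sum_le L s%:R A l) ->
  in_set L J -> T <= x -> (forall z, z \in J -> x <= tlog z < x + S%:R) ->
  (size J)%:R * (s%:R - 2) ^+ 2 <= (S + s)%:R * (A + s%:R).
Proof.
move=> s3 A0 LA JL Tx hJ; set n : R := (size J)%:R.
(* Rounding positions to integers changes distances by at most 1. With windows shorter by 2, the
   overlap of those of two points is at most s minus their true distance, and nonzero only at
   distance at most s - 1. *)
pose s' := (s - 2)%N; pose N := (S + s')%N.
pose k z := Num.truncn (tlog z - x).
have kP z : z \in J -> [/\ (k z)%:R <= tlog z - x, tlog z - x < (k z)%:R + 1 & (k z + s' <= N)%N].
  move=> /hJ/andP[h1 h2]; have p : 0 <= tlog z - x by rewrite subr_ge0.
  have /andP[k1 k2] := truncn_itv p; rewrite -/(k z) in k1 k2; split => //.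
    by rewrite natr1.
  by rewrite leq_add2r -(ler_nat R); rewrite (le_trans k1)//; lra.
pose b z (i : nat) := ((k z <= i < k z + s')%N : nat).
have bsum z : z \in J -> (\sum_(i < N) b z i = s')%N.
  by move=> /kP[_ _ h]; rewrite sum_indicator_itv ?leq_addr// addKn.
pose Ni (i : nat) : R := \sum_(z <- J) (b z i)%:R.
have sumN : \sum_(i < N) Ni i = n * s'%:R.
  rewrite exchange_big /= /n -[size J]sum1_size natr_sum mulr_suml big_seq [RHS]big_seq.
  by apply: eq_bigr => z zJ; rewrite mul1r -natr_sum bsum.
(* The variance of the counts [Ni] about their mean n s' / N is nonnegative. *)
have cs : (n * s'%:R) ^+ 2 <= N%:R * \sum_(i < N) Ni i ^+ 2.
  have := sumr_ge0 (index_enum 'I_N) (P := xpredT) (F := fun i : 'I_N => (N%:R * Ni i - n * s'%:R) ^+ 2).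
  move=> /(_ (fun i _ => sqr_ge0 _)).
  have -> : \sum_(i < N) (N%:R * Ni i - n * s'%:R) ^+ 2 =
     N%:R * (N%:R * \sum_(i < N) Ni i ^+ 2 - (n * s'%:R) ^+ 2).
    transitivity (\sum_(i < N) (N%:R ^+ 2 * Ni i ^+ 2 - 2 * N%:R * (n * s'%:R) * Ni i + (n * s'%:R) ^+ 2)).
      by apply: eq_bigr => i _; ring.
    rewrite big_split sumrB /= -!mulr_sumr sumN sumr_const card_ord -[_ *+ N]mulr_natl; ring.
  have [N0|N0] := eqVneq N 0%N.
    rewrite N0 mul0r; have : (s' <= N)%N by rewrite leq_addl.
    by rewrite N0 leqn0 => /eqP -> _; rewrite mulr0 expr0n /= mul0r.
  by rewrite pmulr_rge0 ?ltr0n ?lt0n// subr_ge0.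
have pair z w : z \in J -> w \in J -> z != w ->
    \sum_(i < N) (b z i)%:R * (b w i)%:R <=
    (if `|tlog w - tlog z| <= s%:R - 1 then s%:R - `|tlog w - tlog z| else 0) :> R.
  wlog kzw : z w / (k z <= k w)%N.
    move=> h zJ wJ zw; have [/h|/ltnW/h] := leqP (k z) (k w); first exact.
    rewrite eq_sym distrC => /(_ wJ zJ zw); under eq_bigr do rewrite mulrC; by [].
  move=> zJ wJ zw; have [z1 z2 z3] := kP z zJ; have [w1 w2 w3] := kP w wJ.
  have kzw' : (k z)%:R <= (k w)%:R :> R by rewrite ler_nat.
  have dist : `|tlog w - tlog z| <= (k w)%:R - (k z)%:R + 1 by rewrite ler_norml; apply/andP; split; lra.
  have [lt|ge] := ltnP (k w) (k z + s'); last first.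
    rewrite big1; first by case: ifP => // h; lra.
    move=> i _; rewrite /b; case: (boolP (k w <= i)%N) => [wi|_]; last by rewrite mulr0.
    by rewrite [(i < k z + s')%N]ltnNge (leq_trans ge wi) andbF mul0r.
  have -> : \sum_(i < N) (b z i)%:R * (b w i)%:R = (k z + s' - k w)%:R :> R.
    rewrite -(@sum_indicator_itv (k w) (k z + s') N) ?(ltnW lt)// natr_sum.
    apply: eq_bigr => i _; rewrite /b -natrM mulnb; congr (_%:R); congr nat_of_bool.
    apply/idP/idP; first by move=> /andP[/andP[_ ->] /andP[->]].
    move=> /andP[h1 h2]; rewrite h1 h2 (leq_trans kzw h1)/=; apply: leq_trans h2 _.
    by rewrite leq_add2r.
  rewrite natrB ?(ltnW lt)// natrD natrB ?(leq_trans _ s3)//.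
  have : (k w)%:R + 1 <= (k z)%:R + (s%:R - 2) :> R.
    by move: lt; rewrite -(ler_nat R) -[_.+1%:R]natr1 natrD natrB ?(leq_trans _ s3).
  by move=> h; rewrite ifT; lra.
(* In the expanded square, distinct pairs through [z] are controlled by the window sum at [z], and
   the diagonal by s. *)
have sq : \sum_(i < N) Ni i ^+ 2 <= n * (A + s%:R).
  have -> : \sum_(i < N) Ni i ^+ 2 = \sum_(z <- J) \sum_(w <- J) \sum_(i < N) (b z i)%:R * (b w i)%:R.
    under [RHS]eq_bigr do rewrite exchange_big /=.
    rewrite [RHS]exchange_big /=; apply: eq_bigr => i _.
    by rewrite expr2 {1}/Ni mulr_suml; apply: eq_bigr => z _; rewrite mulr_sumr.
  rewrite /n -[size J]sum1_size natr_sum mulr_suml big_seq [leRHS]big_seq ler_sum// => z zJ.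
  rewrite mul1r (bigD1_seq z) ?JL.1//= addrC lerD//; last first.
    apply: (@le_trans _ _ (s'%:R)); last by rewrite ler_nat leq_subr.
    rewrite -(bsum z zJ) natr_sum ler_sum// => i _.
    by rewrite -natrM ler_nat /b; case: (_ <= _ < _)%N.
  have Lz : L z := JL.2 _ zJ.
  have Tz : T <= tlog z by have /andP[h _] := hJ _ zJ; exact: le_trans h.
  pose W := [seq w <- J | (w != z) && (`|tlog w - tlog z| <= s%:R - 1)].
  have [WL zW hW] : [/\ in_set L W, z \notin W & forall w, w \in W -> `|tlog w - tlog z| <= s%:R - 1].
    split; first exact: in_set_filter.
      by rewrite mem_filter eqxx.
    by move=> w; rewrite mem_filter => /andP[/andP[]].
  apply: le_trans (LA z Lz Tz W WL zW hW).
  rewrite big_filter [leRHS]big_mkcondr big_seq_cond [leRHS]big_seq_cond ler_sum// => w /andP[wJ wz].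
  by apply: pair => //; rewrite eq_sym.
have s2 : s'%:R = s%:R - 2 :> R by rewrite natrB// (leq_trans _ s3).
have NS : N%:R <= (S + s)%:R :> R by rewrite ler_nat leq_add2l leq_subr.
have As : 0 <= A + s%:R by rewrite addr_ge0.
rewrite -s2; have [->|n0] := eqVneq n 0; first by rewrite mul0r mulr_ge0.
have n_gt0 : 0 < n by rewrite lt_def n0 /n ler0n.
rewrite -(ler_pM2l n_gt0) mulrA -expr2 -exprMn (le_trans cs)//.
rewrite mulrCA ler_pM// ?sumr_ge0// => i _; exact: sqr_ge0.
Qed.

End DensityBound.

(** * Passage to the upper density *)

Section UpperDensity.
Variables (R : realType) (alpha kappa : R).
Hypothesis alpha_gt0 : 0 < alpha.
Implicit Types (L : set R[i]) (z w : R[i]) (Z : seq R[i]).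
Lemma counting_seq (A : set R[i]) Z : uniq Z -> (forall z, z \in Z <-> A z) ->
  counting A = ((size Z)%:R : R)%:E.
Proof.
move=> uZ ZA; have AE : A = [set` Z] by apply/seteqP; split => z /ZA.
have fA : finite_set A by rewrite AE; exact: finite_seq.
rewrite /counting asboolT//; congr (_%:R%:E); apply/perm_size/uniq_perm => //.
move=> z; rewrite in_fset_set//; apply/idP/idP => [/set_mem/ZA//|zZ].
by apply/mem_set/ZA.
Qed.
Lemma annulus_tlog (r s : R) z : 1 <= r -> 0 < s -> annulus r (s * r) z ->
  ln r <= tlog z < ln r + ln s.
Proof.
move=> r1 s0 /andP[h1 h2]; have r0 : 0 < r := lt_le_trans ltr01 r1.
have z1 := le_trans r1 h1; rewrite /tlog /logplus max_l ?ln_ge0//.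
have z0 : 0 < cabs z := lt_le_trans ltr01 z1.
by rewrite ler_ln ?posrE// h1 addrC -lnM ?posrE// ltr_ln ?posrE ?mulr_gt0.
Qed.
Lemma shell_bound_annulus L (K : nat) (r s : R) : shell_bound L K ->
  exists2 Z, in_set L Z & forall z, z \in Z <-> (L `&` annulus r s) z.
Proof.
move=> LK; have [Z uZ ZL] := shell_bound_finite (ln (Num.max s 1)) LK.
exists [seq z <- Z | `[< annulus r s z >]].
  by split; [exact: filter_uniq|move=> z; rewrite mem_filter => /andP[_ /ZL[]]].
move=> z; rewrite mem_filter; split => [/andP[/asboolP h /ZL[]]//|[Lz az]].
rewrite asboolT//=; apply/ZL; split => //.
have /andP[_ zs] := az; rewrite /tlog /logplus ge_max.
have s1 : 0 < Num.max s 1 by rewrite lt_max ltr01 orbT.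
rewrite ln_ge0 ?le_max ?lexx ?orbT// andbT.
have [z0|z0] := leP (cabs z) 0.
  by rewrite ln0// ln_ge0// le_max lexx orbT.
by rewrite ler_ln ?posrE// le_max (ltW zs).
Qed.
(** With [s] fixed, [window_count] bounds an annulus of logarithmic width log t by (log t + 1 + s)(A
    + e / 3). The three thirds of e pay for the window sums, for s - 2 in place of s, and for the
    term independent of t. *)
Lemma interpolates_density L (K : nat) : interpolates_l2 alpha kappa L ->
  shell_bound L K -> (upper_density L <= (2 * alpha)%:E)%E.
Proof.
move=> HL LK; apply/lee_addgt0Pr => e e0; rewrite -EFinD.
set A := 2 * alpha + e / 3; have e3 : 0 < e / 3 by rewrite divr_gt0.
have A0 : 0 < A by rewrite addr_gt0// mulr_gt0.
have [s0 [s03 hs0]] : exists s0 : nat, (3 <= s0)%N /\ forall s : nat, (s0 <= s)%N ->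
    A * s%:R ^+ 2 + s%:R <= (A + e / 3) * (s%:R - 2) ^+ 2.
  (* For s at least [B] the linear terms of the expanded inequality are at most (e / 3) s^2. *)
  pose B := (4 * (A + e / 3) + 1) / (e / 3).
  have B0 : 0 <= B by rewrite divr_ge0 ?(ltW e3)//; lra.
  exists (Num.truncn B).+3; split => // s ss.
  have /andP[_ h] := truncn_itv B0.
  have sB : B <= s%:R by rewrite (le_trans (ltW h))// ler_nat (leq_trans _ ss)// -addn2 leq_addr.
  move: sB; rewrite /B ler_pdivrMr// => sB.
  have := ler_wpM2l (ler0n R s) sB; nra.
have [s ss0 [T hT]] := window_sum_bounded alpha_gt0 s0 HL LK e3; rewrite -/A in hT.
have s3 : (3 <= s)%N := leq_trans s03 ss0.
have s2 : 0 < (s%:R - 2) ^+ 2 :> R.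
  by rewrite exprn_gt0// subr_gt0 ltr_nat.
have bound (r t : R) : 1 <= r -> T <= ln r -> 1 < t -> exists2 n : R,
    counting (L `&` annulus r (t * r)) = n%:E & n <= (ln t + 1 + s%:R) * (A + e / 3).
  move=> r1 Tr t1; have [Z ZL ZE] := shell_bound_annulus r (t * r) LK.
  exists (size Z)%:R; first by apply: counting_seq => //; exact: ZL.1.
  have lt0 : 0 <= ln t by rewrite ln_ge0// ltW.
  have /andP[l1 l2] := truncn_itv lt0; set S := (Num.truncn (ln t)).+1.
  have hZ z : z \in Z -> ln r <= tlog z < ln r + S%:R.
    move=> /ZE[_ /(annulus_tlog r1 (lt_trans ltr01 t1))/andP[-> h]] /=.
    by rewrite (lt_trans h)// ltrD2l.
  have As0 : 0 <= A * s%:R ^+ 2 by rewrite mulr_ge0 ?exprn_ge0// ltW.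
  have := window_count s3 As0 hT ZL Tr hZ => h.
  rewrite -(ler_pM2r s2) (le_trans h)// -mulrA ler_pM ?addr_ge0//; last exact: hs0.
  by rewrite natrD lerD2r /S -natr1 lerD2r.
set X := (1 + s%:R) * (A + e / 3) : R.
have X0 : 0 <= X := mulr_ge0 (addr_ge0 ler01 (ler0n _ _)) (ltW (addr_gt0 A0 e3)).
pose t0 := expR (X / (e / 3)).
have t01 : 1 <= t0 by rewrite /t0 -[leLHS]expR0 ler_expR (divr_ge0 X0 (ltW e3)).
apply: ereal_inf_le; exists (ereal_sup [set (limf_esup (fun r : R =>
  (counting (L `&` annulus r (t * r)) * ((ln t)^-1)%:E)%E) (pinfty_nbhs R)) | t in [set t | t0 < t]]).
  by exists [set t | t0 < t] => //; exists t0; split; [exact: num_real|].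
apply: ge_ereal_sup => _ [t /= tt0 <-].
have t1 : 1 < t := le_lt_trans t01 tt0.
have lt0 : 0 < ln t by rewrite ln_gt0.
apply: ereal_inf_le; pose r0 := Num.max 1 (expR T).
exists (ereal_sup [set (counting (L `&` annulus r (t * r)) * ((ln t)^-1)%:E)%E | r in [set r | r0 < r]]).
  by exists [set r | r0 < r] => //; exists r0; split; [exact: num_real|].
apply: ge_ereal_sup => _ [r /= rr0 <-].
have r1 : 1 <= r by rewrite (le_trans _ (ltW rr0))// le_max lexx.
have Tr : T <= ln r.
  by rewrite -[T]expRK ler_ln ?posrE ?expR_gt0 ?(lt_le_trans ltr01 r1)// (le_trans _ (ltW rr0))// le_max lexx orbT.
have [n -> hn] := bound r t r1 Tr t1.
rewrite -EFinM lee_fin ler_pdivrMr// (le_trans hn)//.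
have : X / (e / 3) <= ln t.
  by rewrite -[leLHS]expRK ler_ln ?posrE ?expR_gt0 ?(lt_trans ltr01 t1)// ltW.
rewrite ler_pdivrMr// => h.
have -> : (ln t + 1 + s%:R) * (A + e / 3) = ln t * (A + e / 3) + X by rewrite /X; ring.
rewrite /A; lra.
Qed.
End UpperDensity.

Section SupremumBounds.
Variable R : realType.

Lemma ereal_sup_bound (T : Type) (A : set T) (g : T -> R) :
  (ereal_sup [set (g z)%:E | z in A] < +oo)%E ->
  exists2 M : R, 0 <= M & forall z, A z -> g z <= M.
Proof.
set S := ereal_sup _ => h; exists (Num.max 0 (fine S)); first by rewrite le_max lexx.
move=> z Az; have := ereal_sup_ubound (_ : [set (g z)%:E | z in A] (g z)%:E).
rewrite -/S => /(_ (ex_intro2 _ _ z Az erefl)); move: h; case: S => //= r _.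
by rewrite lee_fin => h; rewrite le_max h orbT.
Qed.

Lemma bound_ereal_sup (T : Type) (A : set T) (g : T -> R) (M : R) :
  (forall z, A z -> g z <= M) -> (ereal_sup [set (g z)%:E | z in A] < +oo)%E.
Proof.
move=> h; apply: (@le_lt_trans _ _ M%:E); last by rewrite ltry.
by apply: ge_ereal_sup => _ [z Az <-]; rewrite lee_fin h.
Qed.

End SupremumBounds.

(** * The exponent oo, and the two forms of separation *)

Section NecessityUniform.
Variables (R : realType) (alpha : R).
Hypothesis alpha_gt0 : 0 < alpha.
Implicit Types (L : set R[i]) (z w : R[i]) (f : R[i] -> R[i]).

Lemma weight0E z : weight alpha 0 z = expR (log_weight alpha z).
Proof. by rewrite /weight mul0r subr0. Qed.

Lemma fockooP f : fockoo (log_weight alpha) f <-> entire f /\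
  exists2 M : R, 0 <= M & forall z, cabs (f z) <= M * weight alpha 0 z.
Proof.
split=> -[fe].
  move=> /ereal_sup_bound[M M0 hM]; split => //; exists M => // z.
  by rewrite weight0E -ler_pdivrMr ?expR_gt0// -expRN; exact: hM.
move=> [M M0 hM]; split => //; apply: (@bound_ereal_sup _ _ _ _ M) => z _.
by rewrite expRN ler_pdivrMr ?expR_gt0// -weight0E.
Qed.

(** Cauchy's estimate on the circle t = n / (2 alpha), where alpha t^2 - n t is minimal. *)
Lemma bounded_good_coefs f a M : expands a f ->
  (forall z, cabs (f z) <= M * weight alpha 0 z) -> good_coefs alpha 0 a M.
Proof.
move=> [ha af] fM n; set t := n%:R / (2 * alpha).
have t0 : 0 <= t by rewrite divr_ge0 ?mulr_ge0// ltW.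
have [B hB] := ha _ (addr_ge0 (expR_ge0 t) ler01).
have : cabs (a n) * expR t ^+ n <= M * expR (alpha * t ^+ 2).
  apply: (@cauchy_estimate _ a B (expR t + 1) (expR t) _ f) => //; [exact: expR_gt0|by rewrite ltrDl|].
  move=> z zt; have := fM z; rewrite /weight mul0r subr0.
  by rewrite /tlog /logplus zt expRK max_l.
rewrite -ler_pdivlMr ?exprn_gt0 ?expR_gt0// => h; rewrite (le_trans h)//.
rewrite -expRM_natl -mulrA -expRN -expRD addr0.
rewrite (_ : alpha * t ^+ 2 - n%:R * t = - n%:R ^+ 2 / (4 * alpha))//.
by rewrite /t; field; rewrite gt_eqF.
Qed.

Lemma interpolationoo_l2 L : interpolationoo (log_weight alpha) L ->
  interpolates_l2 alpha 0 L.
Proof.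
move=> HL v v0 /esum_fin_bound[B hB].
have vB l : L l -> v l <= B + 1.
  move=> Ll; have : v l ^+ 2 <= B.
    by have := hB [:: l]; rewrite big_seq1 /=; apply => // z; rewrite inE => /eqP ->.
  have := sqr_ge0 (v l - 2^-1); nra.
have [|f /fockooP[fe [M M0 fM]] fv] := HL (fun l => (v l * weight alpha 0 l)%:C%C).
  apply: (@bound_ereal_sup _ _ _ _ (B + 1)) => l Ll.
  rewrite cabsR ger0_norm ?mulr_ge0 ?expR_ge0// weight0E -mulrA -expRD subrr expR0 mulr1.
  exact: vB.
have [a fa] := taylor fe.
exists f, a, M; split => //; exact: bounded_good_coefs fa fM.
Qed.

Lemma separated_d_rho L : (exists2 d : R, 0 < d &
  forall z w, L z -> L w -> z <> w -> d <= d_rho alpha z w) <-> d_rho_separated alpha L.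
Proof.
rewrite /d_rho_separated; split => [[d d0 hd]|].
  apply: (@lt_le_trans _ _ d%:E); first by rewrite lte_fin.
  apply: le_ereal_inf_tmp => _ [[z w] /= [Lz [Lw zw]] <-].
  by rewrite lee_fin hd.
set S := ereal_inf _ => S0.
have lb z w : L z -> L w -> z <> w -> (S <= (d_rho alpha z w)%:E)%E.
  by move=> Lz Lw zw; apply: ereal_inf_lbound; exists (z, w).
move: S0 lb; case: S => [r||] //= r0 lb; last by exists 1 => // z w Lz Lw /(lb _ _ Lz Lw).
by exists r; rewrite ?lte_fin// in r0 * => // z w Lz Lw /(lb _ _ Lz Lw); rewrite lee_fin.
Qed.

(** For |z| < 1 the scale is 1; for |w| >= |z| / 2 the minimum in [d_rho] is comparable to |z|; and
    for smaller |w| the triangle inequality alone gives |z - w| >= |z| / 2. *)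
Lemma d_rho_log_separated L (d : R) : 0 < d ->
  (forall z w, L z -> L w -> z <> w -> d <= d_rho alpha z w) ->
  exists2 e : R, 0 < e & log_separated L e.
Proof.
move=> d0 hd; set A := Num.sqrt (2 * alpha); have A0 : 0 < A by rewrite sqrtr_gt0 mulr_gt0.
pose c := Num.min 1 (2 * A)^-1; have c0 : 0 < c by rewrite lt_min ltr01 invr_gt0 mulr_gt0.
have dc : 0 < d * c := mulr_gt0 d0 c0.
exists (Num.min (d * c) 2^-1); first by rewrite lt_min dc /= invr_gt0 ltr0n.
move=> z w Lz Lw zw; set m := Num.min (cabs z) (cabs w).
have m0 : 0 <= m by rewrite le_min !cabs_ge0.
have hzw : d * (1 + A^-1 * m) <= cabs (z - w).
  have := hd z w Lz Lw zw; rewrite /d_rho -/A -/m mulrA ler_pdivlMr ?ltr_pwDl// => h.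
  rewrite -(ler_pM2l A0) (le_trans _ h)//.
  by rewrite mulrCA mulrDr mulr1 mulrA mulfV ?gt_eqF// mul1r.
have e1 : 0 < expR (tlog z) := expR_gt0 _.
have ez : expR (tlog z) = 1 \/ (1 <= cabs z /\ expR (tlog z) = cabs z).
  have [z1|z1] := leP 1 (cabs z); first by right; rewrite -tlog_cabs.
  by left; rewrite tlog_le1 ?expR0// ltW.
have le1 : Num.min (d * c) 2^-1 <= d * c by rewrite ge_min lexx.
have le2 : Num.min (d * c) 2^-1 <= 2^-1 by rewrite ge_min lexx orbT.
have c1 : c <= 1 by rewrite ge_min lexx.
have c2 : c <= (2 * A)^-1 by rewrite ge_min lexx orbT.
have dm : 0 <= d * (A^-1 * m) by rewrite mulr_ge0 ?(ltW d0)// mulr_ge0 ?invr_ge0 ?(ltW A0).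
case: ez => [->|[z1 ->]].
  rewrite mulr1 (le_trans le1)// (le_trans _ hzw)// (le_trans (ler_wpM2l (ltW d0) c1))//.
  by rewrite mulrDr lerDl.
have [wz|wz] := leP (cabs z / 2) (cabs w).
  rewrite (le_trans (ler_wpM2r (cabs_ge0 z) le1))// (le_trans _ hzw)// -mulrA ler_wpM2l ?(ltW d0)//.
  rewrite (le_trans (ler_wpM2r (cabs_ge0 z) c2))// invfM mulrC mulrA.
  rewrite (@le_trans _ _ (A^-1 * m)) ?lerDr// mulrC ler_wpM2l ?invr_ge0 ?(ltW A0)//.
  by rewrite le_min wz andbT ler_pdivrMr// ler_peMr ?cabs_ge0// ler1n.
rewrite (le_trans (ler_wpM2r (cabs_ge0 z) le2))//.
by have := cabs_lb z w; lra.
Qed.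

End NecessityUniform.

(** * Sufficiency *)

Section DensityCount.
Variables (R : realType) (alpha : R).
Hypothesis alpha_gt0 : 0 < alpha.
Implicit Types (L : set R[i]) (z w : R[i]) (Z : seq R[i]).

Definition count_bound L (b C : R) := forall x y Z, 0 <= x -> x <= y -> in_set L Z ->
  (forall z, z \in Z -> x <= tlog z <= y) -> (size Z)%:R <= b * (y - x) + C.

Lemma size_le_counting (A : set R[i]) Z (M : R) : uniq Z -> (forall z, z \in Z -> A z) ->
  (counting A <= M%:E)%E -> (size Z)%:R <= M.
Proof.
move=> uZ ZA; rewrite /counting; case: asboolP => [fA|//]; rewrite lee_fin; apply: le_trans.
rewrite ler_nat; apply: uniq_leq_size => // z /ZA Az.
by rewrite in_fset_set//; exact/mem_set.
Qed.

(** An upper limit is an infimum of suprema, so the strict inequality already holds at one ratio s.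
    Then S is log s, and [b] is the supremum found there. *)
Lemma upper_density_scale L : (upper_density L < (2 * alpha)%:E)%E ->
  exists b S T : R, [/\ 0 <= b, b < 2 * alpha, 0 < S, 0 < T &
    forall x Z, T <= x -> in_set L Z -> (forall z, z \in Z -> x <= tlog z < x + S) ->
      (size Z)%:R <= b * S].
Proof.
move=> /ereal_inf_lt[_ [V [s0 [_ Vs]] <-] hV].
pose s := Num.max s0 1 + 1.
have s1 : 1 < s by rewrite ltr_pwDr// le_max lexx orbT.
have Vs1 : V s by apply: Vs; rewrite ltr_pwDr// le_max lexx.
have := le_lt_trans (ereal_sup_ubound (ex_intro2 _ _ s Vs1 erefl)) hV.
move=> /ereal_inf_lt[_ [V' [r0 [_ Vr]] <-] hV'].
set f := fun r : R => _ in hV'; set B := ereal_sup _ in hV'.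
have ls : 0 < ln s by rewrite ln_gt0.
have fB r : r0 < r -> (f r <= B)%E.
  by move=> rr0; apply: ereal_sup_ubound; exists r => //; exact: Vr.
have f0 r : (0 <= f r)%E.
  rewrite /f mule_ge0 ?lee_fin ?invr_ge0 ?(ltW ls)// /counting.
  by case: asboolP => _; rewrite ?lee_fin ?leey.
have [b bE] : exists b : R, B = b%:E.
  have := le_trans (f0 _) (fB (r0 + 1) _); rewrite ltrDl ltr01 => /(_ isT).
  by move: hV'; case: (B) => // b; exists b.
rewrite bE in fB hV'.
have b0 : 0 <= b by have := le_trans (f0 _) (fB (r0 + 1) _); rewrite ltrDl ltr01 lee_fin => /(_ isT).
exists b, (ln s), (Num.max (ln (Num.max r0 1)) 0 + 1); split => //.
  by rewrite ltr_pwDr// le_max lexx orbT.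
move=> x Z Tx ZL Zx.
have x0 : 0 < x by rewrite (lt_le_trans _ Tx)// ltr_pwDr// le_max lexx orbT.
have xr : r0 < expR x.
  apply: (@le_lt_trans _ _ (Num.max r0 1)); first by rewrite le_max lexx.
  have m1 : 0 < Num.max r0 1 by rewrite lt_max ltr01 orbT.
  rewrite -[ltLHS](lnK _) ?posrE// ltr_expR (lt_le_trans _ Tx)// ltr_pwDr// le_max lexx//.
apply: (@size_le_counting (L `&` annulus (expR x) (s * expR x))) => //.
- exact: ZL.1.
- move=> z zZ; split; first exact: ZL.2.
  have /andP[h1 h2] := Zx z zZ.
  rewrite /annulus /= tlog_gt0; last exact: lt_le_trans h1.
  rewrite ler_expR h1 /=; have -> : s * expR x = expR (x + ln s).
    by rewrite expRD lnK ?posrE ?(lt_trans ltr01 s1)// mulrC.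
  by rewrite ltr_expR.
- have := fB _ xr; rewrite /f => h.
  rewrite EFinM -lee_pdivrMr// muleC muleC; exact: h.
Qed.

(** The interval is covered by pieces of length S, the last one overshooting, and the finitely many
    points below T enter the additive constant. *)
Lemma density_count_bound L (K : nat) : shell_bound L K ->
  (upper_density L < (2 * alpha)%:E)%E ->
  exists b C : R, [/\ 0 <= b, b < 2 * alpha, 0 <= C & count_bound L b C].
Proof.
move=> LK /upper_density_scale[b [S [T [b0 ba S0 T0 hb]]]].
have [F uF FE] := shell_bound_finite T LK.
exists b, ((size F)%:R + b * S); split => //; first by rewrite addr_ge0// mulr_ge0// ltW.
have far x y Z : T <= x -> x <= y -> in_set L Z -> (forall z, z \in Z -> x <= tlog z <= y) ->
    (size Z)%:R <= b * (y - x) + b * S.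
  move=> Tx xy ZL hZ; pose k z := Num.truncn ((tlog z - x) / S).
  have kP z : z \in Z -> (k z)%:R <= (tlog z - x) / S < (k z)%:R + 1.
    move=> /hZ/andP[h _]; have : 0 <= (tlog z - x) / S by rewrite divr_ge0 ?subr_ge0// ltW.
    by move=> /truncn_itv; rewrite -[_.+1%:R]natr1.
  have yx : 0 <= (y - x) / S by rewrite divr_ge0 ?subr_ge0// ltW.
  have /andP[j1 j2] := truncn_itv yx; set J := Num.truncn _ in j1 j2.
  have part n : (count (fun z => k z == n) Z <= Num.truncn (b * S))%N.
    rewrite -size_filter -ltnS -(ltr_nat R).
    have bS : 0 <= b * S by rewrite mulr_ge0// ltW.
    have /andP[_] := truncn_itv bS; apply: le_lt_trans.
    apply: (hb (x + n%:R * S)); first by rewrite (le_trans Tx)// lerDl mulr_ge0// ltW.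
      exact: in_set_filter.
    move=> z; rewrite mem_filter => /andP[/eqP <- /kP]; rewrite ler_pdivlMr// ltr_pdivrMr//.
    by rewrite mulrDl mul1r => /andP[h1 h2]; apply/andP; split; lra.
  have := @sum_by_shell R _ Z k (fun=> 1) J.+1 (Num.truncn (b * S)) (fun=> ler01) _ part.
  have -> : \sum_(z <- Z) 1 = (size Z)%:R :> R by rewrite -sum1_size natr_sum.
  rewrite sumr_const card_ord => h; apply: le_trans (h _) _.
    move=> z zZ; rewrite ltnS; apply: le_truncn; rewrite ler_pM2r ?invr_gt0// lerD2r.
    by have /andP[] := hZ z zZ.
  have bS : 0 <= b * S by rewrite mulr_ge0// ltW.
  have /andP[t1 _] := truncn_itv bS; rewrite -natr1.
  rewrite (le_trans (ler_wpM2r _ t1))// ?addr_ge0// mulrDr mulr1 lerD2r -mulrA ler_wpM2l//.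
  by move: j1; rewrite ler_pdivlMr// mulrC.
move=> x y Z x0 xy ZL hZ.
have sizeE : (size Z = size [seq z <- Z | (tlog z <= T)%R] + size [seq z <- Z | ~~ (tlog z <= T)%R])%N.
  by rewrite !size_filter count_predC.
have lowF : (size [seq z <- Z | (tlog z <= T)%R] <= size F)%N.
  apply: uniq_leq_size; first by rewrite filter_uniq// ZL.1.
  by move=> z; rewrite mem_filter => /andP[zT zZ]; apply/FE; split => //; exact: ZL.2.
rewrite sizeE natrD addrCA lerD ?ler_nat//.
have [yT|Ty] := ltP y T.
  rewrite (_ : [seq z <- Z | _] = [::]) ?addr_ge0 ?mulr_ge0 ?subr_ge0 ?(ltW S0)//.
  apply/eqP; rewrite -[_ == _]negbK -has_filter; apply/negP => /hasP[z /hZ/andP[_ zy]].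
  by rewrite (le_trans zy (ltW yT)).
apply: le_trans (far (Num.max x T) y _ _ _ _ _) _.
- by rewrite le_max lexx orbT.
- by rewrite ge_max xy.
- exact: in_set_filter.
- move=> z; rewrite mem_filter -ltNge => /andP[zT /hZ/andP[h1 ->]].
  by rewrite ge_max h1 ltW.
- by rewrite lerD2r ler_wpM2l// lerD2l lerN2 le_max lexx.
Qed.

End DensityCount.

(** * Calculus of coefficient majorants *)

Section Majorants.
Variable R : realType.
Implicit Types p q : {poly R[i]}.

(** Rules for sums and products reduce to comparing coefficients with those of a real polynomial. *)
Lemma majorant_le p (P : {poly R}) r : 0 <= r -> (forall i, cabs p`_i <= P`_i) ->
  majorant p r <= P.[r].
Proof.
move=> r0 h; set N := maxn (size p) (size P).
rewrite (@horner_coef_wide _ N) ?leq_maxr//.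
rewrite /majorant (big_ord_widen N (fun i => cabs p`_i * r ^+ i)) ?leq_maxl//.
rewrite big_mkcond/= ler_sum// => i _; case: ifP => _; first by rewrite ler_wpM2r ?exprn_ge0.
by rewrite mulr_ge0 ?exprn_ge0// (le_trans _ (h i)) ?cabs_ge0.
Qed.

Definition abs_poly p : {poly R} := \poly_(i < size p) cabs p`_i.

Lemma coef_abs_poly p i : (abs_poly p)`_i = cabs p`_i.
Proof. by rewrite coef_poly; case: ltnP => // /(nth_default 0) ->; rewrite cabs0. Qed.

Lemma majorantE p r : majorant p r = (abs_poly p).[r].
Proof. by rewrite horner_poly. Qed.

Lemma majorantD p q r : 0 <= r -> majorant (p + q) r <= majorant p r + majorant q r.
Proof.
move=> r0; rewrite !majorantE -hornerD -majorantE; apply: majorant_le => // i.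
by rewrite !coefD !coef_abs_poly cabsD.
Qed.

Lemma majorantM p q r : 0 <= r -> majorant (p * q) r <= majorant p r * majorant q r.
Proof.
move=> r0; rewrite !majorantE -hornerM -majorantE; apply: majorant_le => // i.
rewrite !coefM (le_trans (cabs_sum _ _ _))// ler_sum// => j _.
by rewrite cabsM !coef_abs_poly.
Qed.

Lemma majorantC (c : R[i]) r : 0 <= r -> majorant c%:P r <= cabs c.
Proof.
move=> r0; rewrite -[leRHS](hornerC (cabs c) r); apply: majorant_le => // i.
by rewrite !coefC; case: ifP; rewrite ?cabs0.
Qed.

Lemma majorantZ (c : R[i]) p r : 0 <= r -> majorant (c *: p) r <= cabs c * majorant p r.
Proof.
move=> r0; rewrite -mul_polyC (le_trans (majorantM _ _ r0))// ler_wpM2r ?majorant_ge0//.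
exact: majorantC.
Qed.

Lemma majorantX r : 0 <= r -> majorant ('X : {poly R[i]}) r <= r.
Proof.
move=> r0; rewrite -[leRHS](hornerX r); apply: majorant_le => // i.
by rewrite !coefX; case: eqP => _; rewrite ?cabs1 ?cabs0.
Qed.

Lemma majorant_prod (T : Type) (s : seq T) (h : T -> {poly R[i]}) r : 0 <= r ->
  majorant (\prod_(i <- s) h i) r <= \prod_(i <- s) majorant (h i) r.
Proof.
move=> r0; elim: s => [|x s IH]; first by rewrite !big_nil -polyC1 (le_trans (majorantC _ r0))// cabs1.
rewrite !big_cons (le_trans (majorantM _ _ r0))// ler_wpM2l ?majorant_ge0//.
Qed.

Lemma majorant_sum (T : Type) (s : seq T) (h : T -> {poly R[i]}) r : 0 <= r ->
  majorant (\sum_(i <- s) h i) r <= \sum_(i <- s) majorant (h i) r.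
Proof.
move=> r0; elim: s => [|x s IH]; first by rewrite !big_nil -[0 in leLHS]polyC0 (le_trans (majorantC _ r0))// cabs0.
rewrite !big_cons (le_trans (majorantD _ _ r0))// lerD2l//.
Qed.

Lemma majorantXn (h : {poly R[i]}) r n : 0 <= r -> majorant (h ^+ n) r <= majorant h r ^+ n.
Proof.
move=> r0; elim: n => [|n IH]; first by rewrite !expr0 -polyC1 (le_trans (majorantC _ r0))// cabs1.
by rewrite !exprS (le_trans (majorantM _ _ r0))// ler_wpM2l ?majorant_ge0.
Qed.

Lemma majorant_mono p r s : 0 <= r -> r <= s -> majorant p r <= majorant p s.
Proof.
move=> r0 rs; rewrite ler_sum// => i _; rewrite ler_wpM2l ?cabs_ge0//.
by rewrite lerXn2r ?nnegrE// (le_trans r0).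
Qed.

Lemma majorant_size p r : 1 <= r -> majorant p r <= majorant p 1 * r ^+ size p.
Proof.
move=> r1; rewrite /majorant mulr_suml ler_sum// => i _.
rewrite expr1n mulr1 ler_wpM2l ?cabs_ge0// ler_weXn2l//.
exact: ltnW.
Qed.

End Majorants.

(** * Products of factors 1 + exp(s - d) under a counting bound *)

Section ExponentialProducts.
Variable R : realType.
Implicit Types (D : seq R) (s x : R).

(** The excess of log(1 + e^x) over the positive part of x is at most exp(- |x|), whose sum over the
    points is bounded by [shell_sum]. *)
Lemma one_plus_exp x : 1 + expR x <= expR (Num.max x 0 + expR (- `|x|)).
Proof.
have [x0|x0] := leP x 0.
  by rewrite add0r ler0_norm// opprK expR_ge1Dx.
rewrite gtr0_norm// expRD (_ : 1 + expR x = expR x * (1 + expR (- x))).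
  by rewrite ler_pM2l ?expR_gt0// expR_ge1Dx.
by rewrite mulrDr mulr1 -expRD subrr expR0 addrC.
Qed.

Lemma prod_one_plus (T : Type) (s : seq T) (F G : T -> R) :
  (forall i, 0 <= F i <= expR (G i)) ->
  \prod_(i <- s) F i <= expR (\sum_(i <- s) G i).
Proof. by move=> h; rewrite expR_sum; exact: ler_prod. Qed.

(** A positive s - d is at most the number of integers j >= 0 with d <= s - j. Summing the counting
    bound at s, s - 1, ... gives b s^2 / 2 as leading term. *)
Lemma positive_part_sum D (b C s : R) : 0 <= b -> 0 <= C -> 0 <= s -> (forall d, d \in D -> 0 <= d) ->
  (forall y, 0 <= y -> (count (fun d => d <= y)%R D)%:R <= b * y + C) ->
  \sum_(d <- D) Num.max (s - d) 0 <= b * s ^+ 2 / 2 + (b + C) * (s + 1).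
Proof.
move=> b0 C0 s0 D0 hD; have /andP[m1 m2] := truncn_itv s0; set m := Num.truncn s in m1 m2.
rewrite -[m.+1%:R]natr1 in m2.
have -> : \sum_(d <- D) Num.max (s - d) 0 = \sum_(d <- D | d \in D) Num.max (s - d) 0.
  by rewrite big_seq.
apply: (@le_trans _ _ (\sum_(d <- D | d \in D) \sum_(j < m.+1) (d <= s - j%:R)%R%:R)).
  apply: ler_sum => d /D0 d0; have [sd|sd] := leP (s - d) 0; first by rewrite sumr_ge0.
  have /andP[k1 k2] := truncn_itv (ltW sd); set k := Num.truncn _ in k1 k2.
  have km : (k < m.+1)%N by rewrite ltnS le_truncn// lerBlDl lerDr.
  apply: (@le_trans _ _ k.+1%:R); first exact: ltW.
  rewrite (bigID (fun j : 'I_m.+1 => j < k.+1)%N)/= ler_wpDr ?sumr_ge0//.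
  rewrite -(big_ord_widen m.+1 (fun j => (d <= s - j%:R)%R%:R))//.
  rewrite (eq_bigr (fun=> 1)) => [|j _]; first by rewrite sumr_const card_ord.
  suff -> : d <= s - (j : nat)%:R by [].
  rewrite lerBrDl -lerBrDr (le_trans _ k1)// ler_nat -ltnS; exact: ltn_ord.
rewrite -big_seq exchange_big/=.
apply: (@le_trans _ _ (\sum_(j < m.+1) (b * (s - j%:R) + C))).
  apply: ler_sum => j _; apply: le_trans (hD (s - j%:R) _).
    by rewrite -sum1_count natr_sum [leRHS]big_mkcond/=; apply: ler_sum => d _; case: ifP.
  by rewrite subr_ge0 (le_trans _ m1)// ler_nat -ltnS ltn_ord.
have -> : \sum_(j < m.+1) (b * (s - j%:R) + C) = (m%:R + 1) * (b * (s - m%:R / 2) + C).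
  clear; elim: m => [|m IH]; first by rewrite big_ord1 mul0r !subr0 add0r mul1r.
  by rewrite big_ord_recr/= IH -[m.+1%:R]natr1; field.
have m0 : 0 <= m%:R :> R := ler0n _ _.
move: (m%:R) m0 m1 m2 => u; clear -b0 C0 s0 => u0 u1 u2.
have : (u + 1) * C <= (s + 1) * C by rewrite ler_wpM2r// lerD2r.
have : b * ((u + 1) * (s - u / 2)) <= b * ((s + 1) * ((s + 1) / 2)).
  rewrite ler_wpM2l//; nra.
nra.
Qed.

Lemma exp_product_bound D (b C C1 s : R) : 0 <= b -> 0 <= C -> (forall d, d \in D -> 0 <= d) ->
  (forall y, 0 <= y -> (count (fun d => d <= y)%R D)%:R <= b * y + C) ->
  \sum_(d <- D) expR (- `|s - d|) <= C1 ->
  \prod_(d <- D) (1 + expR (s - d)) <=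
    expR (b * Num.max s 0 ^+ 2 / 2 + (b + C) * (`|s| + 1) + C1).
Proof.
move=> b0 C0 D0 hD h1.
apply: le_trans (prod_one_plus (G := fun d => Num.max (s - d) 0 + expR (- `|s - d|)) _ _) _.
  by move=> d; rewrite one_plus_exp andbT addr_ge0// expR_ge0.
rewrite ler_expR big_split lerD//; have [s0|s0] := leP 0 s.
  rewrite ger0_norm//; exact: positive_part_sum.
rewrite big_seq big1 => [|d /D0 d0]; last by rewrite max_r// subr_le0 (le_trans (ltW s0)).
by rewrite expr0n mulr0 mul0r add0r mulr_ge0// addr_ge0.
Qed.

End ExponentialProducts.

(** * Polynomials peaked at one point of the set *)

Section PeakPolynomials.
Variables (R : realType) (alpha : R) (L : set R[i]) (delta b C0 : R) (K : nat).
Hypothesis alpha_gt0 : 0 < alpha.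
Hypothesis delta_gt0 : 0 < delta.
Hypothesis L_separated : log_separated L delta.
Hypothesis L_shell : shell_bound L K.
Hypothesis b_ge0 : 0 <= b.
Hypothesis b_lt : b < 2 * alpha.
Hypothesis C0_ge0 : 0 <= C0.
Hypothesis L_count : count_bound L b C0.
Implicit Types (z w l : R[i]) (Z : seq R[i]).

(** Separation and the difference of moduli are combined additively; the resulting factor 1 +
    O(exp(- gap)) has bounded products over the points. *)
Lemma separated_ratio z w : L z -> L w -> z <> w -> 0 < tlog z -> tlog w <= tlog z ->
  expR (tlog z) <= cabs (z - w) * (1 + expR (- (tlog z - tlog w)) / delta).
Proof.
move=> Lz Lw zw z0 wz; have h1 := L_separated Lz Lw zw.
have h2 : expR (tlog z) - expR (tlog w) <= cabs (z - w).
  rewrite -(tlog_gt0 z0) (le_trans _ (cabs_lb z w))// lerD2l lerN2; exact: cabs_le_tlog.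
have -> : expR (- (tlog z - tlog w)) = expR (tlog w) / expR (tlog z).
  by rewrite opprB expRD expRN.
have e0 := expR_gt0 (tlog w).
have h3 : expR (tlog w) <= cabs (z - w) * (expR (tlog w) / expR (tlog z) / delta).
  have ez := expR_gt0 (tlog z).
  rewrite mulrA ler_pdivlMr// mulrA ler_pdivlMr// -mulrA (mulrC (cabs _)) ler_pM2l//.
rewrite mulrDr mulr1; lra.
Qed.

Lemma majorant_lagrange_factor l z (c r : R) : 0 <= r -> 0 <= c -> cabs z <= c ->
  majorant ((l - z)^-1 *: ('X - z%:P)) r <= (cabs (l - z))^-1 * (r + c).
Proof.
move=> r0 c0 zc; rewrite (le_trans (majorantZ _ _ r0))// cabsV ler_wpM2l ?invr_ge0 ?cabs_ge0//.
rewrite (le_trans (majorantD _ _ r0))// lerD ?majorantX//.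
by rewrite -polyCN (le_trans (majorantC _ r0))// cabsN.
Qed.

Lemma inner_factor l z (tau : R) : L l -> L z -> z <> l -> 0 < tlog l -> tlog z <= tlog l ->
  majorant ((l - z)^-1 *: ('X - z%:P)) (expR tau) <=
    (1 + expR (- `|tlog z - tlog l|) / delta) *
    (expR (tau - tlog l) * (1 + expR (- (tau - tlog l) - (tlog l - tlog z)))).
Proof.
move=> Ll Lz zl l0 lz.
have lz' : l <> z by move=> e; apply: zl.
have h := separated_ratio Ll Lz lz' l0 lz.
have c0 : 0 < cabs (l - z) by rewrite cabs_gt0 subr_eq0; apply/eqP.
rewrite (le_trans (majorant_lagrange_factor l (expR_ge0 tau) (expR_ge0 (tlog z)) (cabs_le_tlog z)))//.
rewrite ler0_norm ?subr_le0// opprK ler_pdivrMl//.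
have -> : expR tau + expR (tlog z) = expR (tlog l) *
    (expR (tau - tlog l) * (1 + expR (- (tau - tlog l) - (tlog l - tlog z)))).
  by rewrite !mulrDr mulr1 -!expRD; congr (expR _ + expR _); ring.
rewrite [leRHS]mulrA ler_wpM2r ?mulr_ge0 ?addr_ge0 ?expR_ge0//.
by rewrite opprB in h.
Qed.

Lemma outer_factor l z (tau : R) : L l -> L z -> 0 <= tlog l -> tlog l < tlog z ->
  majorant ((l - z)^-1 *: ('X - z%:P)) (expR tau) <=
    (1 + expR (- `|tlog z - tlog l|) / delta) *
    (1 + expR (tau - tlog l - (tlog z - tlog l))).
Proof.
move=> Ll Lz l0 lz.
have zl : z <> l by move=> e; move: lz; rewrite e ltxx.
have h := separated_ratio Lz Ll zl (le_lt_trans l0 lz) (ltW lz).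
have c0 : 0 < cabs (l - z) by rewrite cabs_gt0 subr_eq0; apply/eqP => e; apply: zl.
rewrite (le_trans (majorant_lagrange_factor l (expR_ge0 tau) (expR_ge0 (tlog z)) (cabs_le_tlog z)))//.
rewrite gtr0_norm ?subr_gt0// ler_pdivrMl// mulrA.
have -> : expR tau + expR (tlog z) = expR (tlog z) *
    (1 + expR (tau - tlog l - (tlog z - tlog l))).
  by rewrite mulrDr mulr1 addrC -!expRD; congr (_ + expR _); ring.
rewrite ler_wpM2r ?addr_ge0 ?expR_ge0//.
by rewrite cabs_distC.
Qed.

Lemma prod_expR_const (x : R) Z : \prod_(z <- Z) expR x = expR ((size Z)%:R * x).
Proof. by rewrite -expR_sum big_const_seq count_predT iter_addr_0 mulr_natl. Qed.

(** Here b < 2 alpha enters: the margin (alpha - b / 2) s^2 absorbs all terms linear in |s|. [B]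
    collects them: 3 for the desired decay, 1 for rounding 2 alpha t to m, and 2 (b + C0) from the
    two products. *)
Lemma exponent_bound : exists Q : R, forall (C1 : R) (m : nat) (t s : R),
   2 * alpha * t - 1 <= m%:R -> m%:R <= 2 * alpha * t ->
   m%:R * s + C1 / delta + (b * s ^+ 2 / 2 + 2 * ((b + C0) * (`|s| + 1) + C1)) <=
   (Q + C1 / delta + 2 * C1) + (alpha * (t + s) ^+ 2 - alpha * t ^+ 2 - 3 * `|s|).
Proof.
pose c := alpha - b / 2; pose B := 4 + 2 * (b + C0).
exists (2 * (b + C0) + B ^+ 2 / (4 * c)) => C1 m t s m1 m2.
have c0 : 0 < c by rewrite /c subr_gt0 ltr_pdivrMr// mulrC.
have ms : m%:R * s <= 2 * alpha * t * s + `|s|.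
  have [s0|s0] := leP 0 s.
    by rewrite (le_trans (ler_wpM2r s0 m2))// lerDl.
  by rewrite ltr0_norm//; nra.
have : B * `|s| <= c * s ^+ 2 + B ^+ 2 / (4 * c).
  have -> : s ^+ 2 = `|s| ^+ 2 by rewrite real_normK ?num_real.
  rewrite -subr_ge0 (_ : _ - _ = (2 * c * `|s| - B) ^+ 2 / (4 * c)).
    by rewrite divr_ge0 ?sqr_ge0// mulr_ge0// ltW.
  by field; rewrite gt_eqF.
move: ms; rewrite /B /c; move: (B ^+ 2 / _) => e.
move: (C1 / delta) (m%:R * s) (`|s|) => q p u; lra.
Qed.

(* The witness is the Lagrange product over the other points, times the power
   of ['X / l] that raises its degree near [l] to the dominant exponent
   [2 * alpha * tlog l]. *)
Lemma peak_poly : exists C L0 : R, [/\ 0 < C, 1 <= L0 &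
  forall l Y, L l -> L0 <= tlog l -> exists g : {poly R[i]}, [/\ g.[l] = 1,
    forall z, L z -> tlog z <= Y -> z <> l -> g.[z] = 0 &
    forall tau, 0 <= tau -> majorant g (expR tau) <=
      C * expR (alpha * tau ^+ 2 - alpha * tlog l ^+ 2 - 3 * `|tau - tlog l|)]].
Proof.
have [C1 C10 hC1] := shell_sum L_shell; have [Q hQ] := exponent_bound.
have a2b : 0 < 2 * alpha - b by rewrite subr_gt0.
(* From here on b t + C0 <= 2 alpha t - 1, so there are at most m inner points and the exponent m -
   size In is a true difference. *)
pose L0 := (C0 + 1) / (2 * alpha - b).
have L00 : 0 <= L0 := divr_ge0 (addr_ge0 C0_ge0 ler01) (ltW a2b).
exists (expR (Q + C1 / delta + 2 * C1)), (L0 + 1); split.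
- exact: expR_gt0.
- by rewrite lerDr.
move=> l Y Ll lL0; set t := tlog l.
have t0 : 0 < t by rewrite (lt_le_trans _ lL0)// ltr_pwDr.
have l0 : l != 0 by rewrite -cabs_gt0 (tlog_gt0 t0) expR_gt0.
have [Z uZ ZE] := shell_bound_finite Y L_shell.
pose In := [seq z <- Z | (tlog z <= t)%R && (z != l)].
pose Out := [seq z <- Z | ~~ (tlog z <= t)%R].
have ZL : in_set L Z by split => // z /ZE[].
have InL : in_set L In := in_set_filter _ ZL.
have OutL : in_set L Out := in_set_filter _ ZL.
have at0 : 0 <= 2 * alpha * t by rewrite !mulr_ge0 ?ltW.
have /andP[m1 m2] := truncn_itv at0; set m := Num.truncn _ in m1 m2.
rewrite -[m.+1%:R]natr1 in m2.
have nm : (size In <= m)%N.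
  rewrite -ltnS -(ltr_nat R) -[m.+1%:R]natr1 (le_lt_trans _ m2)//.
  have := @L_count 0 t In (lexx _) (ltW t0) InL; rewrite subr0 => h.
  rewrite (le_trans (h _))//.
    by move=> z; rewrite mem_filter tlog_ge0 => /andP[/andP[->]].
  have : L0 * (2 * alpha - b) = C0 + 1 by rewrite divfK// gt_eqF.
  have : L0 * (2 * alpha - b) <= t * (2 * alpha - b) by rewrite ler_pM2r// (le_trans _ lL0)// lerDl.
  by lra.
pose h z : {poly R[i]} := (l - z)^-1 *: ('X - z%:P).
have hl z : z != l -> (h z).[l] = 1.
  by move=> zl; rewrite hornerZ hornerXsubC mulVf// subr_eq0 eq_sym.
have hz z : (h z).[z] = 0 by rewrite hornerZ hornerXsubC subrr mulr0.
exists ((l^-1 *: 'X) ^+ (m - size In) * ((\prod_(z <- In) h z) * \prod_(z <- Out) h z)).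
split.
- rewrite !hornerM horner_exp hornerZ hornerX mulVf// expr1n mul1r !horner_prod.
  rewrite big_seq big1 ?mul1r => [|z]; last by rewrite mem_filter => /andP[/andP[_ /hl]].
  rewrite big_seq big1 // => z; rewrite mem_filter => /andP[zt _]; apply: hl.
  by apply/eqP => e; move: zt; rewrite e lexx.
- move=> z Lz zY /eqP zl; have zZ : z \in Z by apply/ZE.
  rewrite !hornerM !horner_prod; have [zt|zt] := boolP (tlog z <= t).
    rewrite [X in _ * (X * _)](bigD1_seq z) ?InL.1//= ?mem_filter ?zt ?zl//.
    by rewrite hz mul0r mul0r mulr0.
  rewrite [X in _ * (_ * X)](bigD1_seq z) ?OutL.1//= ?mem_filter ?zt ?zl//.
  by rewrite hz mul0r !mulr0.
move=> tau tau0; have r0 := expR_ge0 tau.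
pose s := tau - t.
have hIn : majorant (\prod_(z <- In) h z) (expR tau) <=
   expR ((\sum_(z <- In) expR (- `|tlog z - t|)) / delta) *
   (expR ((size In)%:R * s) * expR (b * Num.max (- s) 0 ^+ 2 / 2 + (b + C0) * (`|s| + 1) + C1)).
  apply: le_trans (majorant_prod _ _ r0) _.
  apply: (@le_trans _ _ (\prod_(z <- In) ((1 + expR (- `|tlog z - t|) / delta) *
    (expR s * (1 + expR (- s - (t - tlog z))))))).
    rewrite big_seq [leRHS]big_seq; apply: ler_prod => z; rewrite mem_filter => /andP[/andP[zt zl] zZ].
    rewrite majorant_ge0// inner_factor//; [exact: ZL.2|exact/eqP].
  rewrite !big_split/= prod_expR_const; apply: ler_pM.
  - by apply: prodr_ge0 => z _; rewrite addr_ge0// divr_ge0 ?expR_ge0// ltW.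
  - by rewrite mulr_ge0 ?expR_ge0// prodr_ge0// => z _; rewrite addr_ge0 ?expR_ge0.
  - rewrite mulr_suml; apply: prod_one_plus => z.
    by rewrite expR_ge1Dx addr_ge0// divr_ge0 ?expR_ge0// ltW.
  rewrite ler_wpM2l ?expR_ge0// -normrN.
  have := @exp_product_bound R [seq t - tlog z | z <- In] b C0 C1 (- s) b_ge0 C0_ge0.
  rewrite !big_map; apply.
  - move=> d /mapP[z]; rewrite mem_filter => /andP[/andP[zt _] _] ->; by rewrite subr_ge0.
  - move=> y y0; rewrite count_map -size_filter.
    have [yt|yt] := leP y t.
      apply: le_trans (@L_count (t - y) t _ _ _ (in_set_filter _ InL) _) _.
      + by rewrite subr_ge0.
      + by rewrite lerBlDr lerDl.
      + move=> z; rewrite !mem_filter /= => /andP[h1 /andP[/andP[h2 _] _]].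
        by rewrite h2 andbT; move: h1; lra.
      + by rewrite opprB addrCA subrr addr0.
    apply: le_trans (@L_count 0 t _ _ _ (in_set_filter _ InL) _) _ => //.
    + exact: ltW.
    + by move=> z; rewrite !mem_filter tlog_ge0 /= => /andP[h1 /andP[/andP[h2 _] _]].
    + by rewrite subr0 lerD2r ler_wpM2l// ltW.
  - apply: le_trans (hC1 In (t + s) InL); rewrite le_eqVlt; apply/orP; left; apply/eqP.
    apply: eq_bigr => z _; congr (expR (- `|_|)); ring.
have hOut : majorant (\prod_(z <- Out) h z) (expR tau) <=
   expR ((\sum_(z <- Out) expR (- `|tlog z - t|)) / delta) *
   expR (b * Num.max s 0 ^+ 2 / 2 + (b + C0) * (`|s| + 1) + C1).
  apply: le_trans (majorant_prod _ _ r0) _.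
  apply: (@le_trans _ _ (\prod_(z <- Out) ((1 + expR (- `|tlog z - t|) / delta) *
    (1 + expR (s - (tlog z - t)))))).
    rewrite big_seq [leRHS]big_seq; apply: ler_prod => z; rewrite mem_filter -ltNge => /andP[zt zZ].
    rewrite majorant_ge0// outer_factor//; [exact: ZL.2|exact: ltW].
  rewrite !big_split/=; apply: ler_pM.
  - by apply: prodr_ge0 => z _; rewrite addr_ge0// divr_ge0 ?expR_ge0// ltW.
  - by rewrite prodr_ge0// => z _; rewrite addr_ge0 ?expR_ge0.
  - rewrite mulr_suml; apply: prod_one_plus => z.
    by rewrite expR_ge1Dx addr_ge0// divr_ge0 ?expR_ge0// ltW.
  have := @exp_product_bound R [seq tlog z - t | z <- Out] b C0 C1 s b_ge0 C0_ge0.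
  rewrite !big_map; apply.
  - by move=> d /mapP[z]; rewrite mem_filter -ltNge => /andP[zt _] ->; rewrite subr_ge0 ltW.
  - move=> y y0; rewrite count_map -size_filter.
    apply: le_trans (@L_count t (t + y) _ _ _ (in_set_filter _ OutL) _) _.
    + exact: ltW.
    + by rewrite lerDl.
    + move=> z; rewrite !mem_filter -ltNge /= => /andP[h1 /andP[h2 _]].
      by rewrite (ltW h2) /=; move: h1; lra.
    + by rewrite addrAC subrr add0r.
  - apply: le_trans (hC1 Out (t + s) OutL); rewrite le_eqVlt; apply/orP; left; apply/eqP.
    apply: eq_bigr => z _; rewrite -normrN; congr (expR (- `|_|)); ring.
have hX : majorant ((l^-1 *: 'X) ^+ (m - size In)) (expR tau) <= expR ((m - size In)%:R * s).
  rewrite (le_trans (majorantXn _ _ r0))// expRM_natl lerXn2r ?nnegrE ?majorant_ge0 ?expR_ge0//.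
  rewrite (le_trans (majorantZ _ _ r0))// cabsV (tlog_gt0 t0) -expRN mulrC.
  by rewrite expRD ler_wpM2r ?expR_ge0// majorantX.
have hS : \sum_(z <- In) expR (- `|tlog z - t|) + \sum_(z <- Out) expR (- `|tlog z - t|) <= C1.
  have IOL : in_set L (In ++ Out).
    split; last by move=> z; rewrite mem_cat => /orP[/InL.2|/OutL.2].
    rewrite cat_uniq InL.1 OutL.1 andbT /=; apply/hasPn => z; rewrite !mem_filter => /andP[/negbTE -> _] //.
  by have := hC1 _ t IOL; rewrite big_cat.
apply: le_trans (majorantM _ _ r0) _.
apply: le_trans (ler_pM (majorant_ge0 _ r0) (majorant_ge0 _ r0) hX
  (le_trans (majorantM _ _ r0) (ler_pM (majorant_ge0 _ r0) (majorant_ge0 _ r0) hIn hOut))) _.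
rewrite -!expRD ler_expR.
have := hQ C1 m t s _ m1; rewrite lerBlDr => /(_ (ltW m2)).
have -> : (t + s) = tau by rewrite /s addrC subrK.
rewrite -/s; apply: le_trans.
(* Only one of the two products costs b s^2 / 2: the outer one for s > 0, the inner one for s <
   0. *)
have maxs : Num.max (- s) 0 ^+ 2 + Num.max s 0 ^+ 2 = s ^+ 2.
  have [s0|s0] := leP 0 s.
    by rewrite max_r ?oppr_le0// expr0n add0r.
  by rewrite max_l ?oppr_ge0 ?ltW// expr0n addr0 sqrrN.
have hd : (\sum_(z <- In) expR (- `|tlog z - t|)) / delta +
   (\sum_(z <- Out) expR (- `|tlog z - t|)) / delta <= C1 / delta.
  by rewrite -mulrDl ler_wpM2r// invr_ge0 ltW.
have mn : (m - size In)%:R + (size In)%:R = m%:R :> R by rewrite -natrD subnK.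
rewrite -maxs -mn; move: hd.
move: (_ / delta) (_ / delta) (C1 / delta) (Num.max _ _) (Num.max _ _) => q1 q2 q3 x1 x2; lra.
Qed.

End PeakPolynomials.
Lemma interp_poly (F : fieldType) (Z : seq F) (v : F -> F) : uniq Z ->
  exists p : {poly F}, forall z, z \in Z -> p.[z] = v z.
Proof.
elim: Z => [|z Z IH] /=; first by exists 0.
move=> /andP[zZ /IH[p hp]]; pose q := \prod_(w <- Z) ('X - w%:P).
have qz : q.[z] != 0 by rewrite -rootE root_prod_XsubC.
exists (p + ((v z - p.[z]) / q.[z]) *: q) => w; rewrite inE hornerD hornerZ.
have [->|_ /=] := eqVneq w z; first by move=> _; rewrite divfK// addrC subrK.
by move=> wZ; rewrite (rootP (_ : root q w)) ?root_prod_XsubC// mulr0 addr0 hp.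
Qed.

Lemma cauchy_schwarz_seq (R : realType) (T : Type) (s : seq T) (F e : T -> R) :
  (forall i, 0 <= e i) ->
  (\sum_(i <- s) F i * e i) ^+ 2 <= (\sum_(i <- s) e i) * \sum_(i <- s) F i ^+ 2 * e i.
Proof.
move=> e0; elim: s => [|i s IH]; first by rewrite !big_nil expr2 !mul0r.
rewrite !big_cons; have := e0 i; move: (F i) (e i) IH => x y.
have : 0 <= \sum_(j <- s) e j by exact: sumr_ge0.
have : 0 <= \sum_(j <- s) F j ^+ 2 * e j by apply: sumr_ge0 => j _; rewrite mulr_ge0 ?sqr_ge0.
move: (\sum_(j <- s) F j * e j) (\sum_(j <- s) e j) (\sum_(j <- s) _) => S E Q Q0 E0 h y0.
suff : 0 <= E * x ^+ 2 + Q - 2 * S * x.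
  move=> k; have := mulr_ge0 y0 k; move: h; clear; rewrite !expr2; nra.
move: E0; rewrite le_eqVlt => /orP[/eqP E0|E0].
  move: h; rewrite -E0 mul0r => h; have S0 : S = 0.
    by apply/eqP; rewrite -sqrf_eq0 eq_le h sqr_ge0.
  by rewrite S0 mulr0 !mul0r subr0 add0r.
rewrite -(pmulr_rge0 _ E0); have := sqr_ge0 (E * x - S); move: h; clear; rewrite !expr2; nra.
Qed.

Lemma sqr_le_add (R : realType) (p q d : R) : 0 <= q -> q <= d + p ->
  q ^+ 2 <= 2 * d ^+ 2 + 2 * p ^+ 2.
Proof. by have := sqr_ge0 (p - d); rewrite !expr2; nra. Qed.

Lemma sqr_half_add (R : realType) (p q d : R) : 0 <= q -> q <= p / 2 + d ->
  q ^+ 2 <= p ^+ 2 / 2 + 2 * d ^+ 2.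
Proof.
rewrite addrC => q0 /(sqr_le_add q0)/le_trans; apply; rewrite !expr2; lra.
Qed.

(** A polynomial grows at most like exp((size p) tau), and m tau - alpha tau^2 has maximum m^2 / (4
    alpha). *)
Lemma poly_weight_bound (R : realType) (alpha N : R) (p : {poly R[i]}) : 0 < alpha ->
  exists2 C : R, 0 <= C & forall tau, 0 <= tau ->
    majorant p (expR tau) <= C * expR (alpha * tau ^+ 2 - N * tau).
Proof.
move=> a0; set m := (size p)%:R + N.
exists (majorant p 1 * expR (m ^+ 2 / (4 * alpha))) => [|tau tau0].
  by rewrite mulr_ge0 ?majorant_ge0 ?expR_ge0.
rewrite (le_trans (majorant_size _ _)) -?[leLHS]expR0 ?ler_expR//.
rewrite -mulrA ler_wpM2l ?majorant_ge0// -expRM_natl -expRD ler_expR.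
have : 0 <= (2 * alpha * tau - m) ^+ 2 / (4 * alpha) by rewrite divr_ge0 ?sqr_ge0// mulr_ge0// ltW.
rewrite (_ : _ / _ = alpha * tau ^+ 2 - m * tau + m ^+ 2 / (4 * alpha)).
  by rewrite /m; lra.
by field; rewrite gt_eqF.
Qed.

(** * Interpolation level by level *)

Section NewtonSeries.
Variables (R : realType) (alpha kappa : R) (L : set R[i]) (b C0 C L0 T : R).
Variables (G : R[i] -> R -> {poly R[i]}) (S : nat -> seq R[i]) (u : R[i] -> R[i]).
Hypothesis kappa01 : 0 <= kappa <= 1.
Hypothesis b_ge0 : 0 <= b.
Hypothesis C0_ge0 : 0 <= C0.
Hypothesis L_count : count_bound L b C0.
Hypothesis C_ge0 : 0 <= C.
Hypothesis L0_ge0 : 0 <= L0.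
Hypothesis T_ge1 : 1 <= T.
Hypothesis G1 : forall l Y, L l -> L0 <= tlog l -> (G l Y).[l] = 1.
Hypothesis G0 : forall l Y z, L l -> L0 <= tlog l -> L z -> tlog z <= Y -> z <> l ->
  (G l Y).[z] = 0.
Hypothesis G_bound : forall l Y tau, L l -> L0 <= tlog l -> 0 <= tau ->
  majorant (G l Y) (expR tau) <=
    C * expR (alpha * tau ^+ 2 - alpha * tlog l ^+ 2 - 3 * `|tau - tlog l|).
Let x (k : nat) := L0 + k%:R * T.
Hypothesis uniq_S : forall k, uniq (S k).
Hypothesis mem_S : forall k z, z \in S k <-> L z /\ x k <= tlog z < x k.+1.
Hypothesis u0 : forall l, L l -> tlog l < L0 -> u l = 0.
Implicit Types (z w l : R[i]) (Z : seq R[i]).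
Let wt tau := expR (alpha * tau ^+ 2 - kappa * tau).
Local Notation W := (weight alpha kappa).

(** The cutoff [x j.+2] makes the corrections of level j vanish on all levels up to j + 1, each
    except at its own point: they spoil neither the earlier levels nor the next one. *)
Fixpoint newton k : {poly R[i]} := if k is j.+1 then
    newton j + \sum_(l <- S j) (u l - (newton j).[l]) *: G l (x j.+2)
  else 0.

Definition defect k l := u l - (newton k).[l].

Definition increment k := \sum_(l <- S k) defect k l *: G l (x k.+2).

Definition level_norm k := \sum_(l <- S k) cabs (defect k l) / W l.

Definition data_norm k := \sum_(l <- S k) cabs (u l) / W l.

Lemma newton_sum k : newton k = \sum_(i < k) increment i.
Proof. by elim: k => [|k IH]; rewrite ?big_ord0// big_ord_recr/= -IH. Qed.

Lemma level_gap i j : (i <= j)%N -> x i + (j - i)%:R * T = x j.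
Proof. by move=> ij; rewrite /x natrB//; ring. Qed.

Lemma level_mono i j : (i <= j)%N -> x i <= x j.
Proof.
by move=> ij; rewrite -(level_gap ij) lerDl mulr_ge0// (le_trans ler01).
Qed.

Lemma level_ge k : L0 <= x k.
Proof. by rewrite /x lerDl mulr_ge0// (le_trans ler01). Qed.

Lemma level_norm_ge0 k : 0 <= level_norm k.
Proof. by apply: sumr_ge0 => l _; rewrite divr_ge0 ?cabs_ge0 ?expR_ge0. Qed.

Lemma data_norm_ge0 k : 0 <= data_norm k.
Proof. by apply: sumr_ge0 => l _; rewrite divr_ge0 ?cabs_ge0 ?expR_ge0. Qed.

Lemma size_level k : (size (S k))%:R <= b * T + C0.
Proof.
have -> : T = x k.+1 - x k by rewrite /x -[k.+1%:R]natr1; ring.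
apply: L_count.
- exact: le_trans L0_ge0 (level_ge k).
- exact: level_mono.
- by split => // z /mem_S[].
- by move=> z /mem_S[_ /andP[-> /ltW]].
Qed.

(** Of the rate 3 in [G_bound], one unit turns exp(- kappa tlog l) into exp(- kappa tau). The other
    two are recentred from the points to the bottom [x k] of their level, which costs exp(2 T). *)
Lemma majorant_increment k tau : 0 <= tau -> majorant (increment k) (expR tau) <=
  C * wt tau * (level_norm k * expR (2 * T - 2 * `|tau - x k|)).
Proof.
move=> tau0; have r0 := expR_ge0 tau.
rewrite (le_trans (majorant_sum _ _ r0))// mulrA /level_norm mulr_sumr mulr_suml.
rewrite big_seq [leRHS]big_seq; apply: ler_sum => l /mem_S[Ll /andP[l1 l2]].
rewrite (le_trans (majorantZ _ _ r0))//.
have := G_bound (x k.+2) Ll (le_trans (level_ge k) l1) tau0 => h.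
rewrite (le_trans (ler_wpM2l (cabs_ge0 _) h))//.
rewrite [leRHS](_ : _ = cabs (defect k l) * (C * (wt tau / W l * expR (2 * T - 2 * `|tau - x k|)))).
  rewrite ler_wpM2l ?cabs_ge0// ler_wpM2l// -expRN -!expRD ler_expR.
  have xk : `|tau - x k| <= `|tau - tlog l| + T.
    have -> : tau - x k = (tau - tlog l) + (tlog l - x k) by ring.
    rewrite (le_trans (ler_normD _ _))// lerD2l ger0_norm ?subr_ge0// lerBlDl.
    by move: (ltW l2); rewrite /x -[k.+1%:R]natr1; lra.
  have kk : - kappa * (tlog l - tau) <= `|tau - tlog l|.
    have /andP[k0 k1] := kappa01; rewrite mulNr -mulrN opprB.
    apply: le_trans (ler_wpM2l k0 (ler_norm _)) _.
    by rewrite -[leRHS]mul1r ler_wpM2r.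
  lra.
by rewrite mulrA [in RHS]mulrCA; field; rewrite expR_eq0.
Qed.

Lemma increment_value k l : l \in S k -> (increment k).[l] = defect k l.
Proof.
move=> lS; have [Ll /andP[l1 l2]] := (mem_S k l).1 lS.
rewrite horner_sum (bigD1_seq l)//= hornerZ G1// ?(le_trans (level_ge k))// mulr1.
rewrite big_seq_cond big1 ?addr0// => m /andP[/mem_S[Lm /andP[m1 _]] /eqP ml].
rewrite hornerZ G0 ?mulr0// ?(le_trans (level_ge k))//; last by move=> e; exact: ml.
by rewrite (le_trans (ltW l2))// level_mono.
Qed.

Lemma increment_zero k z : L z -> tlog z <= x k.+2 -> z \notin S k -> (increment k).[z] = 0.
Proof.
move=> Lz zx zS; rewrite horner_sum big_seq big1// => m mS; have [Lm /andP[m1 _]] := (mem_S k m).1 mS.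
rewrite hornerZ G0 ?mulr0// ?(le_trans (level_ge k))//.
by move=> e; move: zS; rewrite e mS.
Qed.

Lemma newton_interpolates k l : L l -> tlog l < x k -> (newton k).[l] = u l.
Proof.
move=> Ll; elim: k => [|k IH] lx.
  by rewrite /= horner0 u0//; move: lx; rewrite /x mul0r addr0.
have -> : newton k.+1 = newton k + increment k by [].
rewrite hornerD; have [h|h] := ltP (tlog l) (x k).
  rewrite IH// increment_zero ?addr0//; first by rewrite (le_trans (ltW h))// level_mono// leqW.
  by apply/negP => /mem_S[_ /andP[]]; rewrite leNgt h.
rewrite increment_value; last by apply/mem_S; rewrite h lx.
by rewrite /defect addrC subrK.
Qed.

Let theta := expR (- T).
Let A := C * (b * T + C0).
(** Influence of the lower levels on level k, discounted by theta per level. *)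
Definition memory k := \sum_(i < k) theta ^+ (k - i) * level_norm i.

Lemma A_ge0 : 0 <= A.
Proof. by rewrite mulr_ge0// addr_ge0// mulr_ge0// (le_trans ler01). Qed.

Lemma memory_ge0 k : 0 <= memory k.
Proof. by apply: sumr_ge0 => i _; rewrite mulr_ge0 ?level_norm_ge0// exprn_ge0// expR_ge0. Qed.

Lemma memoryS k : memory k.+1 = theta * (memory k + level_norm k).
Proof.
rewrite /memory big_ord_recr/= subSnn expr1 mulrDr [X in _ = X + _]mulr_sumr; congr (_ + _).
apply: eq_bigr => i _; rewrite subSn; last exact: ltnW.
by rewrite exprS mulrA.
Qed.

(* A polynomial built on level [i] also vanishes on level [i + 1], so that only
   levels at distance at least [T] from each other interact. *)
Lemma increment_at_level k i l : (i < k)%N -> l \in S k ->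
  cabs (increment i).[l] / W l <= C * (theta ^+ (k - i) * level_norm i).
Proof.
move=> ik lS; have [Ll /andP[l1 l2]] := (mem_S k l).1 lS.
have lSi : l \notin S i.
  by apply/negP => /mem_S[_ /andP[_]]; rewrite ltNge (le_trans _ l1)// level_mono.
have rhs0 : 0 <= C * (theta ^+ (k - i) * level_norm i).
  by rewrite !mulr_ge0 ?level_norm_ge0 ?exprn_ge0 ?expR_ge0.
move: ik; rewrite leq_eqVlt => /orP[/eqP ik|ik].
  by rewrite increment_zero ?cabs0 ?mul0r// ik ltW.
rewrite ler_pdivrMr ?expR_gt0//.
rewrite (le_trans (horner_majorant _ _))//.
rewrite (le_trans (majorant_mono _ (cabs_ge0 _) (cabs_le_tlog l)))//.
rewrite (le_trans (majorant_increment _ (tlog_ge0 l)))// -[leLHS]mulrA -[leRHS]mulrA ler_wpM2l//.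
rewrite mulrC ler_wpM2r ?expR_ge0// mulrC ler_wpM2r ?level_norm_ge0//.
rewrite /theta -expRM_natl ler_expR.
have g := level_gap (ltnW (ltnW ik)).
(* With j = k - i at least 2, 2 T - 2 j T <= - j T: the skipped level pays for exp(2 T). *)
have k2 : 2 <= (k - i)%:R :> R by rewrite ler_nat ltn_subRL addn1.
have : 0 <= tlog l - x i.
  by rewrite subr_ge0 (le_trans _ l1)// level_mono// ltnW// ltnW.
move=> h; rewrite ger0_norm//.
have : (k - i)%:R * T <= tlog l - x i by rewrite lerBrDl g.
have : 0 <= ((k - i)%:R - 2) * T by rewrite mulr_ge0 ?subr_ge0// (le_trans ler01).
lra.
Qed.

Lemma level_norm_rec k : level_norm k <= data_norm k + A * memory k.
Proof.
apply: (@le_trans _ _ (\sum_(l <- S k) (cabs (u l) / W l + C * memory k))).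
  rewrite [leLHS]big_seq [leRHS]big_seq; apply: ler_sum => l lS.
  rewrite /memory mulr_sumr; apply: (@le_trans _ _ (cabs (u l) / W l +
      \sum_(i < k) cabs (increment i).[l] / W l)); last first.
    by rewrite lerD2l; apply: ler_sum => i _; exact: increment_at_level.
  rewrite -mulr_suml -mulrDl ler_wpM2r ?invr_ge0 ?expR_ge0//.
  rewrite (le_trans (cabsB _ _))// lerD2l newton_sum horner_sum.
  exact: cabs_sum.
rewrite big_split/= lerD2l big_const_seq count_predT iter_addr_0 -mulr_natl /A.
rewrite [leRHS]mulrAC [leRHS]mulrC ler_wpM2r ?mulr_ge0 ?memory_ge0//; exact: size_level.
Qed.

Hypothesis theta_small : theta * (1 + A) <= 2^-1.

(** Defects feed the memory and the memory feeds later defects; taking T large makes this loop a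
    contraction. *)
Lemma memory_rec k : memory k.+1 <= memory k / 2 + data_norm k.
Proof.
rewrite memoryS; have t0 : 0 <= theta := expR_ge0 _.
have t1 : theta <= 1 by rewrite -[leRHS]expR0 ler_expR oppr_le0 (le_trans ler01).
rewrite (le_trans (ler_wpM2l t0 (lerD (lexx _) (level_norm_rec k))))//.
have -> : theta * (memory k + (data_norm k + A * memory k)) =
  memory k * (theta * (1 + A)) + theta * data_norm k by ring.
rewrite lerD// ?ler_wpM2l ?memory_ge0//.
by rewrite -[leRHS]mul1r ler_wpM2r ?data_norm_ge0.
Qed.

Lemma level_norm_bounded B : (forall k, data_norm k <= B) ->
  forall k, level_norm k <= B + A * (2 * B).
Proof.
move=> hB k; have B0 := le_trans (data_norm_ge0 0) (hB 0%N).
have hm : memory k <= 2 * B.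
  elim: k => [|k IH]; first by rewrite /memory big_ord0 mulr_ge0.
  by rewrite (le_trans (memory_rec k))//; have := hB k; lra.
by rewrite (le_trans (level_norm_rec k))// lerD// ler_wpM2l ?A_ge0.
Qed.

(** The factor 1 / 2 survives squaring by [sqr_half_add], so the sum of the squared memories is at
    most half of itself plus a multiple of B. *)
Lemma level_norm_l2 B : summable_below (fun k => data_norm k ^+ 2) B ->
  summable_below (fun k => level_norm k ^+ 2) (2 * B + 2 * A ^+ 2 * (4 * B)).
Proof.
move=> hB N; have hm : \sum_(k < N) memory k ^+ 2 <= 4 * B.
  have h1 : \sum_(k < N.+1) memory k ^+ 2 <= (\sum_(k < N) memory k ^+ 2) / 2 + 2 * B.
    rewrite big_ord_recl {1}/memory big_ord0 expr0n add0r.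
    rewrite (le_trans _ (lerD (lexx _) (ler_wpM2l _ (hB N))))//.
    rewrite mulr_suml mulr_sumr -big_split/=; apply: ler_sum => k _.
    have := memory_rec k; have := memory_ge0 k.+1; have := memory_ge0 k; have := data_norm_ge0 k.
    have -> : bump 0 k = k.+1 by [].
    by move=> *; exact: sqr_half_add.
  have : \sum_(k < N) memory k ^+ 2 <= \sum_(k < N.+1) memory k ^+ 2.
    by rewrite big_ord_recr/= lerDl sqr_ge0.
  lra.
apply: (@le_trans _ _ (\sum_(k < N) (2 * data_norm k ^+ 2 + 2 * A ^+ 2 * memory k ^+ 2))).
  apply: ler_sum => k _; have := level_norm_rec k; have := level_norm_ge0 k.
  have := mulr_ge0 A_ge0 (memory_ge0 k); have := data_norm_ge0 k.
  rewrite -mulrA -exprMn => *; exact: sqr_le_add.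
have A2 : 0 <= 2 * A ^+ 2 := mulr_ge0 (ler0n _ 2) (sqr_ge0 A).
rewrite big_split/= -!mulr_sumr; apply: lerD; apply: ler_wpM2l => //; exact: hB.
Qed.

Lemma data_norm_bounded B : 0 <= B -> (forall l, L l -> cabs (u l) <= B * W l) ->
  forall k, data_norm k <= (b * T + C0) * B.
Proof.
move=> B0 hB k; apply: (@le_trans _ _ (\sum_(l <- S k) B)).
  rewrite /data_norm [leLHS]big_seq [leRHS]big_seq; apply: ler_sum => l /mem_S[Ll _].
  by rewrite ler_pdivrMr ?expR_gt0// hB.
by rewrite big_const_seq count_predT iter_addr_0 -mulr_natl ler_wpM2r// size_level.
Qed.

Lemma levels_concat (F : R[i] -> R) N : exists Z, [/\ in_set L Z,
  forall z, z \in Z -> tlog z < x N & \sum_(k < N) \sum_(l <- S k) F l = \sum_(l <- Z) F l].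
Proof.
elim: N => [|N [Z [ZL Zx ZE]]]; first by exists [::]; rewrite big_ord0 big_nil; split.
exists (Z ++ S N); split; last by rewrite big_ord_recr/= ZE big_cat.
  split; last by move=> z; rewrite mem_cat => /orP[/ZL.2//|/mem_S[]].
  rewrite cat_uniq ZL.1 uniq_S andbT /=; apply/hasPn => z /mem_S[_ /andP[zN _]].
  by apply/negP => /Zx; rewrite ltNge zN.
move=> z; rewrite mem_cat => /orP[/Zx h|/mem_S[_ /andP[]]//].
by rewrite (lt_le_trans h)// level_mono.
Qed.

(** Cauchy-Schwarz on each level, whose cardinality is bounded, together with disjointness of the
    levels. *)
Lemma data_norm_l2 B : (forall Z, in_set L Z -> \sum_(l <- Z) (cabs (u l) / W l) ^+ 2 <= B) ->
  summable_below (fun k => data_norm k ^+ 2) ((b * T + C0) * B).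
Proof.
move=> hB N; have bT : 0 <= b * T + C0 by rewrite addr_ge0// mulr_ge0// (le_trans ler01).
have [Z [ZL _ ZE]] := levels_concat (fun l => (cabs (u l) / W l) ^+ 2) N.
rewrite (le_trans _ (ler_wpM2l bT (hB Z ZL)))// -ZE mulr_sumr; apply: ler_sum => k _.
have := cauchy_schwarz_seq (S k) (fun l => cabs (u l) / W l) (fun=> ler01 : 0 <= 1).
under eq_bigr do rewrite mulr1; move=> /le_trans; apply.
under [X in _ * X <= _]eq_bigr do rewrite mulr1.
rewrite ler_wpM2r ?sumr_ge0// => [l _|]; first exact: sqr_ge0.
by rewrite big_const_seq count_predT iter_addr_0 size_level.
Qed.

End NewtonSeries.

(** * The interpolating series for both exponents *)

Section InterpolatingSeries.
Variables (R : realType) (alpha kappa : R) (L : set R[i]) (delta b C0 : R) (K : nat).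
Hypothesis alpha_gt0 : 0 < alpha.
Hypothesis kappa01 : 0 <= kappa <= 1.
Hypothesis delta_gt0 : 0 < delta.
Hypothesis L_separated : log_separated L delta.
Hypothesis L_shell : shell_bound L K.
Hypothesis b_ge0 : 0 <= b.
Hypothesis b_lt : b < 2 * alpha.
Hypothesis C0_ge0 : 0 <= C0.
Hypothesis L_count : count_bound L b C0.
Implicit Types (v : R[i] -> R[i]) (z l : R[i]) (Z : seq R[i]).
Local Notation W := (weight alpha kappa).

Lemma exp_beats_affine (a0 a1 : R) : 1 <= a0 -> 0 <= a1 ->
  exists2 T : R, 1 <= T & expR (- T) * (a0 + a1 * T) <= 2^-1.
Proof.
move=> a01 a10; pose T := 8 * a1 + 8 * a0; have T1 : 1 <= T by rewrite /T; lra.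
exists T => //; have h := expR_ge1Dx (T / 2).
have hT : T * (2 * a1 + 2 * a0) <= expR T.
  have -> : expR T = expR (T / 2) ^+ 2 by rewrite expr2 -expRD -splitr.
  apply: (@le_trans _ _ ((T / 2) ^+ 2)); last first.
    by rewrite lerXn2r ?nnegrE ?expR_ge0 ?divr_ge0 ?(le_trans ler01 T1)//; lra.
  by rewrite /T expr2; lra.
have e0 := expR_gt0 T; rewrite expRN ler_pdivrMl//.
rewrite ler_pdivlMr// (le_trans _ hT)//.
have : 0 <= (T - 1) * (2 * a0) by rewrite mulr_ge0 ?subr_ge0// mulr_ge0// (le_trans ler01).
lra.
Qed.

Lemma spaced_exp_sum (L0 T : R) : 1 <= T -> exists2 C : R, 0 <= C & forall x N,
  \sum_(k < N) expR (- `|x - (L0 + k%:R * T)|) <= C.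
Proof.
move=> T1; have T0 := lt_le_trans ltr01 T1; have [C C_gt0 hC] := exp_dist_sum R.
exists C => [|x N]; first exact: ltW.
apply: le_trans (hC ((x - L0) / T) N); apply: ler_sum => k _.
rewrite ler_expR lerN2.
have -> : x - (L0 + k%:R * T) = - (T * (k%:R - (x - L0) / T)) by field; rewrite gt_eqF.
by rewrite normrN normrM gtr0_norm// -[leLHS]mul1r ler_wpM2r.
Qed.

(** Common output for both exponents, a series of bumps of height [E k] centred at logarithmic
    radius [y k]: bounded heights serve p = oo, square summable ones p = 2. *)
Lemma interpolating_series v (B : R) : 0 <= B -> (forall l, L l -> cabs (v l) <= B * W l) ->
  exists (h : nat -> {poly R[i]}) (E y : nat -> R) (M Cy : R),
  [/\ summable_polys h, forall l, L l -> sumC (fun k => (h k).[l]) = v l,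
      forall k, 0 <= E k <= M &
      forall k z, cabs (h k).[z] <= E k * W z * expR (- (2 * `|tlog z - y k|))] /\
  [/\ forall x N, \sum_(k < N) expR (- `|x - y k|) <= Cy, forall k, 0 <= y k &
      (exists B2, forall Z, in_set L Z -> \sum_(l <- Z) (cabs (v l) / W l) ^+ 2 <= B2) ->
      exists B3, summable_below (fun k => E k ^+ 2) B3].
Proof.
move=> B0 hv.
have [C [L0 [C_gt0 L01 peak]]] := peak_poly alpha_gt0 delta_gt0 L_separated L_shell b_ge0 b_lt C0_ge0 L_count.
have C_ge0 := ltW C_gt0; have L00 : 0 <= L0 := le_trans ler01 L01.
pose P (q : R[i] * R) (g : {poly R[i]}) := L q.1 -> L0 <= tlog q.1 ->
    [/\ g.[q.1] = 1, forall z, L z -> tlog z <= q.2 -> z <> q.1 -> g.[z] = 0 &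
     forall tau, 0 <= tau -> majorant g (expR tau) <=
      C * expR (alpha * tau ^+ 2 - alpha * tlog q.1 ^+ 2 - 3 * `|tau - tlog q.1|)].
have [G GP] : {G & forall q, P q (G q)}.
  apply: choice => -[l Y].
  have [[Ll lL]|h] := pselect (L l /\ L0 <= tlog l).
    by have [g hg] := peak l Y Ll lL; exists g => _ _; exact: hg.
  by exists 0 => Ll lL; case: h.
have [T T1 hT] : exists2 T : R, 1 <= T & expR (- T) * (1 + C * (b * T + C0)) <= 2^-1.
  have h1 : 1 <= 1 + C * C0 by rewrite lerDl mulr_ge0.
  have [T T1 h] := exp_beats_affine h1 (mulr_ge0 C_ge0 b_ge0).
  by exists T => //; apply: le_trans h; rewrite le_eqVlt; apply/orP; left; apply/eqP; ring.
pose x k := L0 + k%:R * T.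
have [S SP] : {S : nat -> seq R[i] & forall k, uniq (S k) /\
    forall z, z \in S k <-> L z /\ x k <= tlog z < x k.+1}.
  apply: (choice (P := fun k s => uniq s /\ forall z, z \in s <-> L z /\ x k <= tlog z < x k.+1)) => k.
  have [Z uZ ZE] := shell_bound_finite (x k.+1) L_shell.
  exists [seq z <- Z | (x k <= tlog z < x k.+1)%R]; split; first exact: filter_uniq.
  move=> z; rewrite mem_filter; split => [/andP[h1 /ZE[]]//|[Lz h]].
  by rewrite h; apply/ZE; split => //; case/andP: h => _ /ltW.
(* The finitely many points up to L0 have no peak polynomials. One polynomial [p0], counted as a
   bump centred at 0, interpolates there, and the levels handle v - p0. *)
have [Z0 uZ0 Z0E] := shell_bound_finite L0 L_shell.
have [p0 hp0] := interp_poly v uZ0.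
have [Cp Cp0 hCp] := poly_weight_bound 3 p0 alpha_gt0.
pose u l := v l - p0.[l].
have p0W tau : 0 <= tau -> majorant p0 (expR tau) <=
    Cp * expR (alpha * tau ^+ 2 - kappa * tau) * expR (- (2 * `|tau - 0|)).
  move=> tau0; rewrite subr0 ger0_norm// (le_trans (hCp _ tau0))// -mulrA ler_wpM2l//.
  rewrite -expRD ler_expR; have /andP[_ k1] := kappa01.
  have : 0 <= (1 - kappa) * tau by rewrite mulr_ge0 ?subr_ge0.
  lra.
have p0l l : cabs p0.[l] / W l <= Cp * expR (- (2 * `|tlog l - 0|)).
  rewrite ler_pdivrMr ?expR_gt0// mulrAC (le_trans (horner_majorant _ _))//.
  by rewrite (le_trans (majorant_mono _ (cabs_ge0 _) (cabs_le_tlog l)))// p0W ?tlog_ge0.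
have u0 l : L l -> tlog l < L0 -> u l = 0.
  by move=> Ll lL; rewrite /u hp0 ?subrr//; apply/Z0E; split => //; exact: ltW.
have uB l : L l -> cabs (u l) <= (B + Cp) * W l.
  move=> Ll; rewrite (le_trans (cabsB _ _))// mulrDl lerD ?hv//.
  have := p0l l; rewrite ler_pdivrMr ?expR_gt0// => /le_trans; apply.
  rewrite ler_wpM2r ?expR_ge0// ler_piMr// -[leRHS]expR0 ler_expR oppr_le0 mulr_ge0//.
pose G' l Y := G (l, Y).
pose S1 := fun k => (SP k).1; pose S2 := fun k z => (SP k).2 z.
have G1 l Y : L l -> L0 <= tlog l -> (G' l Y).[l] = 1 by move=> Ll /(GP (l, Y) Ll)[].
have G0 l Y z : L l -> L0 <= tlog l -> L z -> tlog z <= Y -> z <> l -> (G' l Y).[z] = 0.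
  by move=> Ll /(GP (l, Y) Ll)[_ h _]; exact: h.
have GB l Y tau : L l -> L0 <= tlog l -> 0 <= tau -> majorant (G' l Y) (expR tau) <=
    C * expR (alpha * tau ^+ 2 - alpha * tlog l ^+ 2 - 3 * `|tau - tlog l|).
  by move=> Ll /(GP (l, Y) Ll)[_ _ h]; exact: h.
pose H := increment L0 T G' S u.
pose D := level_norm alpha kappa L0 T G' S u.
have D0 k : 0 <= D k by exact: level_norm_ge0.
have HB k tau : 0 <= tau -> majorant (H k) (expR tau) <=
    (C * expR (2 * T) * D k) * expR (alpha * tau ^+ 2 - kappa * tau) * expR (- (2 * `|tau - x k|)).
  move=> tau0; apply: le_trans (majorant_increment u kappa01 C_ge0 T1 GB S2 k tau0) _.
  rewrite (expRD (2 * T)) -/(D k) -/(x k) le_eqVlt; apply/orP; left; apply/eqP; ring.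
pose h k := if k is j.+1 then H j else p0.
pose E k := if k is j.+1 then C * expR (2 * T) * D j else Cp.
pose y k := if k is j.+1 then x j else 0.
have CT : 0 <= C * expR (2 * T) by rewrite mulr_ge0// expR_ge0.
have E0 k : 0 <= E k by case: k => [|k]//=; exact: mulr_ge0.
have hB k tau : 0 <= tau -> majorant (h k) (expR tau) <=
    E k * expR (alpha * tau ^+ 2 - kappa * tau) * expR (- (2 * `|tau - y k|)).
  by case: k => [|k] tau0; [exact: p0W|exact: HB].
have hz k z : cabs (h k).[z] <= E k * W z * expR (- (2 * `|tlog z - y k|)).
  rewrite (le_trans (horner_majorant _ _))//.
  by rewrite (le_trans (majorant_mono _ (cabs_ge0 _) (cabs_le_tlog z)))// hB ?tlog_ge0.
have BC0 : 0 <= B + Cp by exact: addr_ge0.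
have [M hM] : exists M, forall k, E k <= M.
  pose MD := (b * T + C0) * (B + Cp) + C * (b * T + C0) * (2 * ((b * T + C0) * (B + Cp))).
  have DB k : D k <= MD.
    apply: (level_norm_bounded kappa01 b_ge0 C0_ge0 L_count C_ge0 L00 T1 G0 GB S1 S2 hT).
    exact: (data_norm_bounded L_count L00 T1 S1 S2 BC0 uB).
  exists (Num.max Cp (C * expR (2 * T) * MD)) => -[|k] /=; first by rewrite le_max lexx.
  by rewrite le_max ler_wpM2l ?orbT.
have [C1 C10 hC1] := spaced_exp_sum L0 T1.
have yC (z : R) N : \sum_(k < N) expR (- `|z - y k|) <= 1 + C1.
  case: N => [|N]; first by rewrite big_ord0 addr_ge0.
  rewrite big_ord_recl; apply: lerD; last exact: hC1.
  by rewrite -[leRHS]expR0 ler_expR oppr_le0.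
have hsum : summable_polys h.
  move=> r r0; exists (M * expR (alpha * r ^+ 2 - kappa * r) * (1 + C1)) => N.
  rewrite (le_trans _ (ler_wpM2l _ (yC r N)))//; last first.
    by rewrite mulr_ge0 ?expR_ge0// (le_trans (E0 0%N)).
  rewrite mulr_sumr; apply: ler_sum => k _.
  rewrite (le_trans (majorant_mono _ r0 (_ : r <= expR r)))//.
    by rewrite (le_trans _ (expR_ge1Dx r))// lerDr.
  rewrite (le_trans (hB _ _ r0))// ler_pM ?mulr_ge0 ?expR_ge0//.
    by rewrite ler_wpM2r ?expR_ge0.
  by rewrite ler_expR lerN2 ler_peMl// ler1n.
exists h, E, y, M, (1 + C1); split; split => //.
(* As T >= 1, the point lies below [x (n + N)] for all n, so the partial sums at it are eventually
   constant. *)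
- move=> l Ll; pose N := (Num.truncn (tlog l)).+1.
  have lN n : tlog l < x (n + N)%N.
    have /andP[_ t] := truncn_itv (tlog_ge0 l).
    rewrite (lt_le_trans t)// -/N (@le_trans _ _ (n + N)%:R) ?ler_nat ?leq_addl//.
    by rewrite /x -[leLHS]add0r lerD// -[leLHS]mulr1 ler_wpM2l.
  have hc := cvgC_shift N.+1 (poly_series_cvg hsum l).
  apply: (cvgC_unique hc); suff -> : (fun n => \sum_(k < n + N.+1) (h k).[l]) = (fun=> v l).
    exact: cvgC_cst.
  apply/funext => n; rewrite addnS big_ord_recl /=.
  have -> : \sum_(i < n + N) (h (bump 0 i)).[l] = u l.
    rewrite -(newton_interpolates T1 G1 G0 S1 S2 u0 Ll (lN n)) newton_sum horner_sum.
    by apply: eq_bigr => i _.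
  by rewrite /u addrC subrK.
- by move=> k; rewrite E0 hM.
- by case=> [|k] //=; rewrite addr_ge0// mulr_ge0// (le_trans ler01).
move=> [B2 hB2].
have [Cs Cs0 hCs] := shell_sum L_shell.
have hu Z : in_set L Z -> \sum_(l <- Z) (cabs (u l) / W l) ^+ 2 <= 2 * B2 + 2 * (Cp ^+ 2 * Cs).
  move=> ZL; apply: (@le_trans _ _ (\sum_(l <- Z) (2 * (cabs (v l) / W l) ^+ 2 +
      2 * (Cp ^+ 2 * expR (- `|tlog l - 0|))))).
    apply: ler_sum => l _; have q0 : 0 <= cabs (u l) / W l by rewrite divr_ge0 ?cabs_ge0 ?expR_ge0.
    have := sqr_le_add q0 (_ : _ <= cabs (v l) / W l + Cp * expR (- (2 * `|tlog l - 0|))).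
    move=> /(_ _)/le_trans; apply.
      rewrite (le_trans (ler_wpM2r _ (cabsB _ _))) ?invr_ge0 ?expR_ge0// mulrDl lerD2l.
      exact: p0l.
    rewrite lerD2l ler_wpM2l// exprMn ler_wpM2l ?sqr_ge0// -expRM_natl ler_expR.
    have := normr_ge0 (tlog l - 0); move: (`|_|) => q; lra.
  by rewrite big_split/= -!mulr_sumr lerD// ler_wpM2l// ?hB2// ler_wpM2l ?sqr_ge0// hCs.
have hd := data_norm_l2 b_ge0 C0_ge0 L_count L00 T1 S1 S2 hu.
have hl := level_norm_l2 kappa01 b_ge0 C0_ge0 L_count C_ge0 L00 T1 G0 GB S1 S2 hT hd.
set B' := (X in summable_below _ X) in hl; exists (Cp ^+ 2 + (C * expR (2 * T)) ^+ 2 * B').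
have B'0 : 0 <= B' by have := hl 0%N; rewrite big_ord0.
case=> [|N]; first by rewrite big_ord0 addr_ge0 ?sqr_ge0// mulr_ge0// sqr_ge0.
rewrite big_ord_recl lerD2l /= (le_trans _ (ler_wpM2l (sqr_ge0 _) (hl N)))// mulr_sumr.
by apply: ler_sum => k _; rewrite exprMn.
Qed.

End InterpolatingSeries.

Section SufficiencyUniform.
Variables (R : realType) (alpha : R) (L : set R[i]) (delta b C0 : R) (K : nat).
Hypothesis alpha_gt0 : 0 < alpha.
Hypothesis delta_gt0 : 0 < delta.
Hypothesis L_separated : log_separated L delta.
Hypothesis L_shell : shell_bound L K.
Hypothesis b_ge0 : 0 <= b.
Hypothesis b_lt : b < 2 * alpha.
Hypothesis C0_ge0 : 0 <= C0.
Hypothesis L_count : count_bound L b C0.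

Lemma sufficiency_oo : interpolationoo (log_weight alpha) L.
Proof.
move=> v /ereal_sup_bound[B B0 hB].
have hv l : L l -> cabs (v l) <= B * weight alpha 0 l.
  by move=> /hB; rewrite expRN ler_pdivrMr ?expR_gt0// weight0E.
have k01 : 0 <= (0 : R) <= 1 by rewrite lexx ler01.
have [h [E [y [M [Cy [[hs hi hE hz] [hy _ _]]]]]]] := interpolating_series alpha_gt0 k01 delta_gt0
  L_separated L_shell b_ge0 b_lt C0_ge0 L_count B0 hv.
exists (fun z => sumC (fun k => (h k).[z])) => //.
have M0 : 0 <= M by have /andP[/le_trans] := hE 0%N; apply.
have Cy0 : 0 <= Cy by have := hy 0 0%N; rewrite big_ord0.
apply/fockooP; split; first exact: poly_series_entire.
exists (M * Cy) => [|z]; first exact: mulr_ge0.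
apply: (sumC_le (hz^~ z)) => N.
have W0 : 0 <= weight alpha 0 z by exact: expR_ge0.
rewrite mulrAC (le_trans _ (ler_wpM2l (mulr_ge0 M0 W0) (hy (tlog z) N)))// mulr_sumr.
apply: ler_sum => k _; have /andP[Ek EM] := hE k.
rewrite ler_pM ?mulr_ge0 ?expR_ge0// ?ler_wpM2r//.
by rewrite ler_expR lerN2 ler_peMl// ler1n.
Qed.

End SufficiencyUniform.

(** * Integration in the plane and the reproducing kernel *)

Section LineIntegrals.
Variable R : realType.
Local Notation mu := (@lebesgue_measure R).
Implicit Types (c x : R) (f : R -> \bar R).

Lemma lebesgue_measure_translation c (A : set R) : measurable A ->
  pushforward mu ((fun x => x + c) : _ -> measurableTypeR R) A = mu A.
Proof.
have mc : measurable_fun setT ((fun x => x + c) : measurableTypeR R -> measurableTypeR R).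
  by apply: measurable_funD => //; exact: measurable_cst.
move=> mA; apply/esym/lebesgue_measure_unique => //= _ [[a b]] _ <-.
rewrite /pushforward (_ : _ @^-1` _ = `]a - c, b - c]%classic).
  rewrite !lebesgue_measure_itv/= !lte_fin ltrD2r; case: ifP => // _.
  by rewrite -!EFinB; congr (_%:E); ring.
by apply/seteqP; split => x /=; rewrite !in_itv/= ltrBlDr lerBrDr.
Qed.

Lemma integral_translation c f : measurable_fun setT f -> (forall x, (0 <= f x)%E) ->
  (\int[mu]_x f (x + c)%R = \int[mu]_x f x)%E.
Proof.
move=> mf f0.
have mc : measurable_fun setT ((fun x => x + c) : measurableTypeR R -> measurableTypeR R).
  by apply: measurable_funD => //; exact: measurable_cst.
have := @ge0_integral_pushforward _ _ _ _ R _ mc mu setT f measurableT mf (fun y _ => f0 y).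
rewrite preimage_setT => <-.
by apply: eq_measure_integral => //= A mA _; exact: lebesgue_measure_translation.
Qed.

(** Its mass pi does not depend on the scale [a], which will make the bound on [radial_decay]
    uniform in [y]. *)
Definition cauchy_density (a : R) x := a / (a ^+ 2 + x ^+ 2).

Lemma continuous_cauchy_density a : 0 < a -> continuous (cauchy_density a).
Proof.
move=> a0 x; apply: cvgM; first exact: cvg_cst.
apply: cvgV; first by rewrite gt_eqF// ltr_pwDl ?exprn_gt0// sqr_ge0.
by apply: cvgD; [exact: cvg_cst|exact: exprn_continuous].
Qed.

Lemma cauchy_density_ge0 a x : 0 < a -> 0 <= cauchy_density a x.
Proof. by move=> a0; rewrite divr_ge0 ?(ltW a0)// addr_ge0 ?sqr_ge0. Qed.

Lemma integral_cauchy_density a : 0 < a -> (\int[mu]_x (cauchy_density a x)%:E = pi%:E)%E.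
Proof.
move=> a0; have ai0 : 0 < a^-1 by rewrite invr_gt0.
rewrite ge0_symfun_integralT; last 3 first.
- by move=> x; exact: cauchy_density_ge0.
- exact: continuous_cauchy_density.
- by move=> x; rewrite /cauchy_density /= sqrrN.
pose F x := atan (a^-1 * x).
have dF x : is_derive x 1 F (cauchy_density a x).
  have -> : cauchy_density a x = (1 + (a^-1 * x) ^+ 2)^-1 * (a^-1 *: 1).
    rewrite /cauchy_density /GRing.scale/= mulr1; field.
    by rewrite !gt_eqF// ltr_pwDl ?exprn_gt0 ?sqr_ge0// ltr_pwDl// sqr_ge0.
  exact: (@is_derive1_comp _ atan (a^-1 \*: id)).
have cF : continuous F.
  by move=> x; exact/differentiable_continuous/derivable1_diffP.
have -> : [set x : R | 0 <= x] = `[0, +oo[%classic.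
  by apply/seteqP; split => x; rewrite /= in_itv/= andbT.
rewrite (@ge0_continuous_FTC2y _ (cauchy_density a) F 0 (pi / 2)).
- by rewrite /F mulr0 atan0 -EFinB subr0 -EFinM mulrC divfK.
- by move=> x _; exact: cauchy_density_ge0.
- apply: continuous_subspaceT; exact: continuous_cauchy_density.
- apply: (@cvg_comp _ _ _ (fun x => a^-1 * x) atan); last exact: cvgy_atan.
  by apply: gt0_cvgMry => //; exact: cvg_id.
- by move=> x x0; exact: ex_derive.
- by apply: cvg_at_right_filter; exact: cF.
- by move=> x _; rewrite derive1E; exact: derive_val.
Qed.

End LineIntegrals.

(** * Rotation invariance of the plane measure *)

Section PlaneInvariance.
Variable R : realType.
Local Notation mu := (@lebesgue_measure R).
Local Notation mu2 := (plane_measure R).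
Implicit Types (f : R * R -> \bar R) (c : R) (u z : R[i]) (p : R * R).

Definition shear_fst c p : R * R := (p.1 + c * p.2, p.2).
Definition shear_snd c p : R * R := (p.1, p.2 + c * p.1).

Lemma measurable_shear_fst c : measurable_fun [set: R * R] (shear_fst c).
Proof.
apply/measurable_fun_pairP; split => /=; last exact: measurable_snd.
by apply: measurable_funD; [exact: measurable_fst|apply: measurable_funM => //; exact: measurable_snd].
Qed.

Lemma measurable_shear_snd c : measurable_fun [set: R * R] (shear_snd c).
Proof.
apply/measurable_fun_pairP; split => /=; first exact: measurable_fst.
by apply: measurable_funD; [exact: measurable_snd|apply: measurable_funM => //; exact: measurable_fst].
Qed.

Lemma integral_shear_fst c f : measurable_fun [set: R * R] f -> (forall p, (0 <= f p)%E) ->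
  (\int[mu2]_p f (shear_fst c p) = \int[mu2]_p f p)%E.
Proof.
move=> mf f0; have mfs := measurableT_comp mf (measurable_shear_fst c).
transitivity (\int[mu]_y \int[mu]_x f (shear_fst c (x, y)))%E.
  exact: (fubini_tonelli2 (m1 := mu) (m2 := mu) (f \o shear_fst c) mfs (fun=> f0 _)).
transitivity (\int[mu]_y \int[mu]_x f (x, y))%E; last first.
  by apply/esym; exact: (fubini_tonelli2 (m1 := mu) (m2 := mu) f).
apply: eq_integral => y _; apply: (@integral_translation _ (c * y) (fun x => f (x, y))) => //.
exact: measurableT_comp.
Qed.

Lemma integral_shear_snd c f : measurable_fun [set: R * R] f -> (forall p, (0 <= f p)%E) ->
  (\int[mu2]_p f (shear_snd c p) = \int[mu2]_p f p)%E.
Proof.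
move=> mf f0; have mfs := measurableT_comp mf (measurable_shear_snd c).
transitivity (\int[mu]_x \int[mu]_y f (shear_snd c (x, y)))%E.
  exact: (fubini_tonelli1 (m1 := mu) (m2 := mu) (f \o shear_snd c) mfs (fun=> f0 _)).
transitivity (\int[mu]_x \int[mu]_y f (x, y))%E; last first.
  by apply/esym; exact: (fubini_tonelli1 (m1 := mu) (m2 := mu) f).
apply: eq_integral => x _; apply: (@integral_translation _ (c * x) (fun y => f (x, y))) => //.
exact: measurableT_comp.
Qed.

Definition rotate u p : R * R :=
  (complex.Re u * p.1 - complex.Im u * p.2, complex.Im u * p.1 + complex.Re u * p.2).

Lemma toC_rotate u p : toC (rotate u p) = u * toC p.
Proof. by case: u => a b; case: p => x y; rewrite /toC /rotate /=; congr (_ +i* _)%C; ring. Qed.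

Lemma rotateM u z p : rotate u (rotate z p) = rotate (u * z) p.
Proof. by case: u => a b; case: z => c d; case: p => x y; congr pair => /=; ring. Qed.

Lemma measurable_rotate u : measurable_fun [set: R * R] (rotate u).
Proof.
have h1 c : measurable_fun setT (fun p : R * R => c * p.1).
  by apply: measurable_funM => //; exact: measurable_fst.
have h2 c : measurable_fun setT (fun p : R * R => c * p.2).
  by apply: measurable_funM => //; exact: measurable_snd.
by apply/measurable_fun_pairP; split => /=; [exact: measurable_funB|exact: measurable_funD].
Qed.

(* A rotation by [u <> -1] is a product of three shears, which preserve the
   measure by Tonelli and translation invariance. *)
Lemma ge0_integral_rotate u f : cabs u = 1 -> measurable_fun [set: R * R] f -> (forall p, (0 <= f p)%E) ->
  (\int[mu2]_p f (rotate u p) = \int[mu2]_p f p)%E.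
Proof.
have gen v g : cabs v = 1 -> complex.Re v != -1 -> measurable_fun setT g -> (forall p, (0 <= g p)%E) ->
    (\int[mu2]_p g (rotate v p) = \int[mu2]_p g p)%E.
  case: v => a b v1 /= a1 mg g0.
  have ab : b ^+ 2 = (1 + a) * (1 - a).
    by have := cabs_sqr (a +i* b)%C; rewrite v1 expr1n /= => h; move: h; lra.
  have a1' : 1 + a != 0 by rewrite addrC addr_eq0.
  (* For the rotation by theta this is tan(theta / 2); the three shears have parameters - t, sin
     theta and - t. *)
  pose t := b / (1 + a).
  have -> : (fun p => g (rotate (a +i* b)%C p)) =
      (fun p => (g \o shear_fst (- t) \o shear_snd b) (shear_fst (- t) p)).
    apply/funext => -[x y]; rewrite /= /shear_fst /shear_snd /rotate /=; congr (g (_, _)).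
      rewrite -/t; have -> : a * x - b * y = x - t * y - t * (y + b * (x - t * y)).
        have e1 : t * (1 + a) = b by rewrite /t divfK.
        have e2 : t * b = 1 - a by rewrite /t mulrAC -expr2 ab mulrAC mulfV// mul1r.
        have e3 : 2 - t * b = 1 + a by rewrite e2; ring.
        transitivity ((1 - t * b) * x - t * (2 - t * b) * y); last by ring.
        by rewrite e3 e1 e2; ring.
      by rewrite !mulNr.
    have e2 : t * b = 1 - a by rewrite /t mulrAC -expr2 ab mulrAC mulfV// mul1r.
    have -> : a = 1 - t * b by rewrite e2; ring.
    ring.
  have m1 : measurable_fun [set: R * R] (g \o shear_fst (- t)) :=
    measurableT_comp mg (measurable_shear_fst _).
  have m2 := measurableT_comp m1 (measurable_shear_snd b).
  transitivity (\int[mu2]_p (g \o shear_fst (- t) \o shear_snd b) p)%E.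
    exact: (integral_shear_fst _ m2 (fun=> g0 _)).
  transitivity (\int[mu2]_p (g \o shear_fst (- t)) p)%E.
    exact: (integral_shear_snd _ m1 (fun=> g0 _)).
  exact: integral_shear_fst.
move=> u1 mf f0; have [a1|a1] := eqVneq (complex.Re u) (-1); last exact: gen.
pose j : R[i] := (0 +i* 1)%C.
have i1 : cabs j = 1 :> R by rewrite /cabs /= expr0n expr1n add0r sqrtr1.
have r1 : complex.Re j != -1 by rewrite /= eq_sym oppr_eq0 oner_eq0.
(* The excluded rotation -1 is the square of multiplication by i. *)
have uE : u = j * j.
  case: u u1 a1 => a b u1 /= a1; have := cabs_sqr (a +i* b)%C.
  rewrite u1 /= a1 sqrrN !expr1n => b1.
  have b0 : b = 0 by apply/eqP; rewrite -sqrf_eq0; apply/eqP; move: b1; lra.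
  by rewrite b0; congr (_ +i* _)%C; ring.
transitivity (\int[mu2]_p (f \o rotate j) (rotate j p))%E.
  by apply: eq_integral => p _; rewrite /= rotateM -uE.
transitivity (\int[mu2]_p (f \o rotate j) p)%E; last exact: gen.
exact: (gen j _ i1 r1 (measurableT_comp mf (measurable_rotate j)) (fun=> f0 _)).
Qed.

Lemma integral_rotate u f : cabs u = 1 -> measurable_fun [set: R * R] f ->
  (\int[mu2]_p f (rotate u p) = \int[mu2]_p f p)%E.
Proof.
move=> u1 mf; rewrite integralE [RHS]integralE; congr (_ - _)%E.
  transitivity (\int[mu2]_p f^\+ (rotate u p))%E.
    by apply: eq_integral => p _; rewrite unlock.
  exact: (ge0_integral_rotate u1 (measurable_funepos mf) (funepos_ge0 f)).
transitivity (\int[mu2]_p f^\- (rotate u p))%E.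
  by apply: eq_integral => p _; rewrite unlock.
exact: (ge0_integral_rotate u1 (measurable_funeneg mf) (funeneg_ge0 f)).
Qed.

End PlaneInvariance.

(** * Integrals of radial bumps *)

Section WeightedIntegrals.
Variable R : realType.
Local Notation mu := (@lebesgue_measure R).
Local Notation mu2 := (plane_measure R).
Implicit Types (p : R * R) (y : R).

Lemma measurable_cabs : measurable_fun [set: R * R] (fun p => cabs (toC p)).
Proof.
apply: (measurableT_comp (f := @Num.sqrt R)); first exact: continuous_measurable_fun (@sqrt_continuous R).
by apply: measurable_funD; apply: measurable_funX; [exact: measurable_fst|exact: measurable_snd].
Qed.

Lemma measurable_tlog : measurable_fun [set: R * R] (fun p => tlog (toC p)).
Proof.
apply: measurable_maxr; last exact: measurable_cst.
by apply: (measurableT_comp (f := @ln R)) => //; exact: measurable_cabs.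
Qed.

(** A bump at logarithmic radius [y]; exp(- 2 t) compensates the area e^(2 t) dt of annuli, so that
    the integral stays bounded as [y] varies. *)
Definition radial_decay y p := expR (- (2 * `|tlog (toC p) - y|) - 2 * tlog (toC p)).

Lemma measurable_radial_decay y : measurable_fun [set: R * R] (radial_decay y).
Proof.
apply: measurableT_comp; first exact: measurable_expR.
apply: measurable_funB; last by apply: measurable_funM => //; exact: measurable_tlog.
apply: measurable_funN; apply: measurable_funM => //.
apply: (measurableT_comp (f := @Num.norm R R)); first exact: continuous_measurable_fun (@norm_continuous R R).
by apply: measurable_funB => //; exact: measurable_tlog.
Qed.

(* A majorant of product form, integrable by Tonelli, instead of polar
   coordinates. *)
Lemma radial_decay_le y p : 0 <= y ->
  radial_decay y p <= 4 * (cauchy_density (expR y) p.1 * cauchy_density (expR y) p.2).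
Proof.
move=> y0; set t := tlog (toC p); pose m := expR (2 * Num.max t y).
have m0 : 0 < m by exact: expR_gt0.
have am : expR y ^+ 2 <= m by rewrite -expRM_natl ler_expR ler_pM2l// le_max lexx orbT.
have xm : p.1 ^+ 2 + p.2 ^+ 2 <= m.
  have -> : p.1 ^+ 2 + p.2 ^+ 2 = cabs (toC p) ^+ 2 by rewrite cabs_sqr.
  rewrite (@le_trans _ _ (expR t ^+ 2))//.
    by rewrite lerXn2r ?nnegrE ?cabs_ge0 ?expR_ge0// cabs_le_tlog.
  by rewrite -expRM_natl ler_expR ler_pM2l// le_max lexx.
have e0 : 0 < expR y ^+ 2 by rewrite exprn_gt0// expR_gt0.
(* Indeed - 2 |t - y| - 2 t = 2 y - 4 max(t, y). *)
have -> : radial_decay y p = expR y ^+ 2 / m ^+ 2.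
  rewrite -!expRM_natl -expRN -expRD /radial_decay -/t; congr expR; rewrite /m.
  by have [h|h] := leP t y; [rewrite ler0_norm ?subr_le0//|rewrite gtr0_norm ?subr_gt0//]; ring.
have h x : x ^+ 2 <= m -> expR y / (2 * m) <= cauchy_density (expR y) x.
  move=> xm'; rewrite ler_wpM2l ?expR_ge0// lef_pV2 ?posrE ?mulr_gt0// ?ltr_pwDl ?sqr_ge0//.
  by rewrite mulr_natl mulr2n lerD.
have h1 := h p.1 (le_trans _ xm); have h2 := h p.2 (le_trans _ xm).
apply: (@le_trans _ _ (4 * (expR y / (2 * m) * (expR y / (2 * m))))).
  by rewrite le_eqVlt; apply/orP; left; apply/eqP; field; rewrite gt_eqF.
rewrite ler_wpM2l// ler_pM ?divr_ge0 ?expR_ge0 ?mulr_ge0 ?(ltW m0)//.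
  by apply: h1; rewrite lerDl sqr_ge0.
by apply: h2; rewrite lerDr sqr_ge0.
Qed.

Lemma integral_radial_decay : exists2 C : R, 0 <= C & forall y, 0 <= y ->
  (\int[mu2]_p (radial_decay y p)%:E <= C%:E)%E.
Proof.
exists (4 * (pi * pi)) => [|y y0]; first by rewrite !mulr_ge0// pi_ge0.
have a0 : 0 < expR y := expR_gt0 y.
have md := continuous_measurable_fun (continuous_cauchy_density a0).
pose k p := (4 * (cauchy_density (expR y) p.1 * cauchy_density (expR y) p.2))%:E.
have mk : measurable_fun [set: R * R] k.
  apply/measurable_EFinP; apply: measurable_funM => //; apply: measurable_funM.
    exact: (measurableT_comp md (@measurable_fst _ _ R R)).
  exact: (measurableT_comp md (@measurable_snd _ _ R R)).
have d0 x : 0 <= cauchy_density (expR y) x by exact: cauchy_density_ge0.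
have k0 p : (0 <= k p)%E by rewrite lee_fin; exact: mulr_ge0 (mulr_ge0 (d0 _) (d0 _)).
apply: (@le_trans _ _ (\int[mu2]_p k p)%E).
  apply: ge0_le_integral => //.
  - by move=> p _; rewrite lee_fin expR_ge0.
  - by apply/measurable_EFinP; exact: measurable_radial_decay.
  - by move=> p _; rewrite lee_fin radial_decay_le.
have -> : (\int[mu2]_p k p = \int[mu]_x \int[mu]_y k (x, y))%E.
  exact: (fubini_tonelli1 (m1 := mu) (m2 := mu) k mk k0).
have inner x : (\int[mu]_y k (x, y) = (4 * pi)%:E * (cauchy_density (expR y) x)%:E)%E.
  rewrite /k /=; under eq_integral do rewrite mulrA EFinM.
  rewrite ge0_integralZl//; last 3 first.
  - by apply/measurable_EFinP.
  - by move=> z _; rewrite lee_fin.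
  - by rewrite lee_fin; exact: mulr_ge0 (d0 _).
  by rewrite integral_cauchy_density// -!EFinM; congr (_%:E); ring.
under eq_integral do rewrite inner.
rewrite ge0_integralZl//; last 3 first.
- by apply/measurable_EFinP.
- by move=> z _; rewrite lee_fin.
- by rewrite lee_fin mulr_ge0// pi_ge0.
by rewrite integral_cauchy_density// -!EFinM lee_fin mulrA.
Qed.

End WeightedIntegrals.

(** * Measurability and dominated convergence for complex functions *)

Section ComplexMeasurable.
Variable R : realType.
Implicit Types (f g : R[i] -> R[i]) (z w u : R[i]) (p : R * R).
Local Notation mu2 := (plane_measure R).

Definition measC g := measurable_fun [set: R * R] (fun p => complex.Re (g (toC p))) /\
  measurable_fun [set: R * R] (fun p => complex.Im (g (toC p))).

Lemma measC_cst z : measC (fun=> z).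
Proof. by split; exact: measurable_cst. Qed.

Lemma measC_id : measC (fun z => z).
Proof. by split; [exact: measurable_fst|exact: measurable_snd]. Qed.

Lemma measCD f g : measC f -> measC g -> measC (fun z => f z + g z).
Proof.
move=> [f1 f2] [g1 g2]; split.
  rewrite (_ : (fun p => _) = (fun p => complex.Re (f (toC p)) + complex.Re (g (toC p)))).
    exact: measurable_funD.
  by apply/funext => p; case: (f _) => a b; case: (g _).
rewrite (_ : (fun p => _) = (fun p => complex.Im (f (toC p)) + complex.Im (g (toC p)))).
  exact: measurable_funD.
by apply/funext => p; case: (f _) => a b; case: (g _).
Qed.

Lemma measCM f g : measC f -> measC g -> measC (fun z => f z * g z).
Proof.
move=> [f1 f2] [g1 g2]; split.
  rewrite (_ : (fun p => _) = (fun p => complex.Re (f (toC p)) * complex.Re (g (toC p)) -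
      complex.Im (f (toC p)) * complex.Im (g (toC p)))).
    by apply: measurable_funB; exact: measurable_funM.
  by apply/funext => p; case: (f _) => a b; case: (g _).
rewrite (_ : (fun p => _) = (fun p => complex.Re (f (toC p)) * complex.Im (g (toC p)) +
    complex.Im (f (toC p)) * complex.Re (g (toC p)))).
  by apply: measurable_funD; exact: measurable_funM.
by apply/funext => p; case: (f _) => a b; case: (g _).
Qed.

Lemma measC_conj g : measC g -> measC (fun z => (g z)^*%C).
Proof.
move=> [g1 g2]; split.
  by rewrite (_ : (fun p => _) = (fun p => complex.Re (g (toC p))))//; apply/funext => p; case: (g _).
rewrite (_ : (fun p => _) = (fun p => - complex.Im (g (toC p)))).
  exact: measurable_funN.
by apply/funext => p; case: (g _).
Qed.

Lemma measC_real (h : R[i] -> R) : measurable_fun [set: R * R] (fun p => h (toC p)) ->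
  measC (fun z => (h z)%:C%C).
Proof. by move=> mh; split => //=; exact: measurable_cst. Qed.

Lemma measCX f n : measC f -> measC (fun z => f z ^+ n).
Proof.
move=> mf; elim: n => [|n IH].
  by rewrite (_ : (fun z => _) = (fun=> 1)); [exact: measC_cst|apply/funext => z; rewrite expr0].
rewrite (_ : (fun z => _) = (fun z => f z * f z ^+ n)); first exact: measCM.
by apply/funext => z; rewrite exprS.
Qed.

Lemma measC_sum (h : nat -> R[i] -> R[i]) n : (forall k, measC (h k)) ->
  measC (fun z => \sum_(k < n) h k z).
Proof.
move=> mh; elim: n => [|n IH].
  by rewrite (_ : (fun z => _) = (fun=> 0)); [exact: measC_cst|apply/funext => z; rewrite big_ord0].
rewrite (_ : (fun z => _) = (fun z => \sum_(k < n) h k z + h n z)); first exact: measCD.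
by apply/funext => z; rewrite big_ord_recr.
Qed.

Lemma measC_cabs g : measC g -> measurable_fun [set: R * R] (fun p => cabs (g (toC p))).
Proof.
move=> [g1 g2].
rewrite (_ : (fun p => _) = (fun p => Num.sqrt (complex.Re (g (toC p)) ^+ 2 + complex.Im (g (toC p)) ^+ 2))).
  apply: (measurableT_comp (f := @Num.sqrt R)); first exact: continuous_measurable_fun (@sqrt_continuous R).
  by apply: measurable_funD; exact: measurable_funX.
by apply/funext => p; case: (g _).
Qed.

Lemma cvgC_ReIm (v : nat -> R[i]) z : cvgC v z ->
  (fun n => complex.Re (v n)) @ \oo --> complex.Re z /\ (fun n => complex.Im (v n)) @ \oo --> complex.Im z.
Proof.
move=> vz; split; apply/cvgrPdist_le => e e0; have [N hN] := vz e e0; exists N => // n Nn;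
  rewrite (le_trans _ (hN n Nn))// distrC.
  by rewrite (_ : _ - _ = complex.Re (v n - z)) ?Re_le_cabs//; case: (v n) => a b; case: (z).
by rewrite (_ : _ - _ = complex.Im (v n - z)) ?Im_le_cabs//; case: (v n) => a b; case: (z).
Qed.

Lemma ReIm_cvgC (v : nat -> R[i]) z : (fun n => complex.Re (v n)) @ \oo --> complex.Re z ->
  (fun n => complex.Im (v n)) @ \oo --> complex.Im z -> cvgC v z.
Proof.
move=> h1 h2 e e0; have e2 : 0 < e / 2 by rewrite divr_gt0.
move/cvgrPdist_le : h1 => /(_ _ e2)[N1 _ hN1]; move/cvgrPdist_le : h2 => /(_ _ e2)[N2 _ hN2].
exists (maxn N1 N2) => n; rewrite geq_max => /andP[n1 n2].
rewrite cabs_distC (le_trans (cabs_le_ReIm _))// (splitr e) lerD//.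
  rewrite (_ : complex.Re _ = complex.Re z - complex.Re (v n)); first exact: hN1.
  by case: (v n) => a b; case: (z).
rewrite (_ : complex.Im _ = complex.Im z - complex.Im (v n)); first exact: hN2.
by case: (v n) => a b; case: (z).
Qed.

Lemma cvgC_cabs (v : nat -> R[i]) z : cvgC v z -> (fun n => cabs (v n)) @ \oo --> cabs z.
Proof.
move=> vz; apply/cvgrPdist_le => e e0; have [N hN] := vz e e0; exists N => // n Nn.
rewrite (le_trans _ (hN n Nn))// ler_norml.
have h1 := cabs_lb (v n) z; have h2 := cabs_lb z (v n); rewrite cabs_distC in h2.
by apply/andP; split; lra.
Qed.

Lemma measC_cvg (h : nat -> R[i] -> R[i]) g : (forall n, measC (h n)) ->
  (forall z, cvgC (h^~ z) (g z)) -> measC g.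
Proof.
move=> mh hg; split.
  apply: (measurable_fun_cvg (h := fun n p => complex.Re (h n (toC p)))) => [n|p _]; first exact: (mh n).1.
  exact: (cvgC_ReIm (hg (toC p))).1.
apply: (measurable_fun_cvg (h := fun n p => complex.Im (h n (toC p)))) => [n|p _]; first exact: (mh n).2.
exact: (cvgC_ReIm (hg (toC p))).2.
Qed.

Lemma measC_expands a f : expands a f -> measC f.
Proof.
move=> [_ af]; apply: (@measC_cvg (fun n z => \sum_(k < n) a k * z ^+ k)) => // n.
by apply: (@measC_sum (fun k z => a k * z ^+ k)) => k; apply: measCM; [exact: measC_cst|exact: measCX measC_id].
Qed.

Lemma measC_rotate g u : measC g -> measC (fun z => g (u * z)).
Proof.
move=> [g1 g2]; split.
  rewrite (_ : (fun p => _) = (fun p => complex.Re (g (toC p))) \o rotate u).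
    by apply: measurableT_comp => //; exact: measurable_rotate.
  by apply/funext => p /=; rewrite toC_rotate.
rewrite (_ : (fun p => _) = (fun p => complex.Im (g (toC p))) \o rotate u).
  by apply: measurableT_comp => //; exact: measurable_rotate.
by apply/funext => p /=; rewrite toC_rotate.
Qed.

Lemma integralC_rotate g u : cabs u = 1 -> measC g ->
  integralC (fun z => g (u * z)) = integralC g.
Proof.
move=> u1 [g1 g2]; rewrite /integralC; congr (_ +i* _)%C; rewrite /Rintegral.
  rewrite -[in RHS](@integral_rotate _ u)//; last exact/measurable_EFinP.
  by congr fine; apply: eq_integral => p _; rewrite toC_rotate.
rewrite -[in RHS](@integral_rotate _ u)//; last exact/measurable_EFinP.
by congr fine; apply: eq_integral => p _; rewrite toC_rotate.
Qed.

(** The case y = 0 of [radial_decay], whose multiples serve as integrable majorants for complex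
    integrals. *)
Definition decay4 z : R := expR (- (4 * tlog z)).

Lemma integrable_decay4 : mu2.-integrable setT (fun p => (decay4 (toC p))%:E).
Proof.
have E p : decay4 (toC p) = radial_decay 0 p.
  rewrite /decay4 /radial_decay subr0 ger0_norm ?tlog_ge0//; congr expR; ring.
apply/integrableP; split.
  by under eq_fun do rewrite E; apply/measurable_EFinP; exact: measurable_radial_decay.
have [C C0 hC] := integral_radial_decay R.
apply: le_lt_trans (ltry C); apply: le_trans (hC 0 (lexx _)).
rewrite le_eqVlt; apply/orP; left; apply/eqP; apply: eq_integral => p _.
by rewrite E gee0_abs// lee_fin expR_ge0.
Qed.

Definition decays g (K : R) := measC g /\ forall z, cabs (g z) <= K * decay4 z.

Lemma decays_integrable g K : decays g K ->
  mu2.-integrable setT (EFin \o (fun p => complex.Re (g (toC p)))) /\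
  mu2.-integrable setT (EFin \o (fun p => complex.Im (g (toC p)))).
Proof.
move=> [[g1 g2] gK].
have iK : mu2.-integrable setT (fun p => (K * decay4 (toC p))%:E).
  under eq_fun do rewrite EFinM; exact: integrableZl integrable_decay4.
split; apply: (le_integrable measurableT _ _ iK); try exact/measurable_EFinP.
  move=> p _; rewrite /= lee_fin (le_trans (Re_le_cabs _))// (le_trans (gK _))// ler_norm//.
by move=> p _; rewrite /= lee_fin (le_trans (Im_le_cabs _))// (le_trans (gK _))// ler_norm//.
Qed.

Lemma integralCD f g K M : decays f K -> decays g M ->
  integralC (fun z => f z + g z) = integralC f + integralC g.
Proof.
move=> /decays_integrable[f1 f2] /decays_integrable[g1 g2].
rewrite /integralC; apply/eqP; rewrite eq_complex /= -!RintegralD//; apply/andP; split; apply/eqP.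
  by apply: eq_Rintegral => p _; case: (f _) => a b; case: (g _).
by apply: eq_Rintegral => p _; case: (f _) => a b; case: (g _).
Qed.

Lemma integralCZ f z K : decays f K -> integralC (fun w => z * f w) = z * integralC f.
Proof.
move=> /decays_integrable[f1 f2]; case: z => a b.
have iZ c h : mu2.-integrable setT (EFin \o h) -> mu2.-integrable setT (EFin \o (fun p => c * h p)).
  by move=> ih; rewrite (_ : _ \o _ = (fun p => c%:E * (h p)%:E)%E)//; exact: integrableZl.
rewrite /integralC; apply/eqP; rewrite eq_complex /= -!RintegralZl//.
rewrite -RintegralB ?iZ// -RintegralD ?iZ//; apply/andP; split; apply/eqP.
  by apply: eq_Rintegral => p _; case: (f _).
by apply: eq_Rintegral => p _; case: (f _).
Qed.

Lemma integralC_cvg (h : nat -> R[i] -> R[i]) g K : (forall n, decays (h n) K) ->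
  (forall z, cvgC (h^~ z) (g z)) -> decays g K /\ cvgC (fun n => integralC (h n)) (integralC g).
Proof.
move=> hK hg; have dg : decays g K.
  split; first exact: measC_cvg (fun n => (hK n).1) hg.
  by move=> z; apply: (@cvgC_le _ _ _ _ 0%N (hg z)) => n _; exact: (hK n).2.
split => //.
have iK : mu2.-integrable setT (fun p => (K * decay4 (toC p))%:E).
  under eq_fun do rewrite EFinM; exact: integrableZl integrable_decay4.
have key (r : R[i] -> R) : (forall n, measurable_fun [set: R * R] (fun p => r (h n (toC p)))) ->
   measurable_fun [set: R * R] (fun p => r (g (toC p))) -> (forall z, `|r z| <= cabs z) ->
   (forall v z, cvgC v z -> (fun n => r (v n)) @ \oo --> r z) ->
   (fun n => Rintegral mu2 setT (fun p => r (h n (toC p)))) @ \oo --> Rintegral mu2 setT (fun p => r (g (toC p))).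
  move=> mh mg rle rcvg; rewrite /Rintegral.
  have [] := @dominated_convergence _ _ R mu2 setT measurableT
    (fun n p => (r (h n (toC p)))%:E) (fun p => (r (g (toC p)))%:E) (fun p => (K * decay4 (toC p))%:E).
  - by move=> n; apply/measurable_EFinP; exact: mh.
  - by apply/measurable_EFinP; exact: mg.
  - by apply/aeW => p _; apply: cvg_EFin; [exact: nearW|exact: rcvg].
  - exact: iK.
  - by apply/aeW => p n _; rewrite lee_fin (le_trans (rle _))// (hK n).2.
  move=> ig _ hc; apply: (@fine_cvg _ _ _ _ (fun n => _) (fine _)).
  rewrite fineK//; exact: integrable_fin_num.
apply: ReIm_cvgC.
  apply: (key (@complex.Re R)) => [n|||]; [exact: (hK n).1.1|exact: dg.1.1|exact: Re_le_cabs|].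
  by move=> v z /cvgC_ReIm[].
apply: (key (@complex.Im R)) => [n|||]; [exact: (hK n).1.2|exact: dg.1.2|exact: Im_le_cabs|].
by move=> v z /cvgC_ReIm[].
Qed.

End ComplexMeasurable.

(** * Norms and orthogonality of monomials *)

Section GaussianMoments.
Variables (R : realType) (alpha : R).
Hypothesis alpha_gt0 : 0 < alpha.
Implicit Types (z w u : R[i]) (p : R * R).
Local Notation mu := (@lebesgue_measure R).
Local Notation mu2 := (plane_measure R).

Definition gauss z : R := expR (- (2 * log_weight alpha z)).

Lemma gaussE z : gauss z = expR (- (2 * (alpha * tlog z ^+ 2))).
Proof. by []. Qed.

Lemma measurable_gauss : measurable_fun [set: R * R] (fun p => gauss (toC p)).
Proof.
apply: measurableT_comp; first exact: measurable_expR.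
apply: measurable_funN; apply: measurable_funM => //; apply: measurable_funM => //.
by apply: measurable_funX; exact: measurable_tlog.
Qed.

Lemma monomial_gauss_decay m z : cabs z ^+ m * gauss z <=
  expR ((m%:R + 4) ^+ 2 / (8 * alpha)) * decay4 z.
Proof.
rewrite gaussE (le_trans (ler_wpM2r (expR_ge0 _) (cabsX_le_tlog z m)))//.
rewrite /decay4 -!expRD ler_expR; move: (tlog z) => t.
have : 0 <= (4 * alpha * t - (m%:R + 4)) ^+ 2 / (8 * alpha) by rewrite divr_ge0 ?sqr_ge0// mulr_ge0// ltW.
have -> : (4 * alpha * t - (m%:R + 4)) ^+ 2 / (8 * alpha) =
    2 * (alpha * t ^+ 2) - (m%:R + 4) * t + (m%:R + 4) ^+ 2 / (8 * alpha).
  by field; rewrite gt_eqF.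
by lra.
Qed.

Lemma mul_conj z : z * (z^*)%C = (cabs z ^+ 2)%:C%C.
Proof.
rewrite cabs_sqr; case: z => a b; apply/eqP; rewrite eq_complex /=.
by apply/andP; split; apply/eqP; ring.
Qed.

Lemma cabs_gauss z : cabs (gauss z)%:C%C = gauss z.
Proof. by rewrite cabsR ger0_norm// expR_ge0. Qed.

Lemma measC_gauss : measC (fun z => (gauss z)%:C%C).
Proof. by apply: measC_real; exact: measurable_gauss. Qed.

Lemma conjX z n : ((z ^+ n)^*)%C = (z^*)%C ^+ n.
Proof. exact: rmorphXn. Qed.

Definition monomial_pair m n z := z ^+ m * ((z ^+ n)^*)%C * (gauss z)%:C%C.

Lemma monomial_pair_decays m n : decays (monomial_pair m n) (expR (((m + n)%:R + 4) ^+ 2 / (8 * alpha))).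
Proof.
split.
  apply: measCM; last exact: measC_gauss.
  apply: measCM; last apply: measC_conj; apply: measCX; exact: measC_id.
move=> z; rewrite /monomial_pair !cabsM cabs_conj !cabsX cabs_gauss -exprD.
exact: monomial_gauss_decay.
Qed.

Lemma gauss_rotate u z : cabs u = 1 -> gauss (u * z) = gauss z.
Proof. by move=> u1; rewrite /gauss /log_weight cabsM u1 mul1r. Qed.

Definition moment n : R := Rintegral mu2 setT (fun p => cabs (toC p) ^+ (2 * n) * gauss (toC p)).

Lemma monomial_pair_diag n z : monomial_pair n n z = (cabs z ^+ (2 * n) * gauss z)%:C%C.
Proof.
by rewrite /monomial_pair conjX -exprMn mul_conj exprM [RHS]rmorphM [X in _ = X * _]rmorphXn.
Qed.

(** A rotation by u multiplies the integral by u^m / u^n, which differs from 1 for m <> n when u is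
    a primitive root of unity of order 2^(m + n). *)
Lemma integralC_monomials m n :
  integralC (monomial_pair m n) = if m == n then (moment n)%:C%C else 0.
Proof.
have [->|mn] := eqVneq m n.
  rewrite /integralC; congr (_ +i* _)%C.
    by apply: eq_Rintegral => p _; rewrite monomial_pair_diag.
  rewrite -[RHS](mul0r (fine (mu2 setT))) -Rintegral_cst//.
  by apply: eq_Rintegral => p _; rewrite monomial_pair_diag.
set I := integralC _; pose u := unit_root R (m + n).
have u1 : cabs u = 1 := cabs_circle _; have u0 : u != 0 := circle_neq0 _.
have uc : (u^*)%C = u^-1.
  by apply: (mulfI u0); rewrite mul_conj u1 expr1n mulfV.
have small k : (k <= m + n)%N -> (0 < k)%N -> u ^+ k != 1.
  by move=> kmn k0; apply: unit_root_exp_neq1; rewrite k0 (leq_ltn_trans kmn)// ltn_expl.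
have c1 : u ^+ m / u ^+ n != 1.
  move: mn; rewrite neq_ltn => /orP[mn|nm].
    rewrite -(subnK (ltnW mn)) exprD invfM mulrCA mulfV ?expf_neq0// mulr1 invr_eq1.
    by rewrite small ?subn_gt0// (leq_trans (leq_subr _ _)) ?leq_addl.
  rewrite -(subnK (ltnW nm)) exprD mulfK ?expf_neq0//.
  by rewrite small ?subn_gt0// (leq_trans (leq_subr _ _)) ?leq_addr.
have : u ^+ m / u ^+ n * I = I.
  rewrite /I -(integralCZ _ (monomial_pair_decays m n)).
  rewrite -[RHS](integralC_rotate u1); last exact: (monomial_pair_decays m n).1.
  congr integralC; apply/funext => z.
  have cM : ((u * z)^*)%C = u^-1 * (z^*)%C by rewrite -uc; exact: rmorphM.
  by rewrite /monomial_pair gauss_rotate// !conjX cM !exprMn exprVn; ring.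
move/eqP; rewrite -subr_eq0 -{2}[I]mul1r -mulrBl mulf_eq0 subr_eq0 (negPf c1) /=.
by move/eqP.
Qed.

Lemma moment_EFin n : (\int[mu2]_p (cabs (toC p) ^+ (2 * n) * gauss (toC p))%:E = (moment n)%:E)%E.
Proof.
rewrite /moment /Rintegral fineK//; apply: integrable_fin_num => //.
have [h _] := decays_integrable (monomial_pair_decays n n).
rewrite (_ : (fun p => _) = EFin \o (fun p => complex.Re (monomial_pair n n (toC p))))//.
by apply/funext => p; rewrite /= monomial_pair_diag.
Qed.

(** With the area factor e^(2 t), the integrand in t is a Gaussian peaked at y = (n + 1) / (2
    alpha); it is dominated by a multiple of the bump [radial_decay y]. *)
Lemma moment_upper : exists2 C : R, 0 < C &
  forall n, moment n <= C * expR ((n%:R + 1) ^+ 2 / (2 * alpha)).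
Proof.
have [C C0 hC] := integral_radial_decay R.
exists ((C + 1) * expR (1 / (2 * alpha))) => [|n]; first by rewrite mulr_gt0 ?expR_gt0// ltr_pwDr.
pose y := (n%:R + 1) / (2 * alpha).
have y0 : 0 <= y by rewrite divr_ge0// ?addr_ge0// mulr_ge0// ltW.
set B := expR (1 / (2 * alpha)) * expR ((n%:R + 1) ^+ 2 / (2 * alpha)).
rewrite -mulrA -/B -lee_fin -moment_EFin; apply: (@le_trans _ _ (B%:E * C%:E)%E); last first.
  by rewrite -EFinM lee_fin mulrC ler_wpM2r ?mulr_ge0 ?expR_ge0// lerDl.
apply: le_trans (lee_wpmul2l _ (hC y y0)); last by rewrite lee_fin mulr_ge0 ?expR_ge0.
rewrite -ge0_integralZl//; last 3 first.
- by apply/measurable_EFinP; exact: measurable_radial_decay.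
- by move=> p _; rewrite lee_fin expR_ge0.
- by rewrite lee_fin mulr_ge0 ?expR_ge0.
apply: ge0_le_integral => //.
- by move=> p _; rewrite lee_fin mulr_ge0 ?exprn_ge0 ?cabs_ge0 ?expR_ge0.
- apply/measurable_EFinP; apply: measurable_funM; last exact: measurable_gauss.
  by apply: measurable_funX; exact: measurable_cabs.
- apply/measurable_EFinP; apply: measurable_funM => //; exact: measurable_radial_decay.
move=> p _; rewrite -EFinM lee_fin gaussE.
rewrite (le_trans (ler_wpM2r (expR_ge0 _) (cabsX_le_tlog _ _)))//.
rewrite /B /radial_decay -!expRD ler_expR; move: (tlog _) => t.
have : 0 <= (2 * alpha * `|t - y| - 1) ^+ 2 / (2 * alpha) by rewrite divr_ge0 ?sqr_ge0// mulr_ge0// ltW.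
have -> : (2 * alpha * `|t - y| - 1) ^+ 2 / (2 * alpha) =
    2 * alpha * `|t - y| ^+ 2 - 2 * `|t - y| + 1 / (2 * alpha) by field; rewrite gt_eqF.
rewrite real_normK ?num_real//.
have -> : 2 * alpha * (t - y) ^+ 2 = 2 * (alpha * t ^+ 2) - 2 * (n%:R + 1) * t + (n%:R + 1) ^+ 2 / (2 * alpha).
  by rewrite /y; field; rewrite gt_eqF.
by rewrite natrM; lra.
Qed.

(** Only a square of side a = e^y at the peak is kept. There a <= |z| <= 3 a, so 0 <= t - y <= 2;
    the constant sums 8 alpha from 2 alpha (t - y)^2 and 4 from 2 (t - y). *)
Lemma moment_lower : exists2 c : R, 0 < c &
  forall n, c * expR ((n%:R + 1) ^+ 2 / (2 * alpha)) <= moment n.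
Proof.
exists (expR (- (8 * alpha + 4))) => [|n]; first exact: expR_gt0.
pose y := (n%:R + 1) / (2 * alpha); pose a := expR y.
have y0 : 0 <= y by rewrite divr_ge0// ?addr_ge0// mulr_ge0// ltW.
have a1 : 1 <= a by rewrite -[leLHS]expR0 ler_expR.
have a0 : 0 < a := expR_gt0 y.
pose A : set (R * R) := `[a, 2 * a]%classic `*` `[0, a]%classic.
have mA : measurable A by apply: measurableX; exact: measurable_itv.
have muA : (mu2 A = (a * a)%:E)%E.
  rewrite /A product_measure1E//= !lebesgue_measure_itv/= !lte_fin a0 -!EFinB subr0.
  by rewrite ltr_pMl// ltr1n (_ : 2 * a - a = a)//; ring.
set f := fun p => (cabs (toC p) ^+ (2 * n) * gauss (toC p))%:E.
have mf : measurable_fun [set: R * R] f.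
  apply/measurable_EFinP; apply: measurable_funM; last exact: measurable_gauss.
  by apply: measurable_funX; exact: measurable_cabs.
have f0 p : (0 <= f p)%E by rewrite lee_fin mulr_ge0 ?exprn_ge0 ?cabs_ge0 ?expR_ge0.
rewrite -lee_fin -moment_EFin -/f; apply: (@le_trans _ _ (\int[mu2]_(p in A) f p)%E); last first.
  exact: ge0_subset_integral.
set c := expR (- (8 * alpha + 4)) * expR ((n%:R + 1) ^+ 2 / (2 * alpha)).
have -> : c%:E = (\int[mu2]_(p in A) (cst (c / (a * a))%:E p))%E.
  transitivity ((c / (a * a))%:E * (a * a)%:E)%E.
    by rewrite -EFinM divfK// mulf_neq0// gt_eqF.
  by rewrite -muA; apply/esym; exact: integral_cst.
apply: ge0_le_integral => //.
- by move=> p _; rewrite lee_fin divr_ge0 ?mulr_ge0 ?expR_ge0// ltW.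
- exact: measurable_funTS.
move=> [x x'] [/=]; rewrite !in_itv/= => /andP[xa x2a] /andP[x'0 x'a].
have hz : a <= cabs (toC (x, x')).
  by rewrite (le_trans xa)// (le_trans _ (Re_le_cabs _))//= ler_norm.
have hz' : cabs (toC (x, x')) <= 3 * a.
  rewrite (le_trans (cabs_le_ReIm _))//= ger0_norm ?(le_trans (ltW a0))// ger0_norm//; lra.
have tE := tlog_cabs (le_trans a1 hz).
rewrite /f lee_fin gaussE tE -expRM_natl -expRD.
set t := tlog _; have ty : y <= t by rewrite -ler_expR -tE.
have ty2 : t - y <= 2.
  rewrite lerBlDl -ler_expR -tE (le_trans hz')// expRD mulrC ler_wpM2l ?(ltW a0)//.
  by have := expR_ge1Dx (2 : R); lra.
rewrite /c /a -!expRD -expRN -expRD ler_expR natrM.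
have e1 : 2 * alpha * (t - y) ^+ 2 = 2 * (alpha * t ^+ 2) - 2 * (n%:R + 1) * t + (n%:R + 1) ^+ 2 / (2 * alpha).
  by rewrite /y; field; rewrite gt_eqF.
have e2 : alpha * (t - y) ^+ 2 <= alpha * 2 ^+ 2.
  by rewrite ler_pM2l// lerXn2r ?nnegrE ?subr_ge0.
lra.
Qed.

Lemma moment_gt0 n : 0 < moment n.
Proof. by have [c c0 h] := moment_lower; apply: lt_le_trans (h n); rewrite mulr_gt0 ?expR_gt0. Qed.

End GaussianMoments.

(** * Taylor coefficients in the Hilbert space *)

Section CoefficientBound.
Variables (R : realType) (alpha : R).
Hypothesis alpha_gt0 : 0 < alpha.
Implicit Types (z w u : R[i]) (f : R[i] -> R[i]) (a : nat -> R[i]) (p : R * R).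
Local Notation mu2 := (plane_measure R).

Lemma limn_einf_le (v : nat -> \bar R) (B : \bar R) : (forall n, (v n <= B)%E) ->
  (limn_einf v <= B)%E.
Proof.
move=> h; rewrite limn_einf_lim; apply: lime_le; first exact: is_cvg_einfs.
by apply: nearW => n; apply: le_trans (h n); apply: ereal_inf_lbound; exists n => /=.
Qed.

Lemma fatou_bound (g : nat -> R[i] -> R) (h : R[i] -> R) (B : R) :
  (forall n, measurable_fun [set: R * R] (fun p => g n (toC p))) ->
  (forall n z, 0 <= g n z) -> (forall z, g^~ z @ \oo --> h z) ->
  (forall n, (\int[mu2]_p (g n (toC p))%:E <= B%:E)%E) ->
  (\int[mu2]_p (h (toC p))%:E <= B%:E)%E.
Proof.
move=> mg g0 gh gB.
have -> : (\int[mu2]_p (h (toC p))%:E = \int[mu2]_p limn_einf (fun n => (g n (toC p))%:E))%E.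
  apply: eq_integral => p _; apply/esym.
  by apply: (cvg_limn_einf_sup _).1; apply: cvg_EFin; [exact: nearW|exact: gh].
apply: le_trans (@fatou _ _ R mu2 setT measurableT (fun n p => (g n (toC p))%:E) _ _) _.
- by move=> n; apply/measurable_EFinP; exact: mg.
- by move=> n p _; rewrite lee_fin.
- exact: limn_einf_le.
Qed.

(** The mean over 2^k-th roots of unity isolates the coefficient exactly in the partial sum of
    length k, and the tail is geometrically small. *)
Lemma cmean_coef_cvg a f n z : expands a f ->
  cvgC (fun k => cmean k (fun u => f (u * z) / u ^+ n)) (a n * z ^+ n).
Proof.
move=> [ha af] e e0; set r := cabs z + 1.
have r0 : 0 < r by rewrite ltr_wpDl ?cabs_ge0.
have zr : cabs z < r by rewrite ltrDl.
have [B hB] := ha r (ltW r0).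
have B0 : 0 <= B by rewrite (le_trans _ (hB 0%N))// mulr_ge0 ?cabs_ge0// exprn_ge0// ltW.
set q := cabs z / r; have q0 : 0 <= q by rewrite divr_ge0 ?cabs_ge0// ltW.
have q1 : q < 1 by rewrite ltr_pdivrMr// mul1r.
have [N hN] : exists N, forall k, (N <= k)%N -> B * (q ^+ k / (1 - q)) <= e.
  have : (fun k => B * (q ^+ k / (1 - q))) @ \oo --> B * (0 / (1 - q)).
    apply: cvgM; first exact: cvg_cst.
    by apply: cvgM; [apply: cvg_expr; rewrite ger0_norm|exact: cvg_cst].
  rewrite mul0r mulr0 => /cvgrPdist_le /(_ _ e0)[N _ h]; exists N => k Nk.
  have := h k Nk; rewrite /= sub0r normrN; exact: le_trans (ler_norm _).
exists (maxn N n.+1) => k; rewrite geq_max => /andP[Nk nk].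
pose A w := \sum_(j < k) a j * w ^+ j.
have kk j : (j < k)%N -> (j < 2 ^ k)%N by move=> jk; rewrite (ltn_trans jk)// ltn_expl.
have -> : a n * z ^+ n = cmean k (fun u => A (u * z) / u ^+ n).
  have -> : cmean k (fun u => A (u * z) / u ^+ n) =
      cmean k (fun u => \sum_(j < k) a j * z ^+ j * (u ^+ j / u ^+ n)).
    apply: eq_cmean => u _; rewrite /A mulr_suml; apply: eq_bigr => j _.
    by rewrite exprMn; ring.
  rewrite cmean_sum (bigD1 (Ordinal nk))//= big1 ?addr0; last first.
    by move=> j; rewrite -val_eqE /= => jn; rewrite cmeanZ cmean_orth ?kk// (negPf jn) mulr0.
  by rewrite cmeanZ cmean_orth ?kk// eqxx mulr1.
rewrite -mulN1r -cmeanZ -cmeanD; apply: cmean_le => u u1.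
have uz : cabs (u * z) = cabs z by rewrite cabsM u1 mul1r.
rewrite mulN1r -mulrBl cabs_div cabsX u1 expr1n divr1 (le_trans _ (hN k Nk))//.
by have := power_series_tail k r0 hB (_ : cabs (u * z) < r) (af (u * z)); rewrite uz; apply.
Qed.

Lemma cmean_sqr_le k (F : R[i] -> R[i]) :
  cabs (cmean k F) ^+ 2 <= \sum_(j < 2 ^ k) (2 ^ k)%:R^-1 * cabs (F (unit_root R k ^+ j)) ^+ 2.
Proof.
have N0 : 0 < (2 ^ k)%:R :> R by rewrite ltr0n expn_gt0.
rewrite /cmean cabsM cabsV cabs_nat exprMn -mulr_sumr.
apply: (@le_trans _ _ ((2 ^ k)%:R^-1 ^+ 2 * ((2 ^ k)%:R *
    \sum_(j < 2 ^ k) cabs (F (unit_root R k ^+ j)) ^+ 2))).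
  rewrite ler_wpM2l ?sqr_ge0//.
  apply: (@le_trans _ _ ((\sum_(j < 2 ^ k) cabs (F (unit_root R k ^+ j))) ^+ 2)).
    by rewrite lerXn2r ?nnegrE ?cabs_ge0 ?sumr_ge0// => [j _|]; [exact: cabs_ge0|exact: cabs_sum].
  have := cauchy_schwarz_seq (index_enum 'I_(2 ^ k))
    (fun j => cabs (F (unit_root R k ^+ j))) (fun=> ler01 : 0 <= 1).
  under eq_bigr do rewrite mulr1; move=> /le_trans; apply.
  under [X in _ * X <= _]eq_bigr do rewrite mulr1.
  by rewrite sumr_const card_ord.
by rewrite mulrA expr2 -[_^-1 * _ * _%:R]mulrA mulVf ?gt_eqF// mulr1.
Qed.

(* The means of [f (u z) / u ^+ n] over the roots of unity [u] tend to
   [a n * z ^+ n], and their mean square is at most that of [f] by rotation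
   invariance. *)
Lemma coef_sqnorm a f S n : expands a f -> sqnorm2 (log_weight alpha) f = S%:E ->
  cabs (a n) ^+ 2 * moment alpha n <= S.
Proof.
move=> fa fS; have mf := measC_expands fa.
have mfg u : cabs u = 1 -> measurable_fun [set: R * R]
    (fun p => cabs (f (u * toC p)) ^+ 2 * gauss alpha (toC p)).
  move=> u1; apply: measurable_funM; last exact: measurable_gauss.
  by apply: measurable_funX; exact: measC_cabs (measC_rotate u mf).
pose v k z := cabs (cmean k (fun u => f (u * z) / u ^+ n)) ^+ 2 * gauss alpha z.
pose U k j := unit_root R k ^+ j.
have U1 k j : cabs (U k j) = 1 by rewrite /U cabsX cabs_circle expr1n.
have rot u : cabs u = 1 ->
    (\int[mu2]_p (cabs (f (u * toC p)) ^+ 2 * gauss alpha (toC p))%:E = S%:E)%E.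
  move=> u1; rewrite -fS /sqnorm2.
  transitivity (\int[mu2]_p (cabs (f (toC (rotate u p))) ^+ 2 * gauss alpha (toC (rotate u p)))%:E)%E.
    by apply: eq_integral => p _; rewrite toC_rotate gauss_rotate.
  apply: (@ge0_integral_rotate _ u (fun p => (cabs (f (toC p)) ^+ 2 * gauss alpha (toC p))%:E)) => //.
    apply/measurable_EFinP; have := mfg 1 (cabs1 R).
    by under eq_fun do rewrite mul1r.
  by move=> p; rewrite lee_fin mulr_ge0 ?sqr_ge0 ?expR_ge0.
have mv k : measurable_fun [set: R * R] (fun p => v k (toC p)).
  apply: measurable_funM; last exact: measurable_gauss.
  apply: measurable_funX; apply: (@measC_cabs _ (fun z => cmean k (fun u => f (u * z) / u ^+ n))).
  apply: measCM; first exact: measC_cst.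
  apply: (@measC_sum _ (fun j z => f (U k j * z) / U k j ^+ n)) => j.
  by apply: measCM; [exact: measC_rotate|exact: measC_cst].
have h : (\int[mu2]_p (cabs (a n * toC p ^+ n) ^+ 2 * gauss alpha (toC p))%:E <= S%:E)%E.
  apply: (@fatou_bound v (fun z => cabs (a n * z ^+ n) ^+ 2 * gauss alpha z)).
  - exact: mv.
  - by move=> k z; rewrite mulr_ge0 ?sqr_ge0 ?expR_ge0.
  - move=> z; apply: cvgM; last exact: cvg_cst.
    have := cvgC_cabs (cmean_coef_cvg n z fa) => hc; rewrite expr2.
    by under eq_fun do rewrite expr2; exact: cvgM.
  move=> k; have N0 : 0 < (2 ^ k)%:R :> R by rewrite ltr0n expn_gt0.
  have mt (j : 'I_(2 ^ k)) : measurable_fun [set: R * R] (fun p => (((2 ^ k)%:R^-1)%:E *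
      (cabs (f (U k j * toC p)) ^+ 2 * gauss alpha (toC p))%:E)%E).
    by apply: emeasurable_funM; apply/measurable_EFinP; [exact: measurable_cst|exact: mfg].
  apply: (@le_trans _ _ (\int[mu2]_p (\sum_(j < 2 ^ k) ((2 ^ k)%:R^-1)%:E *
      (cabs (f (U k j * toC p)) ^+ 2 * gauss alpha (toC p))%:E))%E).
    apply: ge0_le_integral => //.
    - by move=> p _; rewrite lee_fin mulr_ge0 ?sqr_ge0 ?expR_ge0.
    - by apply/measurable_EFinP; exact: mv.
    - by apply: emeasurable_sum => j; exact: mt.
    move=> p _; rewrite /v sumEFin lee_fin.
    rewrite (le_trans (ler_wpM2r (expR_ge0 _) (cmean_sqr_le _ _)))// mulr_suml ler_sum// => j _.
    by rewrite -/(U k j) cabs_div cabsX U1 expr1n divr1 -mulrA.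
  rewrite ge0_integral_sum//; last first.
    move=> j p _; rewrite -EFinM lee_fin mulr_ge0 ?invr_ge0 ?ler0n//.
    by rewrite mulr_ge0 ?sqr_ge0 ?expR_ge0.
  rewrite (eq_bigr (fun=> ((2 ^ k)%:R^-1 * S)%:E)) => [|j _]; last first.
    rewrite ge0_integralZl// ?rot// ?lee_fin ?invr_ge0//.
    - by apply/measurable_EFinP; exact: mfg.
    - by move=> p _; rewrite lee_fin mulr_ge0 ?sqr_ge0 ?expR_ge0.
  by rewrite sumEFin lee_fin sumr_const card_ord -[_ *+ _]mulr_natl mulrA mulfV ?gt_eqF// mul1r.
rewrite -lee_fin EFinM -moment_EFin// -ge0_integralZl//; last 3 first.
- apply/measurable_EFinP; apply: measurable_funM; last exact: measurable_gauss.
  by apply: measurable_funX; exact: measurable_cabs.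
- by move=> p _; rewrite lee_fin mulr_ge0 ?exprn_ge0 ?cabs_ge0 ?expR_ge0.
- by rewrite lee_fin sqr_ge0.
apply: le_trans h; rewrite le_eqVlt; apply/orP; left; apply/eqP; apply: eq_integral => p _.
by rewrite -EFinM cabsM cabsX exprMn mulrA -exprM mulnC.
Qed.

Lemma fock2_finite f : fock2 (log_weight alpha) f ->
  exists2 S : R, 0 <= S & sqnorm2 (log_weight alpha) f = S%:E.
Proof.
move=> [_ fS]; have : (0 <= sqnorm2 (log_weight alpha) f)%E.
  by apply: integral_ge0 => p _; rewrite lee_fin mulr_ge0 ?sqr_ge0 ?expR_ge0.
by move: fS; case: (sqnorm2 _ f) => // S _ S0; exists S.
Qed.

(** By [coef_sqnorm] and [moment_lower] the square of the n-th coefficient is O(exp(- (n + 1)^2 / (2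
    alpha))); the square root halves the exponent, which is the case kappa = 1. *)
Lemma fock2_good_coefs a f : fock2 (log_weight alpha) f -> expands a f ->
  exists2 M, 0 <= M & good_coefs alpha 1 a M.
Proof.
move=> /fock2_finite[S S0 fS] fa; have [c c0 hc] := moment_lower alpha_gt0.
exists (Num.sqrt (S / c)) => [|n]; first exact: sqrtr_ge0.
rewrite -(@ler_pXn2r _ 2) ?nnegrE ?cabs_ge0 ?mulr_ge0 ?sqrtr_ge0 ?expR_ge0//.
rewrite exprMn sqr_sqrtr ?divr_ge0 ?(ltW c0)// -expRM_natl.
rewrite (_ : 2%:R * _ = - ((n%:R + 1) ^+ 2 / (2 * alpha))); last by field; rewrite gt_eqF.
rewrite expRN ler_pdivlMr ?expR_gt0// ler_pdivlMr// -mulrA [expR _ * c]mulrC.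
by rewrite (le_trans _ (coef_sqnorm n fa fS))// ler_wpM2l ?sqr_ge0.
Qed.

End CoefficientBound.

Lemma sqr_floor_gap (R : realType) (x m : R) : m <= x -> x < m + 1 -> (x - (m + 1)) ^+ 2 <= 1.
Proof.
move=> mx xm; rewrite -subr_ge0 (_ : 1 - _ = (m + 2 - x) * (x - m)); last by ring.
by rewrite mulr_ge0 ?subr_ge0// (le_trans (ltW xm))// lerD2l ler1n.
Qed.

(** * The reproducing kernel and its diagonal *)

Section ReproducingKernel.
Variables (R : realType) (alpha : R).
Hypothesis alpha_gt0 : 0 < alpha.
Implicit Types (z w u : R[i]) (f g : R[i] -> R[i]) (a b : nat -> R[i]) (p : R * R).
Local Notation mu2 := (plane_measure R).
Local Notation phi := (log_weight alpha).

Lemma good_coefs_entire kappa a M : 0 <= M -> good_coefs alpha kappa a M ->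
  exists2 f, entire f & expands a f.
Proof.
move=> M0 aM; have [C C0 hC] := good_partial_sums kappa alpha_gt0.
pose h k : {poly R[i]} := a k *: 'X^k.
have hs : summable_polys h.
  move=> r r0; exists (C * M * weight alpha kappa r%:C%C) => N.
  apply: le_trans (hC a M M0 aM r%:C%C N); apply: ler_sum => k _.
  rewrite (le_trans (majorantZ _ _ r0))// ler_wpM2l ?cabs_ge0// cabsR ger0_norm//.
  by rewrite (le_trans (majorantXn _ _ r0))// lerXn2r ?nnegrE ?majorant_ge0// majorantX.
exists (fun z => sumC (fun k => (h k).[z])); first exact: poly_series_entire.
split.
  move=> r r0; exists (C * M * weight alpha kappa r%:C%C) => n.
  apply: le_trans (hC a M M0 aM r%:C%C n.+1); rewrite cabsR ger0_norm// big_ord_recr lerDr.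
  by apply: sumr_ge0 => k _; rewrite mulr_ge0 ?cabs_ge0// exprn_ge0.
move=> z; have := poly_series_cvg hs z; congr (cvgC _ _).
by apply/funext => n; apply: eq_bigr => k _; rewrite hornerZ hornerXn.
Qed.

Lemma weight_gauss k1 k2 z : weight alpha k1 z * weight alpha k2 z * gauss alpha z =
  expR (- ((k1 + k2) * tlog z)).
Proof. by rewrite /weight gaussE -!expRD; congr expR; ring. Qed.

(** For kappa = 3 the integrand of the square norm is O(e^(- 6 t)), within the integrable
    [decay4]. *)
Lemma weight_bound_fock2 f a K : entire f -> expands a f ->
  (forall z, cabs (f z) <= K * weight alpha 3 z) -> fock2 phi f.
Proof.
move=> fe fa fK; split => //; have mf := measC_expands fa.
have K0 : 0 <= K by rewrite -(pmulr_lge0 _ (expR_gt0 (alpha * tlog 0 ^+ 2 - 3 * tlog (0 : R[i])))) (le_trans _ (fK 0)) ?cabs_ge0.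
have /integrableP[mi ioo] : mu2.-integrable setT (fun p => ((K ^+ 2)%:E * (decay4 (toC p))%:E)%E).
  exact: integrableZl (integrable_decay4 R).
apply: le_lt_trans ioo; apply: ge0_le_integral => //.
- by move=> p _; rewrite lee_fin mulr_ge0 ?sqr_ge0 ?expR_ge0.
- apply/measurable_EFinP; apply: measurable_funM; last exact: measurable_gauss.
  by apply: measurable_funX; exact: measC_cabs.
- exact: measurableT_comp.
move=> p _; rewrite -EFinM gee0_abs ?lee_fin ?mulr_ge0 ?sqr_ge0 ?expR_ge0//.
rewrite (@le_trans _ _ ((K * weight alpha 3 (toC p)) ^+ 2 * gauss alpha (toC p)))//.
  by rewrite ler_wpM2r ?expR_ge0// lerXn2r ?nnegrE ?cabs_ge0 ?mulr_ge0 ?expR_ge0.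
rewrite exprMn -mulrA ler_wpM2l ?sqr_ge0// [_ ^+ 2]expr2 weight_gauss ler_expR lerN2.
by rewrite ler_wpM2r ?tlog_ge0//; lra.
Qed.

Lemma integralC_sum (h : nat -> R[i] -> R[i]) (K : nat -> R) N : (forall k, decays (h k) (K k)) ->
  decays (fun z => \sum_(k < N) h k z) (\sum_(k < N) K k) /\
  integralC (fun z => \sum_(k < N) h k z) = \sum_(k < N) integralC (h k).
Proof.
move=> hK; elim: N => [|N [IH1 IH2]].
  have -> : (fun z => \sum_(k < 0) h k z) = (fun=> 0) by apply/funext => z; rewrite big_ord0.
  rewrite !big_ord0; split.
    by split; [exact: measC_cst|move=> z; rewrite cabs0 mul0r].
  have d0 : decays (fun _ : R[i] => 0 : R[i]) 0.
    by split; [exact: measC_cst|move=> z; rewrite cabs0 mul0r].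
  by have := integralCZ 0 d0; rewrite !mul0r.
have -> : (fun z => \sum_(k < N.+1) h k z) = (fun z => \sum_(k < N) h k z + h N z).
  by apply/funext => z; rewrite big_ord_recr.
rewrite !big_ord_recr /=; split.
  split; first exact: measCD IH1.1 (hK N).1.
  by move=> z; rewrite mulrDl (le_trans (cabsD _ _))// lerD ?IH1.2// (hK N).2.
by rewrite (integralCD IH1 (hK N)) IH2.
Qed.

Lemma decaysZ f K z : decays f K -> decays (fun w => z * f w) (cabs z * K).
Proof.
move=> [mf fK]; split; first by apply: measCM => //; exact: measC_cst.
by move=> w; rewrite cabsM -mulrA ler_wpM2l ?cabs_ge0.
Qed.

Lemma dot2_partial a b N :
  integralC (fun w => (\sum_(m < N) a m * w ^+ m) * ((\sum_(n < N) b n * w ^+ n)^*)%C *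
     (gauss alpha w)%:C%C) = \sum_(n < N) a n * ((b n)^*)%C * (moment alpha n)%:C%C.
Proof.
pose h m n w := a m * ((b n)^*)%C * monomial_pair alpha m n w.
have dh m n := decaysZ (a m * ((b n)^*)%C) (monomial_pair_decays alpha_gt0 m n).
have hm m := integralC_sum N (dh m).
transitivity (integralC (fun w => \sum_(m < N) \sum_(n < N) h m n w)).
  congr integralC; apply/funext => w.
  have -> : ((\sum_(n < N) b n * w ^+ n)^*)%C = \sum_(n < N) ((b n)^*)%C * ((w ^+ n)^*)%C.
    rewrite (rmorph_sum (@conjc R)); apply: eq_bigr => n _; exact: rmorphM.
  rewrite mulr_suml mulr_suml; apply: eq_bigr => m _.
  rewrite mulr_sumr mulr_suml; apply: eq_bigr => n _.
  by rewrite /h /monomial_pair; ring.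
rewrite (integralC_sum N (fun m => (hm m).1)).2; apply: eq_bigr => m _.
rewrite (hm m).2 (bigD1 m)//= big1 ?addr0.
  by rewrite (integralCZ _ (monomial_pair_decays alpha_gt0 m m)) integralC_monomials// eqxx.
move=> n nm; rewrite (integralCZ _ (monomial_pair_decays alpha_gt0 m n)) integralC_monomials//.
by rewrite eq_sym (negPf nm : (n : nat) == m = false) mulr0.
Qed.

Lemma cvgC_M (u v : nat -> R[i]) z w : cvgC u z -> cvgC v w -> cvgC (fun n => u n * v n) (z * w).
Proof.
move=> uz vw; have vz := cvgC_cabs vw.
have [N hN] := uz 1 ltr01; have uB n : (N <= n)%N -> cabs (u n) <= cabs z + 1.
  move=> Nn; have := cabs_lb (u n) z; have := hN n Nn; lra.
move=> e e0; pose d := e / (2 * (cabs z + 1 + cabs w)).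
have den : 0 < cabs z + 1 + cabs w by rewrite ltr_wpDr ?cabs_ge0// ltr_wpDl ?cabs_ge0.
have d0 : 0 < d by rewrite divr_gt0// mulr_gt0.
have [N1 hN1] := uz d d0; have [N2 hN2] := vw d d0.
exists (maxn N (maxn N1 N2)) => n; rewrite !geq_max => /and3P[h0 h1 h2].
have -> : u n * v n - z * w = u n * (v n - w) + (u n - z) * w by ring.
rewrite (le_trans (cabsD _ _))// !cabsM (@le_trans _ _ ((cabs z + 1) * d + d * cabs w))//.
  by rewrite lerD// ler_pM ?cabs_ge0 ?uB ?hN1 ?hN2.
have -> : (cabs z + 1) * d + d * cabs w = (cabs z + 1 + cabs w) * d by ring.
have -> : (cabs z + 1 + cabs w) * d = e / 2 by rewrite /d; field; rewrite gt_eqF.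
by rewrite ler_pdivrMr// ler_peMr ?(ltW e0)// ler1n.
Qed.

Lemma cvgC_conj (u : nat -> R[i]) z : cvgC u z -> cvgC (fun n => ((u n)^*)%C) ((z^*)%C).
Proof.
move=> uz e e0; have [N hN] := uz e e0; exists N => n Nn.
have -> : ((u n)^*)%C - (z^*)%C = ((u n - z)^*)%C by exact/esym/rmorphB.
by rewrite cabs_conj hN.
Qed.

(** Dominated convergence: kappa = 1 for [f] and 3 for [g] make the products O(e^(- 4 t)), a
    multiple of [decay4]. Taking 1 for both would leave e^(- 2 t), which is not integrable in the
    plane. *)
Lemma dot2_series a b f g M1 M3 : expands a f -> expands b g -> 0 <= M1 -> 0 <= M3 ->
  good_coefs alpha 1 a M1 -> good_coefs alpha 3 b M3 ->
  cvgC (fun N => \sum_(n < N) a n * ((b n)^*)%C * (moment alpha n)%:C%C) (dot2 phi f g).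
Proof.
move=> fa gb M10 M30 aM bM.
have [C1 C10 h1] := good_partial_sums 1 alpha_gt0; have [C3 C30 h3] := good_partial_sums 3 alpha_gt0.
pose h N w := (\sum_(m < N) a m * w ^+ m) * ((\sum_(n < N) b n * w ^+ n)^*)%C * (gauss alpha w)%:C%C.
have mp (c : nat -> R[i]) N : measC (fun w : R[i] => \sum_(m < N) c m * w ^+ m).
  apply: (@measC_sum _ (fun k z => c k * z ^+ k)) => k.
  by apply: measCM; [exact: measC_cst|exact: measCX (measC_id R)].
have bnd (c : nat -> R[i]) N w : cabs (\sum_(m < N) c m * w ^+ m) <= \sum_(m < N) cabs (c m) * cabs w ^+ m.
  by rewrite (le_trans (cabs_sum _ _ _))// ler_sum// => k _; rewrite cabsM cabsX.
have hK N : decays (h N) (C1 * M1 * (C3 * M3)).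
  split.
    apply: measCM; last exact: measC_gauss.
    by apply: measCM => //; exact: measC_conj.
  move=> w; rewrite /h !cabsM cabs_conj cabs_gauss.
  rewrite (@le_trans _ _ ((C1 * M1 * weight alpha 1 w) * (C3 * M3 * weight alpha 3 w) * gauss alpha w))//.
    rewrite ler_wpM2r ?expR_ge0// ler_pM ?cabs_ge0//.
      by rewrite (le_trans (bnd _ _ _))// h1.
    by rewrite (le_trans (bnd _ _ _))// h3.
  have -> : C1 * M1 * weight alpha 1 w * (C3 * M3 * weight alpha 3 w) * gauss alpha w =
     C1 * M1 * (C3 * M3) * (weight alpha 1 w * weight alpha 3 w * gauss alpha w) by ring.
  rewrite weight_gauss /decay4 (_ : 1 + 3 = 4 :> R)//; ring.
have hw w : cvgC (h^~ w) (f w * ((g w)^*)%C * (gauss alpha w)%:C%C).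
  apply: cvgC_M; last exact: cvgC_cst.
  by apply: cvgC_M; [exact: fa.2|apply: cvgC_conj; exact: gb.2].
have [_] := integralC_cvg hK hw; congr (cvgC _ _).
by apply/funext => N; rewrite dot2_partial.
Qed.

Definition kernel_coefs z n := ((z^*)%C) ^+ n * ((moment alpha n)^-1)%:C%C.

(** The inverse moments decay at twice the required Gaussian rate, so at fixed [z] any kappa is
    affordable; 3 is what [dot2_series] asks for. *)
Lemma kernel_coefs_good z : exists2 M, 0 <= M & good_coefs alpha 3 (kernel_coefs z) M.
Proof.
have [c c0 hc] := moment_lower alpha_gt0; pose s := tlog z + 1 / (2 * alpha).
exists (c^-1 * expR (alpha * s ^+ 2 + 7 / (4 * alpha))) => [|n].
  by rewrite mulr_ge0 ?invr_ge0 ?expR_ge0// ltW.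
have m0 := moment_gt0 alpha_gt0 n.
rewrite cabsM cabsX cabs_conj cabsR ger0_norm ?invr_ge0 ?(ltW m0)//.
apply: (@le_trans _ _ (expR (n%:R * tlog z) * (c * expR ((n%:R + 1) ^+ 2 / (2 * alpha)))^-1)).
  rewrite ler_pM ?exprn_ge0 ?cabs_ge0 ?invr_ge0 ?(ltW m0) ?cabsX_le_tlog//.
  by rewrite lef_pV2 ?posrE ?hc// mulr_gt0 ?expR_gt0.
rewrite invfM mulrCA -[leRHS]mulrA ler_wpM2l ?invr_ge0 ?(ltW c0)// -expRN -!expRD ler_expR.
have : 0 <= (n%:R - 2 * alpha * s) ^+ 2 / (4 * alpha) by rewrite divr_ge0 ?sqr_ge0// mulr_ge0// ltW.
move=> h; rewrite -subr_ge0; apply: le_trans h _.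
rewrite le_eqVlt; apply/orP; left; apply/eqP; rewrite /s; field.
by rewrite gt_eqF.
Qed.

Lemma kernel_exists z : exists2 k, is_kernel_at phi z k &
  cvgC (fun N => \sum_(n < N) (cabs z ^+ (2 * n) / moment alpha n)%:C%C) (k z).
Proof.
have [M M0 bM] := kernel_coefs_good z; have [k ke kb] := good_coefs_entire M0 bM.
have [C C0 hC] := good_growth 3 alpha_gt0.
exists k; last first.
  have := kb.2 z; congr (cvgC _ _); apply/funext => N; apply: eq_bigr => n _.
  rewrite /kernel_coefs mulrAC -exprMn [_ * z]mulrC mul_conj [RHS]rmorphM exprM.
  by rewrite [X in _ = X * _]rmorphXn.
split; first by apply: (weight_bound_fock2 ke kb) => w; exact: hC M0 bM kb w.
move=> f ff; have [a fa] := taylor ff.1; have [M1 M10 aM] := fock2_good_coefs alpha_gt0 ff fa.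
apply: (cvgC_unique (fa.2 z)); have := dot2_series fa kb M10 M0 aM bM; congr (cvgC _ _).
apply/funext => N; apply: eq_bigr => n _; rewrite -mulrA; congr (_ * _).
rewrite /kernel_coefs [((_ * _)^*)%C]rmorphM /= conjX conjcK -mulrA.
rewrite -[RHS]mulr1; congr (_ * _).
have m0 := moment_gt0 alpha_gt0 n; apply/eqP; rewrite eq_complex /=.
apply/andP; split; apply/eqP; first by rewrite mulVf ?gt_eqF// mulr0 subr0.
by rewrite mulr0 oppr0 mul0r addr0.
Qed.

(* [k1 z] and [k2 z] are the two scalar products of [k1] and [k2]. *)
Lemma kernel_diagonal z k1 k2 : is_kernel_at phi z k1 -> is_kernel_at phi z k2 ->
  complex.Re (k1 z) = complex.Re (k2 z).
Proof.
move=> [f1 h1] [f2 h2]; rewrite (h2 _ f1) (h1 _ f2) /dot2 /integralC /=.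
apply: eq_Rintegral => p _; case: (k1 _) => a b; case: (k2 _) => c d /=; ring.
Qed.

Lemma repro_kernel_diagonal z : cvgC (fun N => \sum_(n < N) (cabs z ^+ (2 * n) / moment alpha n)%:C%C)
  (complex.Re (repro_kernel phi z z))%:C%C.
Proof.
have [k hk kz] := kernel_exists z.
(* Since a kernel exists, [xget] returns a genuine one and not its default; only its value on the
   diagonal is compared with the explicit series. *)
have hr : is_kernel_at phi z (repro_kernel phi z).
  by rewrite /repro_kernel; exact: (xgetPex (fun=> 0) (ex_intro _ k hk)).
rewrite (kernel_diagonal hr hk).
have h0 N : complex.Im (\sum_(n < N) (cabs z ^+ (2 * n) / moment alpha n)%:C%C) = 0.
  by rewrite -rmorph_sum.
have [_ i0] := cvgC_ReIm kz.
have -> : (complex.Re (k z))%:C%C = k z; last exact: kz.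
suff : complex.Im (k z) = 0 by case: (k z) => x y /= ->.
move: i0; under eq_fun do rewrite h0.
by move=> /cvg_lim <-//; rewrite lim_cst.
Qed.

(** The diagonal series has Gaussian terms around n = 2 alpha t - 1: the full sum gives the upper
    bound, the single term n = floor(2 alpha t) the lower one. The data norm of [interpolation2] is
    thus equivalent to the l2 norm of v / W. *)
Lemma repro_kernel_bounds : exists c C : R, [/\ 0 < c, 0 < C & forall z,
  c * weight alpha 1 z ^+ 2 <= complex.Re (repro_kernel phi z z) <= C * weight alpha 1 z ^+ 2].
Proof.
have [c1 c10 hc1] := moment_lower alpha_gt0; have [C2 C20 hC2] := moment_upper alpha_gt0.
have g0 : 0 < (2 * alpha)^-1 by rewrite invr_gt0 mulr_gt0.
have [C3 C30 hC3] := gaussian_sum 0 g0.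
exists (C2^-1 * expR (- (1 / (2 * alpha)))), (c1^-1 * C3); split.
- by rewrite mulr_gt0 ?invr_gt0 ?expR_gt0.
- by rewrite mulr_gt0 ?invr_gt0.
move=> z; have hk := repro_kernel_diagonal z; set K := complex.Re _ in hk *.
set t := tlog z.
have W2 : weight alpha 1 z ^+ 2 = expR (2 * alpha * t ^+ 2 - 2 * t).
  by rewrite /weight -expRM_natl -/t; congr expR; ring.
have part N : \sum_(n < N) (cabs z ^+ (2 * n) / moment alpha n)%:C%C =
    (\sum_(n < N) cabs z ^+ (2 * n) / moment alpha n)%:C%C by rewrite rmorph_sum.
have t_ge0 n : 0 <= cabs z ^+ (2 * n) / moment alpha n.
  by rewrite divr_ge0 ?exprn_ge0 ?cabs_ge0// ltW// moment_gt0.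
apply/andP; split.
  have at0 : 0 <= 2 * alpha * t by rewrite !mulr_ge0 ?tlog_ge0// ltW.
  have /andP[n1 n2] := truncn_itv at0; set n := Num.truncn _ in n1 n2.
  rewrite -[n.+1%:R]natr1 in n2.
  (* When t = 0 the modulus may be below 1, but then n = 0. *)
  have zn : cabs z ^+ (2 * n) = expR ((2 * n)%:R * t).
    have [t0|t0] := ltP 0 t; first by rewrite (tlog_gt0 t0) expRM_natl.
    have tz : t = 0 by apply/eqP; rewrite eq_le t0 tlog_ge0.
    have -> : n = 0%N.
      by apply/eqP; rewrite -leqn0 -(ler_nat R); move: n1; rewrite tz mulr0.
    by rewrite muln0 expr0 mul0r expR0.
  have low : C2^-1 * expR (- (1 / (2 * alpha))) * weight alpha 1 z ^+ 2 <= cabs z ^+ (2 * n) / moment alpha n.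
    rewrite ler_pdivlMr ?moment_gt0// zn W2.
    apply: le_trans (ler_wpM2l _ (hC2 n)) _; first by rewrite !mulr_ge0 ?invr_ge0 ?(ltW C20) ?expR_ge0.
    have -> : C2^-1 * expR (- (1 / (2 * alpha))) * expR (2 * alpha * t ^+ 2 - 2 * t) *
       (C2 * expR ((n%:R + 1) ^+ 2 / (2 * alpha))) =
       expR (- (1 / (2 * alpha))) * expR (2 * alpha * t ^+ 2 - 2 * t) * expR ((n%:R + 1) ^+ 2 / (2 * alpha)).
      by field; rewrite gt_eqF.
    rewrite -!expRD ler_expR natrM.
    have : (2 * alpha * t - (n%:R + 1)) ^+ 2 / (2 * alpha) <= 1 / (2 * alpha).
      by rewrite ler_pM2r// sqr_floor_gap.
    have -> : (2 * alpha * t - (n%:R + 1)) ^+ 2 / (2 * alpha) =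
      2 * alpha * t ^+ 2 - 2 * (n%:R + 1) * t + (n%:R + 1) ^+ 2 / (2 * alpha) by field; rewrite gt_eqF.
    rewrite -subr_ge0 => h; rewrite -subr_ge0; apply: le_trans h _.
    by rewrite le_eqVlt; apply/orP; left; apply/eqP; ring.
  apply: (le_trans low); apply/ler_addgt0Pl => e e0; have [N hN] := hk e e0.
  have := hN (maxn N n.+1) (leq_maxl _ _); rewrite part -rmorphB cabsR => /ler_normlP[_].
  set s := \sum_(_ < _) _ => sK; apply: (@le_trans _ _ s); last by rewrite -lerBlDr.
  rewrite /s (bigD1 (Ordinal (leq_maxr N n.+1)))//= lerDl.
  by apply: sumr_ge0 => j _; exact: t_ge0.
have := @cvgC_le _ _ _ (c1^-1 * C3 * weight alpha 1 z ^+ 2) 0%N hk.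
rewrite cabsR => h; apply: le_trans (ler_norm _) (h _) => N _.
rewrite part cabsR ger0_norm; last by apply: sumr_ge0.
have W20 : 0 <= c1^-1 * weight alpha 1 z ^+ 2 by rewrite mulr_ge0 ?invr_ge0 ?(ltW c10) ?sqr_ge0.
rewrite mulrAC (le_trans _ (ler_wpM2l W20 (hC3 (2 * alpha * t - 1) N)))// mulr_sumr.
apply: ler_sum => n _; have m0 := moment_gt0 alpha_gt0 n.
apply: (@le_trans _ _ (expR ((2 * n)%:R * t) * (c1 * expR ((n%:R + 1) ^+ 2 / (2 * alpha)))^-1)).
  rewrite ler_pM ?exprn_ge0 ?cabs_ge0 ?invr_ge0 ?(ltW m0) ?cabsX_le_tlog//.
  by rewrite lef_pV2 ?posrE ?hc1// mulr_gt0 ?expR_gt0.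
rewrite W2 invfM -expRN mulrCA -[leRHS]mulrA ler_wpM2l ?invr_ge0 ?(ltW c10)// -!expRD ler_expR.
rewrite le_eqVlt; apply/orP; left; apply/eqP; rewrite natrM; field.
by rewrite gt_eqF.
Qed.

End ReproducingKernel.

(** * The exponent 2 *)

Section HilbertCase.
Variables (R : realType) (alpha : R).
Hypothesis alpha_gt0 : 0 < alpha.
Implicit Types (z w : R[i]) (f v : R[i] -> R[i]) (L : set R[i]).
Local Notation mu2 := (plane_measure R).
Local Notation phi := (log_weight alpha).
Local Notation W := (weight alpha 1).

Lemma interpolation2_l2 L : interpolation2 phi L -> interpolates_l2 alpha 1 L.
Proof.
move=> HL v v0 /esum_fin_bound[B hB].
have [c [C [c0 C0 hk]]] := repro_kernel_bounds alpha_gt0.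
have W0 l : 0 < W l ^+ 2 by rewrite exprn_gt0// expR_gt0.
have k0 l : 0 < complex.Re (repro_kernel phi l l).
  by have /andP[h _] := hk l; rewrite (lt_le_trans _ h)// mulr_gt0.
have [|f ff fv] := HL (fun l => (v l * W l)%:C%C).
  apply: (@le_lt_trans _ _ (c^-1 * B)%:E); last by rewrite ltry.
  apply: esum_le_seq => Z uZ ZL.
  rewrite (le_trans _ (ler_wpM2l _ (hB Z uZ ZL))) ?invr_ge0 ?(ltW c0)//.
  rewrite mulr_sumr ler_sum// => l _; rewrite cabsR ger0_norm ?mulr_ge0 ?expR_ge0//.
  rewrite ler_pdivrMr ?k0// exprMn [leRHS]mulrAC [leRHS]mulrC ler_wpM2l ?sqr_ge0//.
  by rewrite ler_pdivlMl//; have /andP[] := hk l.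
have [a fa] := taylor ff.1; have [M M0 aM] := fock2_good_coefs alpha_gt0 ff fa.
by exists f, a, M.
Qed.

Lemma measC_horner (p : {poly R[i]}) : measC (fun z => p.[z]).
Proof.
rewrite (_ : (fun z => _) = (fun z => \sum_(i < size p) p`_i * z ^+ i)).
  apply: (@measC_sum _ (fun k z => p`_k * z ^+ k)) => k.
  by apply: measCM; [exact: measC_cst|exact: measCX (measC_id R)].
by apply/funext => z; rewrite horner_coef.
Qed.

(** Cauchy-Schwarz with weights exp(- 2 |t - y_k|) bounds the squared sum by [Cy] times the sum of
    the weighted E_k^2. Each bump has integral O(1) by [integral_radial_decay], and Fatou's lemma
    passes from partial sums to the series. *)
Lemma series_fock2 (h : nat -> {poly R[i]}) (E y : nat -> R) (Cy B : R) : summable_polys h ->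
  (forall k, 0 <= E k) -> (forall k, 0 <= y k) ->
  (forall k z, cabs (h k).[z] <= E k * W z * expR (- (2 * `|tlog z - y k|))) ->
  (forall x N, \sum_(k < N) expR (- `|x - y k|) <= Cy) ->
  summable_below (fun k => E k ^+ 2) B ->
  fock2 phi (fun z => sumC (fun k => (h k).[z])).
Proof.
move=> hs E0 y0 hz hy hE; split; first exact: poly_series_entire.
have [C C0 hC] := integral_radial_decay R.
have Cy0 : 0 <= Cy by have := hy 0 0%N; rewrite big_ord0.
apply: (@le_lt_trans _ _ (Cy * (C * B))%:E); last by rewrite ltry.
pose g N z := cabs (\sum_(k < N) (h k).[z]) ^+ 2 * gauss alpha z.
have mg N : measurable_fun [set: R * R] (fun p => g N (toC p)).
  apply: measurable_funM; last exact: measurable_gauss.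
  apply: measurable_funX; apply: (@measC_cabs _ (fun z => \sum_(k < N) (h k).[z])).
  by apply: (@measC_sum _ (fun k z => (h k).[z])) => k; exact: measC_horner.
apply: (@fatou_bound _ g (fun z => cabs (sumC (fun k => (h k).[z])) ^+ 2 * gauss alpha z)) => //.
- by move=> N z; rewrite mulr_ge0 ?sqr_ge0 ?expR_ge0.
- move=> z; apply: cvgM; last exact: cvg_cst.
  have := cvgC_cabs (poly_series_cvg hs z) => hc; rewrite expr2.
  by under eq_fun do rewrite expr2; exact: cvgM.
move=> N.
have mt k : measurable_fun [set: R * R] (fun p => ((Cy * E k ^+ 2)%:E * (radial_decay (y k) p)%:E)%E).
  by apply: emeasurable_funM; apply/measurable_EFinP; [exact: measurable_cst|exact: measurable_radial_decay].
apply: (@le_trans _ _ (\int[mu2]_p (\sum_(k < N) (Cy * E k ^+ 2)%:E * (radial_decay (y k) p)%:E))%E).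
  apply: ge0_le_integral => //.
  - by move=> p _; rewrite lee_fin mulr_ge0 ?sqr_ge0 ?expR_ge0.
  - by apply/measurable_EFinP; exact: mg.
  - by apply: emeasurable_sum => k; exact: mt.
  move=> p _; rewrite sumEFin lee_fin /g; set z := toC p.
  pose e k := expR (- (2 * `|tlog z - y k|)).
  have e0 k : 0 <= e k by exact: expR_ge0.
  have S0 : 0 <= \sum_(k < N) E k * e k by apply: sumr_ge0 => k _; exact: mulr_ge0.
  apply: (@le_trans _ _ ((W z * \sum_(k < N) E k * e k) ^+ 2 * gauss alpha z)).
    rewrite ler_wpM2r ?expR_ge0// lerXn2r ?nnegrE ?cabs_ge0 ?mulr_ge0 ?expR_ge0//.
    rewrite (le_trans (cabs_sum _ _ _))// mulr_sumr ler_sum// => k _.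
    by rewrite (le_trans (hz k z))// /e mulrCA mulrA.
  have -> : (W z * \sum_(k < N) E k * e k) ^+ 2 * gauss alpha z =
      (\sum_(k < N) E k * e k) ^+ 2 * (W z * W z * gauss alpha z) by ring.
  rewrite weight_gauss.
  apply: (@le_trans _ _ (Cy * (\sum_(k < N) E k ^+ 2 * e k) * expR (- ((1 + 1) * tlog z)))).
    rewrite ler_wpM2r ?expR_ge0//.
    have := cauchy_schwarz_seq (index_enum 'I_N) (fun k => E k) (fun k : 'I_N => e0 k) => /le_trans; apply.
    rewrite ler_wpM2r ?sumr_ge0// => [k _|]; first by rewrite mulr_ge0 ?sqr_ge0.
    rewrite (le_trans _ (hy (tlog z) N))// ler_sum// => k _.
    by rewrite ler_expR lerN2 ler_peMl// ler1n.
  rewrite mulr_sumr mulr_suml ler_sum// => k _.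
  rewrite /radial_decay expRD -/z -/(e k) le_eqVlt; apply/orP; left; apply/eqP.
  have -> : (1 + 1) = 2 :> R by [].
  ring.
rewrite ge0_integral_sum//; last first.
  by move=> k p _; rewrite -EFinM lee_fin mulr_ge0 ?expR_ge0// mulr_ge0 ?sqr_ge0.
  by move=> k; exact: mt.
apply: (@le_trans _ _ (\sum_(k < N) (Cy * E k ^+ 2)%:E * C%:E)%E).
  apply: lee_sum => k _; rewrite ge0_integralZl//.
  - by apply: lee_wpmul2l; [rewrite lee_fin mulr_ge0 ?sqr_ge0|exact: hC].
  - by apply/measurable_EFinP; exact: measurable_radial_decay.
  - by move=> p _; rewrite lee_fin expR_ge0.
  - by rewrite lee_fin mulr_ge0 ?sqr_ge0.
rewrite (eq_bigr (fun k : 'I_N => (Cy * E k ^+ 2 * C)%:E)) => [|k _]; last by rewrite EFinM.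
rewrite sumEFin lee_fin -mulr_suml -mulr_sumr -mulrA ler_wpM2l// mulrC ler_wpM2l//.
exact: hE.
Qed.

Lemma sufficiency_2 L (delta b C0 : R) (K : nat) : 0 < delta -> log_separated L delta ->
  shell_bound L K -> 0 <= b -> b < 2 * alpha -> 0 <= C0 -> count_bound L b C0 ->
  interpolation2 phi L.
Proof.
move=> d0 Ld LK b0 ba C00 Lb v /esum_fin_bound[B hB].
have [c [C [c0 C_gt0 hk]]] := repro_kernel_bounds alpha_gt0.
have W0 l : 0 < W l ^+ 2 by rewrite exprn_gt0// expR_gt0.
have k0 l : 0 < complex.Re (repro_kernel phi l l).
  by have /andP[h _] := hk l; rewrite (lt_le_trans _ h)// mulr_gt0.
have vB Z : in_set L Z -> \sum_(l <- Z) (cabs (v l) / W l) ^+ 2 <= C * B.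
  move=> [uZ ZL]; rewrite (le_trans _ (ler_wpM2l (ltW C_gt0) (hB Z uZ ZL)))// mulr_sumr.
  apply: ler_sum => l _; rewrite expr_div_n ler_pdivrMr// mulrAC mulrA ler_pdivlMr//.
  have /andP[_ h] := hk l.
  by rewrite [leRHS]mulrC ler_wpM2l ?sqr_ge0.
have B1 : 0 <= C * B + 1.
  by rewrite addr_ge0//; have := vB [::]; rewrite big_nil; apply; split.
have vW l : L l -> cabs (v l) <= (C * B + 1) * W l.
  move=> Ll; rewrite -ler_pdivrMr ?expR_gt0//.
  have : (cabs (v l) / W l) ^+ 2 <= C * B.
    have := vB [:: l]; rewrite big_seq1; apply; split => // z; rewrite inE => /eqP -> //.
  have := sqr_ge0 (cabs (v l) / W l - 2^-1); move: (cabs (v l) / W l) => q; nra.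
have k01 : 0 <= (1 : R) <= 1 by rewrite ler01 lexx.
have [h [E [y [M [Cy [[hs hi hE hz] [hy hy0 hl2]]]]]]] := interpolating_series alpha_gt0 k01 d0
  Ld LK b0 ba C00 Lb B1 vW.
have [B3 hB3] := hl2 (ex_intro _ (C * B) vB).
exists (fun z => sumC (fun k => (h k).[z])) => //.
apply: (series_fock2 hs _ hy0 hz hy hB3) => k.
by have /andP[] := hE k.
Qed.

End HilbertCase.

Theorem theorem1p6 (R : realType) (alpha : R) (alpha_gt0 : 0 < alpha)
    (p : exponent) :
  (forall L : set R[i], countable L ->
     d_rho_separated alpha L -> (upper_density L < (2 * alpha)%:E)%E ->
     interpolation (log_weight alpha) p L)
  /\
  (forall L : set R[i], countable L ->
     interpolation (log_weight alpha) p L ->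
     d_rho_separated alpha L /\ (upper_density L <= (2 * alpha)%:E)%E).
Proof.
split=> L _.
  move=> /separated_d_rho[d d0 hd] dens.
  have [e e0 Le] := d_rho_log_separated alpha_gt0 d0 hd.
  have [K LK] := separated_shell_bound e0 Le.
  have [b [C [b0 ba C0 Lb]]] := density_count_bound LK dens.
  case: p; first exact: (sufficiency_2 alpha_gt0 e0 Le LK b0 ba C0 Lb).
  exact: (sufficiency_oo alpha_gt0 e0 Le LK b0 ba C0 Lb).
move=> hL; have [kappa hl2] : exists kappa, interpolates_l2 alpha kappa L.
  by case: p hL => hL; [exists 1; exact: interpolation2_l2|exists 0; exact: interpolationoo_l2].
have [d d0 hd] := interpolates_separated alpha_gt0 hl2.
have [e e0 Le] := d_rho_log_separated alpha_gt0 d0 hd.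
have [K LK] := separated_shell_bound e0 Le.
split; first by apply/separated_d_rho; exists d.
exact: (interpolates_density alpha_gt0 hl2 LK).
Qed.
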